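(* Let $M\in\{2,3,4,5,6,7,8,9,10,12,13,16,18,25\}$, let $t$ be the Hauptmodul of $\Gamma_0(M)$ described below, and let $N$ be a positive integer with $\gcd(M,N)=1$. Then there exist polynomials $\Phi_N^{\Gamma_0(M)},\Psi_N^{\Gamma_0(M)}\in\mathbb{Z}[X,Y]$ such that for all $\tau\in\mathbb{H}$ \[ \Phi_N^{\Gamma_0(M)}(X,t(\tau))=\prod_{\substack{a,d>0,\ ad=N\\0\le b<d}}\Bigl(X-t\bigl(\tfrac{a\tau+b}{d}\bigr)\Bigr),\qquad \Psi_N^{\Gamma_0(M)}(X,t(\tau))=\prod_{\substack{a,d>0,\ ad=N\\0\le b<d,\ \gcd(a,b,d)=1}}\Bigl(X-t\bigl(\tfrac{a\tau+b}{d}\bigr)\Bigr). \] Moreover $\deg_X\Phi_N^{\Gamma_0(M)}=\deg_Y\Phi_N^{\Gamma_0(M)}$ and $\deg_X\Psi_N^{\Gamma_0(M)}=\deg_Y\Psi_N^{\Gamma_0(M)}=[\mathrm{SL}_2(\mathbb{Z}):\Gamma_0(N)]$.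
   Context: $\Gamma_0(K)=\{\gamma\in\mathrm{SL}_2(\mathbb{Z}):\gamma\equiv\begin{pmatrix}*&*\\0&*\end{pmatrix}\bmod K\}$. With $\eta(\tau)=q^{1/24}\prod_{n\ge1}(1-q^n)$, $q=e^{2\pi i\tau}$, $t$ is: $M=2$: $\eta(\tau)^{24}/\eta(2\tau)^{24}$; $3$: $\eta(\tau)^{12}/\eta(3\tau)^{12}$; $4$: $\eta(\tau)^8/\eta(4\tau)^8$; $5$: $\eta(\tau)^6/\eta(5\tau)^6$; $6$: $\eta(\tau)^5\eta(3\tau)/(\eta(2\tau)\eta(6\tau)^5)$; $7$: $\eta(\tau)^4/\eta(7\tau)^4$; $8$: $\eta(\tau)^4\eta(4\tau)^2/(\eta(2\tau)^2\eta(8\tau)^4)$; $9$: $\eta(\tau)^3/\eta(9\tau)^3$; $10$: $\eta(\tau)^3\eta(5\tau)/(\eta(2\tau)\eta(10\tau)^3)$; $12$: $\eta(\tau)^3\eta(4\tau)\eta(6\tau)^2/(\eta(2\tau)^2\eta(3\tau)\eta(12\tau)^3)$; $13$: $\eta(\tau)^2/\eta(13\tau)^2$; $16$: $\eta(\tau)^2\eta(8\tau)/(\eta(2\tau)\eta(16\tau)^2)$; $18$: $\eta(\tau)^2\eta(6\tau)\eta(9\tau)/(\eta(2\tau)\eta(3\tau)\eta(18\tau)^2)$; $25$: $\eta(\tau)/\eta(25\tau)$. This $t$ generates the function field of the genus-zero curve $X_0(M)$, has a simple pole at the cusp $\infty$ and is holomorphic elsewhere on $X_0(M)$. *)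

(* Defs.v *)
From mathcomp Require Import all_boot all_order all_algebra.
From mathcomp Require Import all_classical all_reals all_analysis.
From mathcomp.real_closed Require Import complex.

Set Implicit Arguments.
Unset Strict Implicit.
Unset Printing Implicit Defensive.

Import Order.TTheory GRing.Theory Num.Theory.
Import numFieldNormedType.Exports.

Local Open Scope classical_set_scope.
Local Open Scope ring_scope.
Local Open Scope complex_scope.

Definition SL2Z : set 'M[int]_2 := [set g | \det g = 1].

Definition Gamma0 (K : nat) : set 'M[int]_2 :=
  [set g | SL2Z g /\ (K %| g 1%R 0%R)%Z].

Definition right_cosets (G H : set 'M[int]_2) : set (set 'M[int]_2) :=
  [set [set h *m g | h in H] | g in G].

(* In particular the index is finite. *)
Definition has_index (G H : set 'M[int]_2) (n : nat) : Prop :=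
  (right_cosets G H #= `I_n)%card.

Section EtaQuotients.
Variable R : realType.

Definition upper_half_plane : set R[i] := [set tau | 0 < complex.Im tau].

Definition cexp (z : R[i]) : R[i] :=
  (expR (complex.Re z))%:C *
    (cos (complex.Im z) +i* sin (complex.Im z)).

(* cexp_2ipi tau = q, and cexp_2ipi (tau / 24) = q ^ (1 / 24) *)
Definition cexp_2ipi (tau : R[i]) : R[i] := cexp (2 * pi%:C * 'i * tau).

Definition eta (tau : R[i]) : R[i] :=
  cexp_2ipi (tau / 24) *
    lim ((fun n => \prod_(1 <= k < n.+1) (1 - cexp_2ipi tau ^+ k) : R[i]^o)
           @ \oo).

(* Only the values of M listed are relevant; 0 is a dummy value. *)
Definition hauptmodul (M : nat) (tau : R[i]) : R[i] :=
  let e (k : nat) := eta (k%:R * tau) in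
  match M with
  | 2 => e 1 ^+ 24 / e 2 ^+ 24
  | 3 => e 1 ^+ 12 / e 3 ^+ 12
  | 4 => e 1 ^+ 8 / e 4 ^+ 8
  | 5 => e 1 ^+ 6 / e 5 ^+ 6
  | 6 => e 1 ^+ 5 * e 3 / (e 2 * e 6 ^+ 5)
  | 7 => e 1 ^+ 4 / e 7 ^+ 4
  | 8 => e 1 ^+ 4 * e 4 ^+ 2 / (e 2 ^+ 2 * e 8 ^+ 4)
  | 9 => e 1 ^+ 3 / e 9 ^+ 3
  | 10 => e 1 ^+ 3 * e 5 / (e 2 * e 10 ^+ 3)
  | 12 => e 1 ^+ 3 * e 4 * e 6 ^+ 2 / (e 2 ^+ 2 * e 3 * e 12 ^+ 3)
  | 13 => e 1 ^+ 2 / e 13 ^+ 2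
  | 16 => e 1 ^+ 2 * e 8 / (e 2 * e 16 ^+ 2)
  | 18 => e 1 ^+ 2 * e 6 * e 9 / (e 2 * e 3 * e 18 ^+ 2)
  | 25 => e 1 / e 25
  | _ => 0
  end.

(* The product of X - f((a tau + b) / d) over the triples (a, b, d) of natural
   numbers with a, d > 0, a d = N, 0 <= b < d and P a b d. *)
Definition modular_product (P : nat -> nat -> nat -> bool) (N : nat)
    (f : R[i] -> R[i]) (tau : R[i]) : {poly R[i]} :=
  \prod_(1 <= a < N.+1) \prod_(1 <= d < N.+1 | (a * d == N)%N)
    \prod_(0 <= b < d | P a b d)
      ('X - (f ((a%:R * tau + b%:R) / d%:R))%:P).

(* p(X, Y) in Z[X, Y] is represented, as in polyXY, by an element of Z[Y][X];
   specY p y = p(X, y). *)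
Definition specY (p : {poly {poly int}}) (y : R[i]) : {poly R[i]} :=
  map_poly (horner_eval y) (map_poly (map_poly intr) p).

End EtaQuotients.

Definition degX (p : {poly {poly int}}) : nat := (size p).-1.

Definition degY (p : {poly {poly int}}) : nat := (sizeY p).-1.

(* Main.v *)
(* Holomorphic functions on the upper half plane enter through their expansions at the
   cusps, in the form of locally uniform limits of polynomials in q^(1/w).  A function of
   level one that is holomorphic at infinity is constant: the fundamental domain stays away
   from |q| = 1, and Cauchy's estimate makes the oscillation contract.

   An absolutely convergent lattice product for wp(a) - wp(b), evaluated row by row as a
   quotient of theta functions, is compared for tau and -1/tau; at the 2-torsion points
   this gives eta(-1/tau)^12 = - tau^6 eta(tau)^12.  So for g in SL_2(Z), t o g is a constant
   times an explicit eta quotient.  For g in Gamma_0(M) the quotient is t itself, and the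
   constant is 1: this is clear for translations, for elliptic g (evaluate at the fixed
   point) and for many parabolic g, and a descent on the lower left entry, driven by a
   finite certificate for each M, reduces every g to these.

   Since N is prime to M, right multiplication by Gamma_0(M) permutes the Hermite normal
   forms of determinant N up to left multiplication by Gamma_0(M); so the coefficients F of
   the product over the triples (a, b, d) are Gamma_0(M)-invariant and regular at the cusps
   other than infinity.  Taking norms from Z[x] to Z[x^d] shows that q^sigma(N) F has an
   integral expansion.  Subtracting integral multiples of powers of t from F leaves an
   invariant G that vanishes at infinity; for every z the product of z - G over the cosets
   of Gamma_0(M) is constant, so G takes finitely many values and is 0.  The constant
   coefficient in X has leading term +-q^(-sigma(N)), whence the degree in Y.

   Finally Phi_N is the product of the Psi_(N / k^2) over k^2 | N, which gives Psi_N by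
   division, and degrees in X and Y are both additive; Hermite normal forms of diag(N, 1) g
   put the cosets of Gamma_0(N) in bijection with the primitive triples. *)
From Pilot Require Import Defs.
From HB Require Import structures.
From mathcomp Require Import all_boot all_order all_algebra.
From mathcomp Require Import all_classical all_reals all_analysis.
From mathcomp.real_closed Require Import complex.
From mathcomp Require Import ring lra zify.

Set Implicit Arguments.
Unset Strict Implicit.
Unset Printing Implicit Defensive.

Import Order.TTheory GRing.Theory Num.Theory.
Import numFieldNormedType.Exports.

Local Open Scope classical_set_scope.
Local Open Scope ring_scope.
Local Open Scope complex_scope.

(** * Moduli and limits of complex numbers *)

(** Expansions are the property [Hol], whose parameter is the ring of coefficients: over the complex
    numbers it yields the analytic facts, over the integers the same closure lemmas yield
    integrality.

    The differences of wp at the three half periods multiply to a square root of the discriminant,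
    so the twelfth power of eta is what gets transformed, and eta quotients are controlled only up
    to a root of unity; the certificates settle that root of unity without Dedekind sums.

    Psi_N is not built directly, because the norm argument needs, for given a and d, all residues b
    modulo d, and gcd(a, b, d) = 1 breaks this. The division is exact over the integers: the
    polynomials are monic in X, and a polynomial vanishing at all values of t is zero. The degrees
    of Phi_N agree because, over the factorisations N = ad, the sum of the a equals the sum of the
    d: the first is the order of the pole at infinity of the constant coefficient, the second the
    number of triples. *)

Section Modulus.
Variable R : realType.
Implicit Types (z w : R[i]) (x y : R).

Definition modulus z : R := Normc.normc z.
Local Notation nm := modulus.

Lemma modulusE z : `|z| = (nm z)%:C. Proof. by case: z. Qed.

Lemma modulus_ge0 z : 0 <= nm z.
Proof. by case: z => a b; rewrite sqrtr_ge0. Qed.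

Lemma modulus0 : nm 0 = 0. Proof. exact: Normc.normc0. Qed.
Lemma modulus1 : nm 1 = 1. Proof. exact: Normc.normc1. Qed.

Lemma modulus_eq0 z : (nm z == 0) = (z == 0).
Proof. by apply/eqP/eqP => [/Normc.eq0_normc|->] //; rewrite modulus0. Qed.

Lemma modulus_gt0 z : (0 < nm z) = (z != 0).
Proof. by rewrite lt_def modulus_ge0 modulus_eq0 andbT. Qed.

Lemma modulusM : {morph nm : z w / z * w}.
Proof. by move=> z w; rewrite /nm Normc.normcM. Qed.

Lemma modulusV z : nm z^-1 = (nm z)^-1.
Proof. exact: Normc.normcV. Qed.

Lemma modulusN z : nm (- z) = nm z.
Proof. exact: normcN. Qed.

Lemma modulusD z w : nm (z + w) <= nm z + nm w.
Proof. exact: le_normcD. Qed.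

Lemma modulusB z w : nm (z - w) <= nm z + nm w.
Proof. by rewrite -(modulusN w) modulusD. Qed.

Lemma modulusC z w : nm (z - w) = nm (w - z).
Proof. by rewrite -modulusN opprB. Qed.

Lemma modulus_dist z w : nm z - nm w <= nm (z - w).
Proof. by rewrite lerBlDr -{1}(subrK w z) modulusD. Qed.

Lemma modulusX z n : nm (z ^+ n) = nm z ^+ n.
Proof. by elim: n => [|n IHn]; rewrite ?modulus1 // !exprS modulusM IHn. Qed.

Lemma modulus_prod I (r : seq I) (P : pred I) (F : I -> R[i]) :
  nm (\prod_(i <- r | P i) F i) = \prod_(i <- r | P i) nm (F i).
Proof. by apply: (big_morph nm modulusM modulus1). Qed.

Lemma modulus_sum I (r : seq I) (P : pred I) (F : I -> R[i]) :
  nm (\sum_(i <- r | P i) F i) <= \sum_(i <- r | P i) nm (F i).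
Proof.
elim/big_rec2: _ => [|i x z _ le_zx]; first by rewrite modulus0.
by rewrite (le_trans (modulusD _ _)) // lerD2l.
Qed.

Lemma modulus_real x : nm x%:C = `|x|.
Proof. by rewrite /nm /= expr0n addr0 sqrtr_sqr. Qed.

Lemma modulus_nat n : nm n%:R = n%:R.
Proof. by rewrite -(rmorph_nat (real_complex R)) modulus_real ger0_norm. Qed.

Lemma modulus_i : nm 'i = 1.
Proof. by rewrite /nm /= expr0n expr1n add0r sqrtr1. Qed.

Lemma Re_le_modulus z : `|complex.Re z| <= nm z.
Proof. by rewrite -lecR -modulusE normc_ge_Re. Qed.

Lemma Im_le_modulus z : `|complex.Im z| <= nm z.
Proof.
have := Re_le_modulus (z * 'i); rewrite ReiNIm modulusM modulus_i mulr1.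
by rewrite normrN.
Qed.

Lemma modulus_le z : nm z <= `|complex.Re z| + `|complex.Im z|.
Proof.
case: z => a b; have -> : (a +i* b) = a%:C + 'i * b%:C by rewrite [LHS]complexE.
rewrite (le_trans (modulusD _ _)) // modulusM modulus_i mul1r !modulus_real /=.
by rewrite !(mulr0, mul0r, mul1r, subr0, addr0, add0r).
Qed.

Lemma modulus_sqr z : nm z ^+ 2 = complex.Re z ^+ 2 + complex.Im z ^+ 2.
Proof. by case: z => a b; rewrite sqr_sqrtr // addr_ge0 ?sqr_ge0. Qed.

End Modulus.

Section Limits.
Variable R : realType.
Implicit Types (u v : nat -> R[i]) (k l z : R[i]).
Local Notation nm := (@modulus R).

(** Limits with real epsilons; the topological [lim] is met only through [tends_lim], where an
    infinite product is defined by it. *)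
Definition tends u l := forall eps : R, 0 < eps ->
  exists K : nat, forall n, (K <= n)%N -> nm (u n - l) <= eps.

Lemma tends_cst l : tends (fun=> l) l.
Proof. by move=> e e0; exists 0%N => n _; rewrite subrr modulus0 ltW. Qed.

Lemma tends_ext u v l : (forall n, u n = v n) -> tends u l -> tends v l.
Proof. by move=> uv ul e /ul[K h]; exists K => n /h; rewrite uv. Qed.

Lemma tends_ext_from N u v l :
  (forall n, (N <= n)%N -> u n = v n) -> tends u l -> tends v l.
Proof.
move=> uv ul e /ul[K h]; exists (maxn K N) => n; rewrite geq_max.
by case/andP=> /h + Nn; rewrite uv.
Qed.

Lemma tends_comp u l (f : nat -> nat) : (forall n, (n <= f n)%N) ->
  tends u l -> tends (u \o f) l.
Proof. by move=> nf ul e /ul[K h]; exists K => n Kn; apply: h; apply: leq_trans (nf n). Qed.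

Lemma tends_bounded u l : tends u l ->
  exists2 K, forall n, (K <= n)%N -> nm (u n) <= nm l + 1 & True.
Proof.
case/(_ 1 ltr01)=> K h; exists K => // n /h le1.
by have := modulus_dist (u n) l; move: le1; set a := nm _; lra.
Qed.

Lemma tendsD u v k l : tends u k -> tends v l -> tends (fun n => u n + v n) (k + l).
Proof.
move=> uk vl e e0; have e20 : 0 < e / 2 by lra.
have [K hK] := uk _ e20; have [L hL] := vl _ e20.
exists (maxn K L) => n; rewrite geq_max => /andP[/hK a /hL b].
have -> : u n + v n - (k + l) = (u n - k) + (v n - l) by ring.
by rewrite (le_trans (modulusD _ _)) //; lra.
Qed.

Lemma tendsM u v k l : tends u k -> tends v l -> tends (fun n => u n * v n) (k * l).
Proof.
move=> uk vl e e0; have [N hN _] := tends_bounded uk.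
pose A := nm k + nm l + 1.
have A0 : 0 < A by rewrite /A; have := modulus_ge0 k; have := modulus_ge0 l; lra.
have e20 : 0 < e / (2 * A) by rewrite divr_gt0 // mulr_gt0.
have [K hK] := uk _ e20; have [L hL] := vl _ e20.
exists (maxn N (maxn K L)) => n; rewrite !geq_max => /and3P[/hN c /hK a /hL b].
have -> : u n * v n - (k * l) = u n * (v n - l) + (u n - k) * l by ring.
rewrite (le_trans (modulusD _ _)) // !modulusM.
have E : e = e / (2 * A) * A + e / (2 * A) * A by field; rewrite gt_eqF.
rewrite [leRHS]E lerD //.
  rewrite mulrC; apply: ler_pM; rewrite ?modulus_ge0 // (le_trans c) // /A.
  by have := modulus_ge0 l; lra.
apply: ler_pM; rewrite ?modulus_ge0 // /A.
by have := modulus_ge0 k; lra.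
Qed.

Lemma tendsN u l : tends u l -> tends (fun n => - u n) (- l).
Proof.
by move=> ul e /ul[K h]; exists K => n /h; rewrite -opprD modulusN.
Qed.

Lemma tendsV u l : l != 0 -> tends u l -> tends (fun n => (u n)^-1) l^-1.
Proof.
move=> l0 ul e e0; have nl0 : 0 < nm l by rewrite modulus_gt0.
have h20 : 0 < nm l / 2 by rewrite divr_gt0.
have e20 : 0 < e * (nm l ^+ 2 / 2) by rewrite mulr_gt0 // divr_gt0 // exprn_gt0.
have [K hK] := ul _ h20; have [L hL] := ul _ e20.
exists (maxn K L) => n; rewrite !geq_max => /andP[/hK a /hL b].
have hu : nm l / 2 <= nm (u n).
  by have := modulus_dist l (u n); rewrite modulusC; lra.
have un0 : u n != 0 by rewrite -modulus_gt0; lra.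
have -> : (u n)^-1 - l^-1 = - (u n - l) / (u n * l) by field; apply/andP.
rewrite modulusM modulusN modulusV modulusM ler_pdivrMr; last by rewrite mulr_gt0 //; lra.
by apply: (le_trans b); rewrite ler_pM2l //; nra.
Qed.

Lemma tends_prod I (r : seq I) (P : pred I) (F : I -> nat -> R[i]) (L : I -> R[i]) :
  (forall i, P i -> tends (F i) (L i)) ->
  tends (fun n => \prod_(i <- r | P i) F i n) (\prod_(i <- r | P i) L i).
Proof.
move=> h; elim: r => [|i r IHr].
  rewrite big_nil; apply: tends_ext (tends_cst 1) => n; by rewrite big_nil.
rewrite big_cons; case: ifP => Pi.
  by apply: tends_ext (tendsM (h i Pi) IHr) => n; rewrite big_cons Pi.
by apply: tends_ext IHr => n; rewrite big_cons Pi.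
Qed.

Lemma tends_unique u k l : tends u k -> tends u l -> k = l.
Proof.
move=> uk ul; apply/eqP; rewrite -subr_eq0 -modulus_eq0 eq_le modulus_ge0 andbT.
apply/ler_addgt0Pl => e e0; rewrite addr0; have e20 : 0 < e / 2 by lra.
have [K hK] := uk _ e20; have [L hL] := ul _ e20.
have a := hK _ (leq_maxl K L); have b := hL _ (leq_maxr K L).
have -> : k - l = (u (maxn K L) - l) - (u (maxn K L) - k) by ring.
by rewrite (le_trans (modulusB _ _)) //; lra.
Qed.

Lemma tends_le u l (B : R) z N :
  tends u l -> (forall n, (N <= n)%N -> nm (u n - z) <= B) -> nm (l - z) <= B.
Proof.
move=> ul uB; apply/ler_addgt0Pl => e /ul[K hK].
have a := hK _ (leq_maxl K N); have b := uB _ (leq_maxr K N).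
have -> : l - z = (u (maxn K N) - z) - (u (maxn K N) - l) by ring.
by rewrite (le_trans (modulusB _ _)) //; lra.
Qed.

Lemma tends_lim u l : tends u l -> lim ((u : nat -> R[i]^o) @ \oo) = l.
Proof.
move=> ul; apply: cvg_lim; first exact: norm_hausdorff.
apply/cvgrPdist_le => /= e; rewrite ltcE /= => /andP[/eqP ei er].
have [K hK] := ul _ er; exists K => // n /= /hK h.
by rewrite distrC modulusE lecE /= ei eqxx.
Qed.

(** Completeness of the reals is applied to the real and imaginary parts, the two maps [p] that
    respect differences and are bounded by the modulus. *)
Lemma tends_complete u :
  (forall eps : R, 0 < eps -> exists K, forall m n, (K <= m)%N -> (m <= n)%N ->
     nm (u n - u m) <= eps) -> exists l, tends u l.
Proof.
move=> h.
have real (p : R[i] -> R) : (forall z w, p (z - w) = p z - p w) ->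
    (forall z, `|p z| <= nm z) ->
    exists l : R, forall eps : R, 0 < eps ->
      exists K, forall n, (K <= n)%N -> `|p (u n) - l| <= eps.
  move=> pB p_le; have : cvg ((fun n => p (u n)) @ \oo).
    apply/cauchy_cvgP/cauchy_exP => e e0; have [|K hK] := h (e / 2); first lra.
    exists (p (u K)), K => // n /= Kn; rewrite -ball_normE /ball_ /= distrC -pB.
    by rewrite (le_lt_trans (p_le _)) // (le_lt_trans (hK _ _ (leqnn K) Kn)) //; lra.
  case/cvg_ex => l /cvgrPdist_le pl; exists l => e /pl[K _ hK].
  by exists K => n Kn; rewrite distrC; apply: hK.
have [|//|a ha] := real (@complex.Re R); [by case=> ? ? [] ? ?|exact: Re_le_modulus|].
have [|//|b hb] := real (@complex.Im R); [by case=> ? ? [] ? ?|exact: Im_le_modulus|].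
exists (a +i* b) => e e0; have e20 : 0 < e / 2 by lra.
have [K hK] := ha _ e20; have [L hL] := hb _ e20.
exists (maxn K L) => n; rewrite geq_max => /andP[/hK ka /hL lb].
apply: (le_trans (modulus_le _)).
by case: (u n) ka lb => c d /=; lra.
Qed.

End Limits.

(** * Estimates for finite products of factors close to 1 *)

Section ProductBounds.
Variable R : realType.
Local Notation nm := (@modulus R).

Lemma expR_sub1_le (t : R) : expR t - 1 <= t * expR t.
Proof.
have := expR_ge1Dx (- t); rewrite expRN; have := expR_gt0 t.
set E := expR t => E0 h; have := ler_wpM2r (ltW E0) h.
by rewrite mulVf ?gt_eqF //; lra.
Qed.

Lemma modulus_prod1D_le I (r : seq I) (P : pred I) (x : I -> R[i]) :
  nm (\prod_(i <- r | P i) (1 + x i)) <= expR (\sum_(i <- r | P i) nm (x i)).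
Proof.
rewrite modulus_prod expR_sum; apply: ler_prod => i _.
rewrite modulus_ge0 /= (le_trans (modulusD _ _)) // modulus1; exact: expR_ge1Dx.
Qed.

(** Every monomial of the expanded product is bounded by the same monomial in the moduli, and 1 + x
    <= exp x. The induction peels off one factor by (1 + x) p - 1 = (p - 1) + x p. *)
Lemma modulus_prod1D_sub1 I (r : seq I) (P : pred I) (x : I -> R[i]) :
  nm (\prod_(i <- r | P i) (1 + x i) - 1) <=
    expR (\sum_(i <- r | P i) nm (x i)) - 1.
Proof.
elim: r => [|i r IHr]; first by rewrite !big_nil subrr modulus0 expR0 subrr.
rewrite !big_cons; case: ifP => // Pi.
set p := \prod_(_ <- _ | _) _ in IHr *; set s := \sum_(_ <- _ | _) _ in IHr *.
have -> : (1 + x i) * p - 1 = (p - 1) + x i * p by ring.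
rewrite (le_trans (modulusD _ _)) // modulusM expRD.
have ps : nm p <= expR s by exact: modulus_prod1D_le.
have a := expR_ge1Dx (nm (x i)); have x0 := modulus_ge0 (x i).
have := ler_wpM2l x0 ps; have := ler_wpM2r (ltW (expR_gt0 s)) a; lra.
Qed.

(* A finite product of factors 1 + x_i is insensitive to adding factors whose
   total weight is small. *)
Lemma modulus_prod1D_cat I (r s : seq I) (P : pred I) (x : I -> R[i]) (A e : R) :
  \sum_(i <- r | P i) nm (x i) <= A -> \sum_(i <- s | P i) nm (x i) <= e ->
  nm (\prod_(i <- r ++ s | P i) (1 + x i) - \prod_(i <- r | P i) (1 + x i)) <=
    expR A * (e * expR e).
Proof.
move=> rA se; rewrite big_cat /= -[X in _ - X]mulr1 -mulrBr modulusM.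
rewrite ler_pM ?modulus_ge0 ?(le_trans (modulus_prod1D_le _ _ _)) ?ler_expR //.
apply: (le_trans (modulus_prod1D_sub1 _ _ _)).
by apply: le_trans (expR_sub1_le _); rewrite lerD2r ler_expR.
Qed.

End ProductBounds.

(** * The exponential and continuity on the upper half plane *)

Section RealBounds.
Variable R : realType.
Implicit Types x : R.

Lemma sin_mvt x : 0 <= x -> exists2 c, c \in `[0, x] & sin x = cos c * x.
Proof.
move=> x0; have [|c cx] := @MVT_segment R sin cos 0 x x0 (fun y _ => is_derive_sin y).
  by apply: continuous_subspaceT => y; exact: continuous_sin.
by rewrite sin0 !subr0 => sE; exists c.
Qed.

Lemma ler_norm_sin x : `|sin x| <= `|x|.
Proof.
wlog x0 : x / 0 <= x.
  move=> h; have [/h//|xlt0] := leP 0 x.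
  by have := h (- x); rewrite sinN !normrN; apply; lra.
have [c _ ->] := sin_mvt x0; rewrite normrM ler_piMl // ler_norml.
by have [a b] := (cos_geN1 c, cos_le1 c); rewrite a.
Qed.

Lemma cos_half_sin x : cos x = 1 - 2 * sin (x / 2) ^+ 2.
Proof.
have -> : cos x = cos ((x / 2) *+ 2) by congr cos; rewrite mulr2n; lra.
by rewrite cos_mulr2n cos2sin2 mulr2n; ring.
Qed.

Lemma cos_ge_sub_sqr x : 1 - x ^+ 2 / 2 <= cos x.
Proof.
rewrite cos_half_sin lerD2l lerN2.
have : sin (x / 2) ^+ 2 <= (x / 2) ^+ 2.
  by rewrite -real_normK ?num_real // -[leRHS]real_normK ?num_real // lerXn2r ?nnegrE ?ler_norm_sin.
by lra.
Qed.

Lemma sin_sub_bound x : `|sin x - x| <= `|x| * (x ^+ 2 / 2).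
Proof.
wlog x0 : x / 0 <= x.
  move=> h; have [/h//|xlt0] := leP 0 x.
  by have := h (- x); rewrite sinN -opprD !normrN sqrrN; apply; lra.
have [c cx ->] := sin_mvt x0; move: cx; rewrite in_itv /= => /andP[c0 cx].
rewrite -{2}(mul1r x) -mulrBl normrM mulrC ler_wpM2l // ler_norml.
have := cos_ge_sub_sqr c; have := cos_le1 c.
have : c ^+ 2 <= x ^+ 2 by rewrite lerXn2r ?nnegrE.
by have := sqr_ge0 x; lra.
Qed.

(** A crude form of Jordan's inequality: sin x >= x / 2 up to 1 by the mean value theorem, then
    monotonicity up to pi / 2 < 2. It bounds the denominators of the sine product from below. *)
Lemma sin_ge_quarter x : 0 <= x -> x <= pi / 2 -> x / 4 <= sin x.
Proof.
move=> x0 xpi; have p2 := pihalf_lt2 R; have p1 := pihalf_ge1 R.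
have small (y : R) : 0 <= y -> y <= 1 -> y / 2 <= sin y.
  move=> y0 y1; have [c cy ->] := sin_mvt y0; move: cy; rewrite in_itv /= => /andP[c0 cy].
  have := cos_ge_sub_sqr c; have c1 : c ^+ 2 <= 1 by rewrite -(expr1n _ 2) lerXn2r ?nnegrE //; lra.
  by move=> h; rewrite mulrC ler_wpM2r //; lra.
have [x1|x1] := leP x 1; first by have := small _ x0 x1; lra.
have s1 : sin 1 <= sin x by apply: ltW; rewrite ltr_sin ?in_itv /= ?x1 //; lra.
by have := small 1 ler01 (lexx _); lra.
Qed.

Lemma expR_half_le2 x : x <= 1 / 2 -> expR x <= 2.
Proof.
move=> xh; have := expR_ge1Dx (- x); rewrite expRN.
have := expR_gt0 x; set E := expR x => E0 h.
have : 1 / 2 <= E^-1 by lra.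
by rewrite -(ler_pM2r E0) mulVf ?gt_eqF //; lra.
Qed.

Lemma expR_sub1_sub_bound x : `|x| <= 1 / 2 -> `|expR x - 1 - x| <= 2 * x ^+ 2.
Proof.
rewrite ler_norml => /andP[x1 x2]; have a := expR_ge1Dx x; have b := expR_sub1_le x.
have c := expR_half_le2 x2; have E0 := expR_gt0 x; rewrite ger0_norm; last by lra.
by nra.
Qed.

(** Here exp(1/2) >= 3/2 and (3/2)^4 = 81/16 exceeds 5. The bound supplies the ratio 1/5 of the
    contraction in [level_one]. *)
Lemma expRN2_le : expR (- 2) <= 1 / 5 :> R.
Proof.
have h := expR_ge1Dx (1 / 2 : R).
have -> : - 2 = - (1/2 + (1/2 + (1/2 + 1/2))) :> R by lra.
rewrite expRN !expRD; have := expR_gt0 (1 / 2 : R); set E := expR _ in h * => E0.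
rewrite div1r lef_pV2 ?posrE ?mulr_gt0 //; have : (1 + 1/2) * (1 + 1/2) <= E * E by apply: ler_pM; lra.
by move=> h2; have : (1 + 1/2) * (1 + 1/2) * ((1 + 1/2) * (1 + 1/2)) <= E * E * (E * E); [apply: ler_pM; lra|rewrite -!mulrA; lra].
Qed.

End RealBounds.

(* Locked, since otherwise [rewrite exprMn] and the like see through it to the
   product defining [cexp]. *)
HB.lock Definition qexp {R : realType} (z : R[i]) : R[i] := cexp_2ipi z.

Section Exponential.
Variable R : realType.
Implicit Types (z w tau : R[i]) (x y : R).
Local Notation nm := (@modulus R).
Local Notation e := (@qexp R).

Lemma cexpD z w : cexp (z + w) = cexp z * cexp w.
Proof.
case: z w => [a b] [c d]; rewrite /cexp /= expRD cosD sinD.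
by apply/eqP; rewrite eq_complex /=; apply/andP; split; apply/eqP; ring.
Qed.

Lemma cexp0 : cexp (0 : R[i]) = 1.
Proof. by rewrite /cexp /= expR0 cos0 sin0 mul1r. Qed.

Lemma modulus_cexp z : nm (cexp z) = expR (complex.Re z).
Proof.
rewrite /cexp modulusM modulus_real ger0_norm ?expR_ge0 //.
by rewrite /modulus /= cos2Dsin2 sqrtr1 mulr1.
Qed.

Lemma cexp_sub1_sub_bound z : nm z <= 1 / 2 -> nm (cexp z - 1 - z) <= 6 * nm z ^+ 2.
Proof.
have := Re_le_modulus z; have := Im_le_modulus z.
case: z => a b; set r := nm _ => br ar rh; rewrite /= in br ar.
have -> : cexp (a +i* b) - 1 - (a +i* b) =
    (expR a * cos b - 1 - a) +i* (expR a * sin b - b).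
  by apply/eqP; rewrite eq_complex /=; apply/andP; split; apply/eqP; ring.
apply: (le_trans (modulus_le _)) => /=.
have a2 : a ^+ 2 <= r ^+ 2 by rewrite -[leLHS]real_normK ?num_real // lerXn2r ?nnegrE ?modulus_ge0.
have b2 : b ^+ 2 <= r ^+ 2 by rewrite -[leLHS]real_normK ?num_real // lerXn2r ?nnegrE ?modulus_ge0.
have ah : `|a| <= 1 / 2 by lra.
have E1 := expR_sub1_sub_bound ah; have c1 := cos_ge_sub_sqr b; have c2 := cos_le1 b.
have s1 := sin_sub_bound b; have E0 := expR_gt0 a.
have E2 : expR a <= 2 by apply: expR_half_le2; move: ah; rewrite ler_norml; lra.
move: E1 s1 E0 E2 c1 c2; set E := expR a; set c := cos b; set s := sin b => E1 s1 E0 E2 c1 c2.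
have -> : E * c - 1 - a = (E - 1 - a) + E * (c - 1) by ring.
have -> : E * s - b = E * (s - b) + (E - 1 - a) * b + a * b by ring.
have r0 : 0 <= r := modulus_ge0 _.
have t1 : `|E * (c - 1)| <= r ^+ 2.
  rewrite normrM (ger0_norm (ltW E0)) distrC ger0_norm; last by lra.
  by have := ler_pM (ltW E0) (_ : 0 <= 1 - c) E2 (_ : 1 - c <= r ^+ 2 / 2); lra.
have t2 : `|E * (s - b)| <= r ^+ 2 / 2.
  rewrite normrM (ger0_norm (ltW E0)).
  have : `|s - b| <= 1 / 2 * (r ^+ 2 / 2).
    by apply: (le_trans s1); apply: ler_pM; rewrite ?divr_ge0 ?sqr_ge0 //; lra.
  by move=> k; have := ler_pM (ltW E0) (normr_ge0 _) E2 k; lra.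
have t3 : `|(E - 1 - a) * b| <= 2 * r ^+ 2 * (1 / 2).
  by rewrite normrM; apply: ler_pM => //; lra.
have t4 : `|a * b| <= r ^+ 2 by rewrite normrM expr2; apply: ler_pM.
have := ler_normD (E - 1 - a) (E * (c - 1)).
have := ler_normD (E * (s - b) + (E - 1 - a) * b) (a * b).
have := ler_normD (E * (s - b)) ((E - 1 - a) * b).
lra.
Qed.

Lemma e_add z w : e (z + w) = e z * e w.
Proof. by rewrite qexp.unlock /cexp_2ipi mulrDr cexpD. Qed.

Lemma e0 : e 0 = 1. Proof. by rewrite qexp.unlock /cexp_2ipi mulr0 cexp0. Qed.

Lemma e_neq0 z : e z != 0.
Proof. by rewrite -modulus_gt0 qexp.unlock modulus_cexp expR_gt0. Qed.

Lemma eN z : e (- z) = (e z)^-1.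
Proof. by apply: (mulIf (e_neq0 z)); rewrite mulVf ?e_neq0 // -e_add addNr e0. Qed.

Lemma e_sub z w : e (z - w) = e z / e w. Proof. by rewrite e_add eN. Qed.

Lemma e_natM n z : e (n%:R * z) = e z ^+ n.
Proof. by elim: n => [|n IHn]; rewrite ?mul0r ?e0 // mulrS mulrDl mul1r e_add IHn exprS. Qed.

Lemma e_argE z : 2 * (pi : R)%:C * 'i * z = (- (2 * pi * complex.Im z)) +i* (2 * pi * complex.Re z).
Proof.
case: z => a b; have -> : (2 : R[i]) = (2 : R)%:C by rewrite rmorph_nat.
by apply/eqP; rewrite eq_complex /=; apply/andP; split; apply/eqP; ring.
Qed.

Lemma modulus_e z : nm (e z) = expR (- (2 * pi * complex.Im z)).
Proof. by rewrite qexp.unlock modulus_cexp e_argE. Qed.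

Lemma e_real x : e x%:C = cos (2 * pi * x) +i* sin (2 * pi * x).
Proof. by rewrite qexp.unlock /cexp_2ipi e_argE /cexp /= mulr0 oppr0 expR0 mul1r. Qed.

Lemma e_nat n : e n%:R = 1.
Proof.
rewrite -(mulr1 n%:R) e_natM -[1 in X in X ^+ _](rmorph1 (real_complex R)) e_real.
by rewrite mulr1 mulr_natl cos2pi sin2pi -[1 +i* 0]/(1 : R[i]) expr1n.
Qed.

Lemma e_int (m : int) : e m%:~R = 1.
Proof.
by case: m => n; rewrite ?NegzE ?rmorphN /= ?eN -?pmulrn e_nat ?invr1.
Qed.

Lemma e_half : e (1 / 2) = - 1.
Proof.
have -> : (1 / 2 : R[i]) = (1 / 2 : R)%:C by rewrite rmorphM fmorphV rmorph_nat.
rewrite e_real; have -> : 2 * pi * (1 / 2) = pi :> R by field.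
by rewrite cospi sinpi; apply/eqP; rewrite eq_complex /= oppr0 !eqxx.
Qed.

Lemma e_real_eq1 x : 0 <= x -> x < 1 -> e x%:C = 1 -> x = 0.
Proof.
move=> x0 x1; rewrite e_real => -[c1 _]; apply/eqP; apply: contraT => xn0.
(* For 0 < x < 1 the identity cos(2 pi x) = 1 - 2 sin(pi x)^2 gives a cosine below 1. *)
have : 0 < sin (pi * x).
  apply: sin_gt0_pi; rewrite mulr_gt0 ?pi_gt0 ?(lt_def 0 x) ?xn0 //=.
  by rewrite -[X in _ < X]mulr1 ltr_pM2l ?pi_gt0.
have := cos_half_sin (2 * pi * x); rewrite c1.
have -> : 2 * pi * x / 2 = pi * x by field.
move=> h s0; have : 0 < sin (pi * x) ^+ 2 by rewrite exprn_gt0.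
by lra.
Qed.

Lemma e_frac_eq1 (k m : nat) : (0 < m)%N -> e (k%:R / m%:R) = 1 -> (m %| k)%N.
Proof.
move=> m0 h; have mC : m%:R != 0 :> R[i] by rewrite pnatr_eq0 -lt0n.
have mR : 0 < m%:R :> R by rewrite ltr0n.
have h' : e ((k %% m)%:R / m%:R) = 1.
  have : e (k%:R / m%:R) = e ((k %/ m)%:R + (k %% m)%:R / m%:R).
    by congr e; rewrite {1}(divn_eq k m) natrD natrM mulrDl mulfK.
  by rewrite h e_add e_nat mul1r => <-.
have E : ((k %% m)%:R / m%:R : R[i]) = ((k %% m)%:R / m%:R)%:C.
  by rewrite rmorphM fmorphV !rmorph_nat.
rewrite E in h'; have := e_real_eq1 _ _ h'.
rewrite divr_ge0 ?ler0n // ltr_pdivrMr // mul1r ltr_nat ltn_mod m0 => /(_ isT isT)/eqP.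
by rewrite mulf_eq0 invr_eq0 (gt_eqF mR) orbF pnatr_eq0.
Qed.

Lemma modulus_e_lt1 tau : 0 < complex.Im tau -> nm (e tau) < 1.
Proof. by move=> t0; rewrite modulus_e expR_lt1 oppr_lt0 !mulr_gt0 ?pi_gt0. Qed.

Lemma modulus_e_le tau y : y <= complex.Im tau -> nm (e tau) <= expR (- (2 * pi * y)).
Proof. by move=> yt; rewrite modulus_e ler_expR lerN2 ler_pM2l // mulr_gt0 ?pi_gt0. Qed.

Lemma modulus_2pii z : nm (2 * (pi : R)%:C * 'i * z) = 2 * pi * nm z.
Proof.
rewrite !modulusM modulus_i mulr1 modulus_real ger0_norm ?pi_ge0 //.
by rewrite modulus_nat.
Qed.

Lemma e_sub1_sub_bound z : 2 * pi * nm z <= 1 / 2 ->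
  nm (e z - 1 - 2 * (pi : R)%:C * 'i * z) <= 6 * (2 * pi * nm z) ^+ 2.
Proof.
rewrite qexp.unlock -modulus_2pii; exact: cexp_sub1_sub_bound.
Qed.

Lemma e_sub1_bound z : 2 * pi * nm z <= 1 / 2 -> nm (e z - 1) <= 4 * (2 * pi * nm z).
Proof.
rewrite qexp.unlock => h; have := @cexp_sub1_sub_bound (2 * (pi : R)%:C * 'i * z).
rewrite modulus_2pii => /(_ h) k; have := modulusD (cexp_2ipi z - 1 - 2 * pi%:C * 'i * z) (2 * pi%:C * 'i * z).
rewrite subrK modulus_2pii => /le_trans; apply; move: k; rewrite -/(cexp_2ipi z).
set a := nm (_ - _); have : 0 <= 2 * pi * nm z by rewrite mulr_ge0 ?modulus_ge0 ?mulr_ge0 ?pi_ge0.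
by set t := 2 * pi * nm z in h *; nra.
Qed.

End Exponential.

(** * Continuity and connectedness of the upper half plane *)

Section Connectedness.
Variable R : realType.
Implicit Types (tau : R[i]) (f g : R[i] -> R[i]).
Local Notation nm := (@modulus R).
Local Notation H := (@upper_half_plane R).
Local Notation e := (@qexp R).

Definition continuousH f := forall tau, H tau -> forall eps : R, 0 < eps ->
  exists2 d : R, 0 < d & forall tau', H tau' -> nm (tau' - tau) <= d ->
    nm (f tau' - f tau) <= eps.

Lemma continuousH_cst (c : R[i]) : continuousH (fun=> c).
Proof. by move=> t Ht d d0; exists 1 => // *; rewrite subrr modulus0 ltW. Qed.

Lemma continuousH_ext f g : (forall tau, H tau -> f tau = g tau) ->
  continuousH f -> continuousH g.
Proof. by move=> fg cf t Ht d /(cf t Ht)[r r0 h]; exists r => // s Hs; rewrite -!fg //; apply: h. Qed.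

Lemma continuousHM f g : continuousH f -> continuousH g ->
  continuousH (fun tau => f tau * g tau).
Proof.
move=> cf cg t Ht eps eps0.
pose A := nm (f t) + nm (g t) + 1.
have f0 := modulus_ge0 (f t); have g0 := modulus_ge0 (g t).
have A0 : 0 < A by rewrite /A; lra.
have d0 : 0 < eps / (2 * A) by rewrite divr_gt0 // mulr_gt0.
have [a a0 ha] := cf t Ht _ d0; have [b b0 hb] := cg t Ht _ d0; have [c c0 hc] := cf t Ht _ ltr01.
exists (Num.min a (Num.min b c)); first by rewrite !lt_min a0 b0 c0.
move=> s Hs; rewrite !le_min => /and3P[/(ha _ Hs) fa /(hb _ Hs) gb /(hc _ Hs) fc].
have -> : f s * g s - f t * g t = f s * (g s - g t) + (f s - f t) * g t by ring.
rewrite (le_trans (modulusD _ _)) // !modulusM.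
have -> : eps = A * (eps / (2 * A)) + eps / (2 * A) * A by field; rewrite gt_eqF.
apply: lerD; apply: ler_pM; rewrite ?modulus_ge0 // /A; try by lra.
by have := modulus_dist (f s) (f t); lra.
Qed.

Lemma continuousHV f : (forall tau, H tau -> f tau != 0) -> continuousH f ->
  continuousH (fun tau => (f tau)^-1).
Proof.
move=> fn0 cf t Ht eps eps0; have l0 := fn0 t Ht; have nl0 : 0 < nm (f t) by rewrite modulus_gt0.
have h20 : 0 < nm (f t) / 2 by rewrite divr_gt0.
have e20 : 0 < eps * (nm (f t) ^+ 2 / 2) by rewrite mulr_gt0 // divr_gt0 // exprn_gt0.
have [a a0 ha] := cf t Ht _ h20; have [b b0 hb] := cf t Ht _ e20.
exists (Num.min a b); first by rewrite lt_min a0.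
move=> s Hs; rewrite le_min => /andP[/(ha _ Hs) fa /(hb _ Hs) fb].
have hu : nm (f t) / 2 <= nm (f s).
  by have := modulus_dist (f t) (f s); rewrite modulusC; lra.
have un0 : f s != 0 := fn0 s Hs.
have -> : (f s)^-1 - (f t)^-1 = - (f s - f t) / (f s * f t) by field; apply/andP.
rewrite modulusM modulusN modulusV modulusM ler_pdivrMr; last by rewrite mulr_gt0 ?modulus_gt0.
by apply: (le_trans fb); rewrite ler_pM2l //; nra.
Qed.

(** The modulus of f - f(t) along the segment from t to u is a continuous real function with
    finitely many values, so the intermediate value theorem forbids it to leave 0. *)
Lemma continuousH_finite_range f (s : seq R[i]) : continuousH f ->
  (forall tau, H tau -> f tau \in s) -> forall t u, H t -> H u -> f t = f u.
Proof.
move=> cf fs t u Ht Hu; apply/eqP; apply: contraT => ftu.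
(* Clamping the parameter to [0, 1] gives a path defined on the whole real line, so that no
   one-sided continuity arises at the ends. *)
pose cl (x : R) := if x <= 0 then 0 else if 1 <= x then 1 else x.
have cl01 x : 0 <= cl x <= 1.
  by rewrite /cl; case: (leP x 0); case: (leP 1 x) => *; apply/andP; split; lra.
have cl_lip x y : `|cl x - cl y| <= `|x - y|.
  wlog xy : x y / y <= x.
    by move=> h; have [/h//|/ltW/h] := leP y x; rewrite distrC => /le_trans; apply; rewrite distrC.
  rewrite [leRHS]ger0_norm ?subr_ge0 // /cl ler_norml.
  by case: (leP x 0); case: (leP 1 x); case: (leP y 0); case: (leP 1 y) => *; apply/andP; split; lra.
pose p (x : R) : R[i] := t + (cl x)%:C * (u - t).
have Hp x : H (p x).
  rewrite /H /= /p; have := cl01 x; move: Ht Hu; rewrite /H /=.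
  case: t {ftu p} => a b; case: u => c d /= b0 d0 /andP[x0 x1].
  rewrite mul0r addr0; have -> : b + cl x * (d - b) = (1 - cl x) * b + cl x * d by ring.
  have [->|xn] := eqVneq (cl x) 0; first by rewrite mul0r subr0 mul1r addr0.
  by apply: ltr_wpDl; [apply: mulr_ge0; lra|rewrite mulr_gt0 // lt_def xn].
pose g (x : R) := nm (f (p x) - f t).
have cg : forall x : R, {for x, continuous g}.
  move=> x; apply/cvgrPdist_le => /= eps eps0.
  have [d d0 hd] := cf _ (Hp x) _ eps0.
  have k0 : 0 < nm (u - t).
    by rewrite modulus_gt0 subr_eq0; apply: contraNneq ftu => ->.
  exists (d / nm (u - t)) => /= [|y]; first by rewrite divr_gt0.
  move=> xy; have {}xy : `|y - x| <= d / nm (u - t) by rewrite distrC ltW.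
  have : nm (f (p y) - f (p x)) <= eps.
    apply: hd => //; rewrite /p.
    have -> : t + (cl y)%:C * (u - t) - (t + (cl x)%:C * (u - t)) = (cl y - cl x)%:C * (u - t).
      by rewrite rmorphB; ring.
    by rewrite modulusM modulus_real -ler_pdivlMr // (le_trans (cl_lip _ _)).
  have := modulus_dist (f (p y) - f t) (f (p x) - f t).
  have := modulus_dist (f (p x) - f t) (f (p y) - f t).
  rewrite (modulusC (f (p x) - f t)).
  have -> : f (p y) - f t - (f (p x) - f t) = f (p y) - f (p x) by ring.
  by rewrite /g ler_norml; lra.
have g0 : g 0 = 0 by rewrite /g /p /cl lexx mul0r addr0 subrr modulus0.
have g1 : g 1 = nm (f u - f t) by rewrite /g /p /cl lexx leNgt ltr01 /= mul1r [t + _]addrC subrK.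
have g10 : 0 < g 1 by rewrite g1 modulus_gt0 subr_eq0 eq_sym.
pose vals := [seq nm (z - f t) | z <- s].
(* A positive level strictly below every positive value in the finite list. *)
have [v v0 [v1 vn]] : exists2 v, 0 < v & v <= g 1 /\ forall w, w \in vals -> w <= 0 \/ v < w.
  elim: vals => [|w vs [v v0 [v1 vn]]]; first by exists (g 1).
  have [w0|w0] := leP w 0.
    exists v => //; split=> // z; rewrite inE => /orP[/eqP->|/vn]; by [left|].
  exists (Num.min v (w / 2)); first by rewrite lt_min v0 /=; lra.
  split=> [|z]; first by rewrite ge_min v1.
  rewrite inE => /orP[/eqP->|/vn[]]; [right; rewrite gt_min; apply/orP; right; lra|by left|].
  by move=> vz; right; rewrite gt_min vz.
have [||c _ gc] := @IVT R g 0 1 v ler01.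
- by apply: continuous_subspaceT.
- by rewrite g0 (min_l (ltW g10)) (max_r (ltW g10)) ltW.
have : v \in vals by rewrite -gc; apply: (map_f (fun z => nm (z - f t))); apply: fs.
by case/vn; rewrite ?ltxx // leNgt v0.
Qed.

End Connectedness.

(** * Infinite products and Cauchy's estimate *)

Section Geometric.
Variable R : realType.
Implicit Types (rho eps : R).

Lemma expr_small rho A eps : 0 <= rho < 1 -> 0 <= A -> 0 < eps ->
  exists n, forall m, (n <= m)%N -> A * rho ^+ m <= eps.
Proof.
move=> /andP[r0 r1] A0 eps0.
have /cvgrPdist_le : (rho ^+ x @[x --> \oo] --> (0 : R)) by apply: cvg_expr; rewrite ger0_norm.
have d0 : 0 < eps / (A + 1) by rewrite divr_gt0 //; lra.
move=> /(_ _ d0)[n _ h]; exists n => m /h /=; rewrite sub0r normrN ger0_norm ?exprn_ge0 //.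
rewrite ler_pdivlMr; last by lra.
by have := exprn_ge0 m r0; set u := rho ^+ m; lra.
Qed.

Lemma sum_geometric_le rho n m : 0 <= rho < 1 ->
  \sum_(n <= k < m) rho ^+ k <= rho ^+ n / (1 - rho).
Proof.
move=> /andP[r0 r1]; have d0 : 0 < 1 - rho by lra.
rewrite ler_pdivlMr //; have [nm|mn] := leqP n m; last first.
  by rewrite big_geq ?mul0r ?exprn_ge0 // ltnW.
rewrite -(subnKC nm); elim: (m - n)%N => [|k IHk].
  by rewrite addn0 big_geq // mul0r exprn_ge0.
have E j : (\sum_(n <= i < n + j) rho ^+ i) * (1 - rho) = rho ^+ n - rho ^+ (n + j).
  elim: j => [|j IHj]; first by rewrite addn0 big_geq // mul0r subrr.
  by rewrite addnS big_nat_recr ?leq_addr //= mulrDl IHj exprS; ring.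
by rewrite E lerBlDr lerDl exprn_ge0.
Qed.

End Geometric.

Section InfiniteProduct.
Variable R : realType.
Local Notation nm := (@modulus R).
Variables (x : nat -> R[i]) (A rho : R).
Hypotheses (rho01 : 0 <= rho < 1) (A0 : 0 <= A) (x_le : forall k, nm (x k) <= A * rho ^+ k).

Let S : R := A / (1 - rho).
Let P n := \prod_(0 <= k < n) (1 + x k).

Let rhoX0 n : 0 <= rho ^+ n.
Proof. by rewrite exprn_ge0 //; case/andP: rho01. Qed.

Let rhoX1 n : rho ^+ n <= 1.
Proof. by rewrite exprn_ile1 //; case/andP: rho01 => // _ /ltW. Qed.

Let sum_le n m : \sum_(n <= k < m) nm (x k) <= S * rho ^+ n.
Proof.
rewrite (@le_trans _ _ (A * \sum_(n <= k < m) rho ^+ k)) //.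
  by rewrite mulr_sumr; apply: ler_sum_nat => k _.
rewrite /S mulrAC -mulrA; apply: ler_wpM2l => //; exact: sum_geometric_le.
Qed.

Let S0 : 0 <= S.
Proof. by rewrite divr_ge0 // subr_ge0 ltW //; case/andP: rho01. Qed.

Let P_sub n m : (n <= m)%N -> nm (P m - P n) <= expR S * (S * rho ^+ n * expR S).
Proof.
move=> le_nm; have iotaE : index_iota 0 m = index_iota 0 n ++ index_iota n m.
  by rewrite /index_iota !subn0 -{1}(subnKC le_nm) iotaD.
rewrite /P iotaE.
apply: le_trans (modulus_prod1D_cat _ (sum_le n m)) _.
  by have := sum_le 0 n; rewrite expr0 mulr1; apply.
apply: ler_wpM2l; first exact: expR_ge0.
apply: ler_wpM2l; first exact: mulr_ge0.
by rewrite ler_expR ler_piMr.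
Qed.

(** The error bound involves only A and rho, so for factors depending on tau the convergence is
    uniform wherever the same A and rho serve. *)
Lemma infinite_product_cvg : exists2 l, tends P l &
  forall n, nm (l - P n) <= expR S * (S * rho ^+ n * expR S).
Proof.
have C0 : 0 <= expR S * (S * expR S) by apply: mulr_ge0 (expR_ge0 _) (mulr_ge0 S0 (expR_ge0 _)).
have [eps eps0|l hl] := @tends_complete R P.
  have [K hK] := expr_small rho01 C0 eps0; exists K => m n Km mn.
  by apply: le_trans (P_sub mn) _; apply: le_trans (hK m Km); rewrite !mulrA mulrAC.
by exists l => // n; apply: (tends_le hl) (@P_sub n).
Qed.

(** Past an index K the tail product stays within 1/2 of 1, so the limit has modulus at least half
    that of the partial product [P K]. *)
Lemma infinite_product_neq0 l : tends P l -> (forall k, 1 + x k != 0) -> l != 0.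
Proof.
move=> hl x0; have SE0 : 0 <= S * expR S := mulr_ge0 S0 (expR_ge0 _).
have half0 : 0 < 1 / 2 :> R by lra.
have [K hK] := expr_small rho01 SE0 half0.
have Sr : S * rho ^+ K * expR (S * rho ^+ K) <= 1 / 2.
  apply: le_trans (hK K (leqnn K)); rewrite [leRHS]mulrAC.
  apply: ler_wpM2l; first exact: mulr_ge0.
  by rewrite ler_expR ler_piMr.
have PK0 : 0 < nm (P K).
  by rewrite modulus_gt0 /P prodf_seq_neq0; apply/allP => k _ /=; apply: x0.
rewrite -modulus_gt0.
have : nm (l - P K) <= nm (P K) / 2.
  apply: (@tends_le _ P l _ (P K) K) => // n Kn.
  rewrite /P (@big_cat_nat _ _ _ K) //= -/(P K) -[X in _ - X]mulr1 -mulrBr modulusM.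
  rewrite ler_wpM2l ?modulus_ge0 // -[2^-1]div1r; apply: le_trans (modulus_prod1D_sub1 _ _ _) _.
  apply: le_trans (expR_sub1_le _) _; apply: le_trans Sr.
  apply: ler_pM; rewrite ?expR_ge0 ?ler_expR ?sum_le //.
  by apply: sumr_ge0 => k _; apply: modulus_ge0.
by have := modulus_dist (P K) (P K - l); rewrite subKr (modulusC (P K)); lra.
Qed.

End InfiniteProduct.

Section RootsOfUnity.
Variable R : realType.
Local Notation nm := (@modulus R).
Local Notation e := (@qexp R).

Lemma sum_unity_root (m : nat) (u : R[i]) : u ^+ m = 1 -> u != 1 ->
  \sum_(j < m) u ^+ j = 0.
Proof.
move=> um u1; apply/eqP; rewrite -(inj_eq (mulfI (_ : u - 1 != 0))) ?subr_eq0 //.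
by rewrite mulr0 -subrX1 um subrr.
Qed.

Lemma sum_e_frac (m i n : nat) : (i < m)%N -> (n < m)%N ->
  \sum_(j < m) (e (i%:R / m%:R) / e (n%:R / m%:R)) ^+ j = (if i == n then m%:R else 0).
Proof.
move=> im nm'; have m0 : (0 < m)%N by apply: leq_ltn_trans im.
have mC : m%:R != 0 :> R[i] by rewrite pnatr_eq0 -lt0n.
have [->|i_n] := eqVneq i n.
  rewrite divff ?e_neq0 // (eq_bigr (fun=> 1)) ?sumr_const ?card_ord //.
  by move=> j _; rewrite expr1n.
apply: sum_unity_root.
  by rewrite exprMn exprVn -!e_natM !mulrA !(mulrC m%:R) !mulfK // !e_nat divr1.
have wl (a b : nat) : (a < b)%N -> (b < m)%N -> e (a%:R / m%:R) / e (b%:R / m%:R) != 1.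
  move=> ab bm; apply/eqP => h; have : e ((b - a)%N%:R / m%:R) = 1.
    rewrite natrB 1?ltnW // mulrBl e_sub; apply: invr_inj; rewrite invf_div h invr1 //.
  move/(e_frac_eq1 m0)/dvdn_leq; lia.
have [/wl|in'] := ltnP i n; first exact.
apply/eqP => h; have := wl n i; rewrite ltn_neqAle eq_sym i_n in' => /(_ isT im)/eqP; apply.
by apply: invr_inj; rewrite invf_div h invr1.
Qed.

(* Cauchy's estimate, by averaging over roots of unity on the circle of radius |e(iy)|. *)
Lemma poly_coef_le (p : {poly R[i]}) (y B : R) :
  (forall tau, complex.Im tau = y -> nm p.[e tau] <= B) ->
  forall n, nm p`_n * expR (- (2 * pi * y)) ^+ n <= B.
Proof.
(* More nodes than any exponent that occurs, so the discrete average picks out the coefficient of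
   index n alone. *)
move=> pB n; pose m := (size p + n.+1)%N.
have m0 : (0 < m)%N by rewrite /m addnS.
have mR : 0 < m%:R :> R by rewrite ltr0n.
have mC : m%:R != 0 :> R[i] by rewrite pnatr_eq0 -lt0n.
pose r := e (y *i); pose z j := e ((j%:R / m%:R) : R[i]).
have rE : nm r = expR (- (2 * pi * y)) by rewrite modulus_e.
have zC (i j : nat) : z j ^+ i = z i ^+ j by rewrite -!e_natM; congr e; ring.
have E : m%:R * (p`_n * r ^+ n) = \sum_(j < m) p.[e (j%:R / m%:R + y *i)] / z n ^+ j.
  rewrite (eq_bigr (fun j : 'I_m => \sum_(i < m) p`_i * r ^+ i * (z i / z n) ^+ j)); last first.
    move=> j _; rewrite (@horner_coef_wide _ m) ?leq_addr // e_add -/r mulr_suml.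
    by apply: eq_bigr => i _; rewrite -/(z j) !exprMn exprVn (zC i j) !mulrA [_ * r ^+ i]mulrAC.
  have lt_nm : (n < m)%N by rewrite /m addnS ltnS leq_addl.
  rewrite exchange_big (bigD1 (Ordinal lt_nm)) //= -mulr_sumr sum_e_frac // eqxx.
  rewrite big1 ?addr0 => [|i]; first by rewrite mulrC.
  by rewrite -val_eqE /= -mulr_sumr sum_e_frac // => /negPf->; rewrite mulr0.
rewrite -rE -modulusX -modulusM -(ler_pM2l mR) -{1}(modulus_nat R m) -modulusM E.
apply: le_trans (modulus_sum _ _ _) _.
have -> : m%:R * B = \sum_(j < m) B by rewrite sumr_const card_ord mulr_natl.
apply: ler_sum => j _; rewrite modulusM modulusV modulusX.
have -> : nm (z n) = 1.
  rewrite modulus_e (_ : complex.Im _ = 0) ?mulr0 ?oppr0 ?expR0 //.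
  by rewrite -!(rmorph_nat (real_complex R)) -fmorphV -rmorphM.
rewrite expr1n invr1 mulr1 pB //.
by rewrite -!(rmorph_nat (real_complex R)) -fmorphV -rmorphM /= add0r.
Qed.

(** Cauchy's estimate on the line Im = y bounds the k-th term at x by B theta^k; the geometric
    series from k = 1 gives the factor. *)
Lemma horner_sub_coef0_le (p : {poly R[i]}) (y B theta : R) (x : R[i]) :
  (forall tau, complex.Im tau = y -> nm p.[e tau] <= B) -> 0 <= theta < 1 ->
  nm x <= theta * expR (- (2 * pi * y)) ->
  nm (p.[x] - p`_0) <= B * (theta / (1 - theta)).
Proof.
move=> pB th xr; have B0 : 0 <= B by apply: le_trans (pB (y *i) (erefl _)); apply: modulus_ge0.
have [n np] : exists n, (size p <= n.+1)%N by exists (size p).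
rewrite (horner_coef_wide _ np) big_ord_recl expr0 mulr1 addrAC subrr add0r.
apply: le_trans (modulus_sum _ _ _) _.
rewrite (@le_trans _ _ (\sum_(1 <= k < n.+1) B * theta ^+ k)) //; last first.
  rewrite -mulr_sumr ler_wpM2l //; exact: sum_geometric_le.
rewrite big_add1 /= big_mkord; apply: ler_sum => k _.
rewrite modulusM modulusX /= (@le_trans _ _ (nm p`_k.+1 * (theta * expR (- (2 * pi * y))) ^+ k.+1)) //.
  by apply: ler_wpM2l; rewrite ?modulus_ge0 // lerXn2r ?nnegrE ?modulus_ge0 // (le_trans _ xr) ?modulus_ge0.
rewrite exprMn mulrCA mulrC ler_wpM2r ?exprn_ge0 //; first by case/andP: th.
exact: poly_coef_le.
Qed.

End RootsOfUnity.

(** * Expansions in powers of q *)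

Section Holomorphic.
Variables (R : realType) (A : comNzRingType) (f : {rmorphism A -> R[i]}).
Implicit Types (h g : R[i] -> R[i]) (w : nat) (tau : R[i]).
Local Notation nm := (@modulus R).
Local Notation e := (@qexp R).
Local Notation "p ^f" := (map_poly f p).

(* h is a locally uniform limit, in the disc |x| < 1 where x = e(tau / w), of
   polynomials in x with coefficients in the image of A.  This replaces
   absolutely convergent power series in x with coefficients in A. *)
Definition Hol w h := forall y eps : R, 0 < y -> 0 < eps ->
  exists p : {poly A}, forall tau, y <= complex.Im tau ->
    nm (h tau - p^f.[e (tau / w%:R)]) <= eps.

Lemma Hol_ext w h g : (forall tau, 0 < complex.Im tau -> h tau = g tau) ->
  Hol w h -> Hol w g.
Proof.
move=> hg H y eps y0 eps0; have [p hp] := H y eps y0 eps0.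
by exists p => tau yt; rewrite -hg ?hp // (lt_le_trans y0).
Qed.

Lemma Hol_cst w a : Hol w (fun=> f a).
Proof.
move=> y eps y0 eps0; exists a%:P => tau _.
by rewrite map_polyC hornerC subrr modulus0 ltW.
Qed.

Lemma Hol1 w : Hol w (fun=> 1).
Proof. by apply: Hol_ext (Hol_cst w 1) => tau _; rewrite rmorph1. Qed.

Lemma modulus_e_div_le1 w tau : 0 <= complex.Im tau -> nm (e (tau / w%:R)) <= 1.
Proof.
move=> t0; rewrite modulus_e expR_le1 oppr_le0 mulr_ge0 ?mulr_ge0 ?pi_ge0 //.
rewrite -(rmorph_nat (real_complex R)) -fmorphV.
by case: tau t0 => a b /= b0; rewrite mulr0 add0r mulr_ge0 // invr_ge0.
Qed.

Lemma modulus_horner_le (p : {poly R[i]}) x : nm x <= 1 ->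
  nm p.[x] <= \sum_(i < size p) nm p`_i.
Proof.
move=> x1; rewrite horner_coef; apply: le_trans (modulus_sum _ _ _) _.
apply: ler_sum => i _; rewrite modulusM modulusX ler_piMr ?modulus_ge0 //.
by rewrite exprn_ile1 // modulus_ge0.
Qed.

Lemma Hol_bounded w h (y : R) : 0 < y -> Hol w h ->
  exists2 B, 0 <= B & forall tau, y <= complex.Im tau -> nm (h tau) <= B.
Proof.
move=> y0 H; have [p hp] := H y 1 y0 ltr01.
exists (\sum_(i < size p^f) nm (p^f)`_i + 1).
  by rewrite addr_ge0 // sumr_ge0 // => i _; rewrite modulus_ge0.
move=> tau yt; have := hp _ yt.
have := @modulus_horner_le p^f (e (tau / w%:R)) (modulus_e_div_le1 _ _).
move=> /(_ (le_trans (ltW y0) yt)) a b.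
by have := modulus_dist (h tau) p^f.[e (tau / w%:R)]; lra.
Qed.

Lemma HolD w h g : Hol w h -> Hol w g -> Hol w (fun tau => h tau + g tau).
Proof.
move=> Hh Hg y eps y0 eps0; have e20 : 0 < eps / 2 by lra.
have [p hp] := Hh _ _ y0 e20; have [q hq] := Hg _ _ y0 e20.
exists (p + q) => tau yt; rewrite rmorphD hornerD.
have -> : h tau + g tau - (p^f.[e (tau / w%:R)] + q^f.[e (tau / w%:R)]) =
  (h tau - p^f.[e (tau / w%:R)]) + (g tau - q^f.[e (tau / w%:R)]) by ring.
by apply: le_trans (modulusD _ _) _; have := hp _ yt; have := hq _ yt; lra.
Qed.

Lemma HolN w h : Hol w h -> Hol w (fun tau => - h tau).
Proof.
move=> Hh y eps y0 eps0; have [p hp] := Hh _ _ y0 eps0.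
by exists (- p) => tau /hp; rewrite rmorphN hornerN -opprD modulusN.
Qed.

Lemma HolM w h g : Hol w h -> Hol w g -> Hol w (fun tau => h tau * g tau).
Proof.
move=> Hh Hg y eps y0 eps0.
have [B B0 hB] := Hol_bounded y0 Hg.
have d0 : 0 < eps / (2 * (B + 1)) by rewrite divr_gt0 // mulr_gt0 //; lra.
have [p hp] := Hh _ _ y0 d0.
pose C := \sum_(i < size p^f) nm (p^f)`_i.
have C0 : 0 <= C by rewrite sumr_ge0 // => i _; rewrite modulus_ge0.
have d1 : 0 < eps / (2 * (C + 1)) by rewrite divr_gt0 // mulr_gt0 //; lra.
have [q hq] := Hg _ _ y0 d1.
exists (p * q) => tau yt; rewrite rmorphM hornerM.
set x := e (tau / _).
have -> : h tau * g tau - p^f.[x] * q^f.[x] =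
  (h tau - p^f.[x]) * g tau + p^f.[x] * (g tau - q^f.[x]) by ring.
apply: le_trans (modulusD _ _) _; rewrite !modulusM.
have px : nm p^f.[x] <= C.
  by apply: modulus_horner_le; apply: modulus_e_div_le1; apply: le_trans (ltW y0) yt.
have a := ler_pM (modulus_ge0 _) (modulus_ge0 _) (hp _ yt) (hB _ yt).
have b := ler_pM (modulus_ge0 _) (modulus_ge0 _) px (hq _ yt).
have EB : eps / (2 * (B + 1)) * (B + 1) = eps / 2 by field; apply/eqP; lra.
have EC : eps / (2 * (C + 1)) * (C + 1) = eps / 2 by field; apply/eqP; lra.
move: a b; rewrite -/x; move: d0 d1 EB EC.
set u := eps / (2 * (B + 1)); set v := eps / (2 * (C + 1)); nra.
Qed.

Lemma Hol_sum I (r : seq I) (P : pred I) w (F : I -> R[i] -> R[i]) :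
  (forall i, P i -> Hol w (F i)) -> Hol w (fun tau => \sum_(i <- r | P i) F i tau).
Proof.
move=> h; elim: r => [|i r IHr].
  by apply: Hol_ext (Hol_cst w 0) => tau _; rewrite big_nil rmorph0.
case Pi: (P i); last by apply: Hol_ext IHr => tau _; rewrite big_cons Pi.
by apply: Hol_ext (HolD (h i Pi) IHr) => tau _; rewrite big_cons Pi.
Qed.

Lemma Hol_prod I (r : seq I) (P : pred I) w (F : I -> R[i] -> R[i]) :
  (forall i, P i -> Hol w (F i)) -> Hol w (fun tau => \prod_(i <- r | P i) F i tau).
Proof.
move=> h; elim: r => [|i r IHr].
  by apply: Hol_ext (Hol1 w) => tau _; rewrite big_nil.
case Pi: (P i); last by apply: Hol_ext IHr => tau _; rewrite big_cons Pi.
by apply: Hol_ext (HolM (h i Pi) IHr) => tau _; rewrite big_cons Pi.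
Qed.

Lemma HolX w h n : Hol w h -> Hol w (fun tau => h tau ^+ n).
Proof.
move=> H; have := @Hol_prod nat (index_iota 0 n) xpredT w (fun=> h) (fun _ _ => H).
by apply: Hol_ext => tau _; rewrite prodr_const_nat subn0.
Qed.

Lemma Hol_e w : Hol w (fun tau => e (tau / w%:R)).
Proof.
by move=> y eps y0 eps0; exists 'X => tau _; rewrite map_polyX hornerX subrr modulus0 ltW.
Qed.

Lemma Hol_limit w h :
  (forall y eps : R, 0 < y -> 0 < eps -> exists2 g, Hol w g &
     forall tau, y <= complex.Im tau -> nm (h tau - g tau) <= eps) -> Hol w h.
Proof.
move=> H y eps y0 eps0; have e20 : 0 < eps / 2 by lra.
have [g Hg hg] := H _ _ y0 e20; have [p hp] := Hg _ _ y0 e20.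
exists p => tau yt; have a := hg _ yt; have b := hp _ yt.
have -> : h tau - p^f.[e (tau / w%:R)] = (h tau - g tau) + (g tau - p^f.[e (tau / w%:R)]) by ring.
by apply: le_trans (modulusD _ _) _; lra.
Qed.

Definition tends_infty h (c : R[i]) := forall eps : R, 0 < eps ->
  exists Y, forall tau, Y <= complex.Im tau -> nm (h tau - c) <= eps.

Lemma tends_infty_poly (p : {poly R[i]}) w : (0 < w)%N ->
  tends_infty (fun tau => p.[e (tau / w%:R)]) p`_0.
Proof.
move=> w0 eps eps0; have wR : 0 < w%:R :> R by rewrite ltr0n.
pose B := \sum_(i < size p) nm p`_i.
have B0 : 0 <= B by rewrite sumr_ge0 // => i _; rewrite modulus_ge0.
(* Small enough that B th / (1 - th) <= eps. *)
pose th := eps / (2 * B + 2 * eps).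
have D0 : 0 < 2 * B + 2 * eps by lra.
have th0 : 0 < th by rewrite divr_gt0.
have thE : th * (2 * B + 2 * eps) = eps by rewrite /th mulfVK ?gt_eqF.
have th1 : th <= 1 / 2 by rewrite -(ler_pM2r D0) thE; lra.
(* From this height on |e(tau / w)| <= th; Cauchy's estimate is then used on the unit circle, that
   is at y = 0. *)
exists (w%:R * (ln th^-1 / (2 * pi))) => tau tY.
have pB tau' : complex.Im tau' = 0 -> nm p.[e tau'] <= B.
  by move=> t0; apply: modulus_horner_le; rewrite modulus_e t0 mulr0 oppr0 expR0.
have xle : nm (e (tau / w%:R)) <= th * expR (- (2 * pi * 0)).
  rewrite mulr0 oppr0 expR0 mulr1 -[leRHS](@lnK _ th) ?posrE //.
  rewrite modulus_e ler_expR lerNl -lnV ?posrE // mulrC -ler_pdivrMr ?mulr_gt0 ?pi_gt0 //.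
  rewrite -(ler_pM2l wR) (le_trans tY) // -(rmorph_nat (real_complex R)) -fmorphV.
  by case: tau {tY} => a b /=; rewrite mulr0 add0r mulrCA mulfV ?gt_eqF ?mulr1.
apply: le_trans (horner_sub_coef0_le pB _ xle) _; first by apply/andP; split; lra.
rewrite mulrA ler_pdivrMr; last by lra.
by nra.
Qed.

(** Two good approximants are both close to h at a single high point, hence their constant
    coefficients are close; these form a Cauchy sequence, whose limit is the value at infinity. *)
Lemma Hol_tends w h : (0 < w)%N -> Hol w h -> exists c, tends_infty h c.
Proof.
move=> w0 H; have near_p (p : {poly R[i]}) := @tends_infty_poly p w w0.
have [u hu] : exists u : nat -> {poly A}, forall n tau, 1 <= complex.Im tau ->
    nm (h tau - (u n)^f.[e (tau / w%:R)]) <= n.+1%:R^-1.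
  have /choice[u hu] : forall n : nat, exists p : {poly A}, forall tau, 1 <= complex.Im tau ->
    nm (h tau - p^f.[e (tau / w%:R)]) <= n.+1%:R^-1.
    by move=> n; apply: H; rewrite ?invr_gt0.
  by exists u.
have small (eps : R) : 0 < eps -> exists K : nat, forall n, (K <= n)%N -> n.+1%:R^-1 <= eps.
  move=> eps0; have [k hk] : exists k : nat, eps^-1 <= k%:R.
    by exists (Num.Def.archi_bound eps^-1); rewrite ltW // archi_boundP // invr_ge0 ltW.
  exists k => n kn; rewrite -[eps]invrK lef_pV2 ?posrE ?invr_gt0 //.
  by rewrite (le_trans hk) // ler_nat (leq_trans kn).
have [|c hc] := @tends_complete R (fun n => (u n)^f`_0).
  move=> eps eps0; have e40 : 0 < eps / 4 by lra.
  have [K hK] := small _ e40; exists K => m n Km mn.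
  have [Y hY] := near_p (u m)^f _ e40; have [Z hZ] := near_p (u n)^f _ e40.
  pose tau : R[i] := (Num.max 1 (Num.max Y Z)) *i.
  have a : nm (h tau - (u m)^f.[e (tau / w%:R)]) <= eps / 4.
    by apply: le_trans (hu m tau _) (hK m Km); rewrite le_max lexx.
  have b : nm (h tau - (u n)^f.[e (tau / w%:R)]) <= eps / 4.
    by apply: le_trans (hu n tau _) (hK n (leq_trans Km mn)); rewrite le_max lexx.
  have c := hY tau; rewrite !le_max lexx !orbT in c; have {}c := c isT.
  have d := hZ tau; rewrite !le_max lexx !orbT in d; have {}d := d isT.
  have -> : (u n)^f`_0 - (u m)^f`_0 = (h tau - (u m)^f.[e (tau / w%:R)])
    - (h tau - (u n)^f.[e (tau / w%:R)]) + ((u m)^f.[e (tau / w%:R)] - (u m)^f`_0)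
    - ((u n)^f.[e (tau / w%:R)] - (u n)^f`_0) by ring.
  apply: le_trans (modulusB _ _) _; have := modulusD (h tau - (u m)^f.[e (tau / w%:R)]
    - (h tau - (u n)^f.[e (tau / w%:R)])) ((u m)^f.[e (tau / w%:R)] - (u m)^f`_0).
  have := modulusB (h tau - (u m)^f.[e (tau / w%:R)]) (h tau - (u n)^f.[e (tau / w%:R)]).
  by lra.
exists c => eps eps0; have e30 : 0 < eps / 3 by lra.
have [K hK] := small _ e30; have [L hL] := hc _ e30.
pose n := maxn K L; have [Y hY] := near_p (u n)^f _ e30.
exists (Num.max 1 Y) => tau; rewrite ge_max => /andP[/(hu n) a /hY b].
have {}a := le_trans a (hK n (leq_maxl _ _)); have d := hL n (leq_maxr _ _).
have -> : h tau - c = (h tau - (u n)^f.[e (tau / w%:R)]) +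
  ((u n)^f.[e (tau / w%:R)] - (u n)^f`_0) + ((u n)^f`_0 - c) by ring.
apply: le_trans (modulusD _ _) _.
have := modulusD (h tau - (u n)^f.[e (tau / w%:R)]) ((u n)^f.[e (tau / w%:R)] - (u n)^f`_0).
by lra.
Qed.

End Holomorphic.

Section HolomorphicMore.
Variable R : realType.
Implicit Types (h g : R[i] -> R[i]) (w : nat) (tau : R[i]).
Local Notation nm := (@modulus R).
Local Notation e := (@qexp R).
Local Notation H := (@upper_half_plane R).
Local Notation HolC := (Hol (idfun : {rmorphism R[i] -> R[i]})).

Lemma tends_infty_unique h (c d : R[i]) : tends_infty h c -> tends_infty h d -> c = d.
Proof.
move=> hc hd; apply: (@tends_unique _ (fun=> c)); first exact: tends_cst.
move=> eps eps0; exists 0%N => _ _; have e20 : 0 < eps / 2 by lra.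
have [Y hY] := hc _ e20; have [Z hZ] := hd _ e20.
have a := hY ((Num.max Y Z) *i); have b := hZ ((Num.max Y Z) *i).
rewrite /= !le_max !lexx orbT in a b; have {}a := a isT; have {}b := b isT.
have -> : c - d = (h (Num.max Y Z) *i - d) - (h (Num.max Y Z) *i - c) by ring.
by apply: le_trans (modulusB _ _) _; lra.
Qed.

Lemma Hol_approx_coef0 w h (p : {poly R[i]}) (y eps : R) c : (0 < w)%N ->
  tends_infty h c ->
  (forall tau, y <= complex.Im tau -> nm (h tau - p.[e (tau / w%:R)]) <= eps) ->
  nm (p`_0 - c) <= eps.
Proof.
move=> w0 hc hp; apply/ler_addgt0Pl => d d0; have d20 : 0 < d / 2 by lra.
have [Y hY] := hc _ d20; have [Z hZ] := @tends_infty_poly _ p _ w0 _ d20.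
pose tau : R[i] := (Num.max y (Num.max Y Z)) *i.
have a := hp tau; have b := hY tau; have k := hZ tau.
rewrite /= !le_max !lexx !orbT in a b k; have {}a := a isT; have {}b := b isT; have {}k := k isT.
have -> : p`_0 - c = (h tau - c) - (h tau - p.[e (tau / w%:R)]) - (p.[e (tau / w%:R)] - p`_0) by ring.
apply: le_trans (modulusB _ _) _.
by have := modulusB (h tau - c) (h tau - p.[e (tau / w%:R)]); lra.
Qed.

(** Covers changes of width and affine substitutions alike: the old variable is a monomial c x^m in
    the new one. The factor c is the reason for complex coefficients in the conclusion. *)
Lemma Hol_comp (A : comNzRingType) (f : {rmorphism A -> R[i]}) w k m (c : R[i]) (s : R) h g :
  Hol f w h -> 0 < s -> (forall tau, 0 < complex.Im tau -> complex.Im (g tau) = s * complex.Im tau) ->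
  (forall tau, 0 < complex.Im tau -> e (g tau / w%:R) = c * e (tau / k%:R) ^+ m) ->
  HolC k (h \o g).
Proof.
move=> Hh s0 gIm ge y eps y0 eps0.
have [p hp] := Hh (s * y) eps (mulr_gt0 s0 y0) eps0.
exists (map_poly f p \Po (c *: 'X^m)) => tau yt; have t0 := lt_le_trans y0 yt.
rewrite map_poly_id // horner_comp hornerZ hornerXn -ge //.
by apply: hp; rewrite gIm // ler_pM2l.
Qed.

Lemma Hol_widen w k h : (0 < w)%N -> (0 < k)%N -> HolC w h -> HolC (w * k) h.
Proof.
move=> w0 k0 Hh; have wC : w%:R != 0 :> R[i] by rewrite pnatr_eq0 -lt0n.
have kC : k%:R != 0 :> R[i] by rewrite pnatr_eq0 -lt0n.
apply: Hol_ext (@Hol_comp _ _ w (w * k) k 1 1 h id Hh ltr01 _ _) => //= tau t0.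
  by rewrite mul1r.
by rewrite mul1r -e_natM natrM; congr e; field; apply/andP.
Qed.

Lemma Hol_affine (A : comNzRingType) (f : {rmorphism A -> R[i]}) w (a d : nat) (b : R[i]) h :
  (0 < w)%N -> (0 < a)%N -> (0 < d)%N -> complex.Im b = 0 -> Hol f w h ->
  HolC (w * d) (fun tau => h ((a%:R * tau + b) / d%:R)).
Proof.
move=> w0 a0 d0 b0 Hh; have wC : w%:R != 0 :> R[i] by rewrite pnatr_eq0 -lt0n.
have dC : d%:R != 0 :> R[i] by rewrite pnatr_eq0 -lt0n.
have dR : d%:R != 0 :> R by rewrite pnatr_eq0 -lt0n.
apply: (@Hol_comp _ _ w (w * d) a (e (b / d%:R / w%:R)) (a%:R / d%:R) h _ Hh).
- by rewrite divr_gt0 // ltr0n.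
- move=> tau t0; rewrite -!(rmorph_nat (real_complex R)) -fmorphV.
  case: tau b b0 {t0} => [x y] [u v] /= ->; rewrite ?(mul0r, mulr0, addr0, add0r, subr0).
  by rewrite mulrAC.
move=> tau t0; rewrite -e_natM -e_add natrM; congr e.
by field; apply/andP.
Qed.

Lemma continuousHD h g : continuousH h -> continuousH g -> continuousH (fun tau => h tau + g tau).
Proof.
move=> ch cg t Ht eps eps0; have e20 : 0 < eps / 2 by lra.
have [a a0 ha] := ch t Ht _ e20; have [b b0 hb] := cg t Ht _ e20.
exists (Num.min a b); first by rewrite lt_min a0.
move=> s Hs; rewrite le_min => /andP[/(ha _ Hs) x /(hb _ Hs) y].
have -> : h s + g s - (h t + g t) = (h s - h t) + (g s - g t) by ring.
by apply: le_trans (modulusD _ _) _; lra.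
Qed.

Lemma continuousH_e (c : R[i]) : continuousH (fun tau => e (tau * c)).
Proof.
move=> t Ht eps eps0; pose K := 2 * pi * nm c + 1.
have n0 := modulus_ge0 c; have p0 := pi_gt0 R.
have K0 : 0 < K by rewrite /K ltr_wpDl // mulr_ge0 // mulr_ge0 // ltW.
have E0 : 0 < nm (e (t * c)) by rewrite modulus_gt0 e_neq0.
exists (Num.min (1 / 2 / K) (eps / (4 * nm (e (t * c))) / K)).
  by rewrite lt_min !divr_gt0 // mulr_gt0.
move=> s Hs; rewrite le_min !(ler_pdivlMr _ _ K0) => /andP[h1 h2].
have D0 := modulus_ge0 (s - t).
have h3 : 2 * pi * nm ((s - t) * c) <= nm (s - t) * K by rewrite modulusM /K; lra.
have := e_sub1_bound (le_trans h3 h1) => h4.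
have -> : e (s * c) - e (t * c) = e (t * c) * (e ((s - t) * c) - 1).
  by rewrite mulrBr mulr1 -e_add; congr (e _ - _); ring.
rewrite modulusM; apply: le_trans (ler_wpM2l (ltW E0) h4) _.
move: h2; rewrite ler_pdivlMr ?mulr_gt0 // => h2; apply: le_trans h2.
by have := ler_wpM2l (ltW E0) h3; lra.
Qed.

Lemma Hol_continuous (A : comNzRingType) (f : {rmorphism A -> R[i]}) w h :
  Hol f w h -> continuousH h.
Proof.
move=> Hh t Ht eps eps0; have e30 : 0 < eps / 3 by lra.
have y0 : 0 < complex.Im t / 2 by move: Ht; rewrite /upper_half_plane /= => ?; lra.
have [p hp] := Hh _ _ y0 e30.
have cp : continuousH (fun tau => (map_poly f p).[e (tau / w%:R)]).
  elim/poly_ind: (map_poly f p) => [|q c IHq].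
    by apply: continuousH_ext (continuousH_cst 0) => tau _; rewrite horner0.
  apply: continuousH_ext (continuousHD (continuousHM IHq (continuousH_e w%:R^-1)) (continuousH_cst c)).
  by move=> tau _; rewrite hornerMXaddC.
have [d d0 hd] := cp t Ht _ e30; exists (Num.min d (complex.Im t / 2)); first by rewrite lt_min d0.
move=> s Hs; rewrite le_min => /andP[/(hd _ Hs) a b].
have c : complex.Im t / 2 <= complex.Im s.
  have := Im_le_modulus (s - t); case: (s) (t) b {hd a hp y0 Ht Hs} => [? x] [? y] /= b.
  by rewrite ler_norml; lra.
have u := hp _ c; have v : nm (h t - (map_poly f p).[e (t / w%:R)]) <= eps / 3 by apply: hp; lra.
have -> : h s - h t = (h s - (map_poly f p).[e (s / w%:R)]) +
  ((map_poly f p).[e (s / w%:R)] - (map_poly f p).[e (t / w%:R)]) -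
  (h t - (map_poly f p).[e (t / w%:R)]) by ring.
apply: le_trans (modulusB _ _) _.
have := modulusD (h s - (map_poly f p).[e (s / w%:R)])
  ((map_poly f p).[e (s / w%:R)] - (map_poly f p).[e (t / w%:R)]).
by lra.
Qed.

End HolomorphicMore.

(** * Euler's product and eta: nonvanishing, expansions, behaviour at infinity *)

HB.lock Definition euler {R : realType} (tau : R[i]) : R[i] :=
  lim ((fun n => \prod_(1 <= k < n.+1) (1 - qexp tau ^+ k) : R[i]^o) @ \oo).

(* Locked copy of [Defs.eta]: comparing two values of it by unification is very slow. *)
HB.lock Definition dedekind {R : realType} (tau : R[i]) : R[i] := Defs.eta tau.

Section EulerFunction.
Variable R : realType.
Implicit Types (tau : R[i]).
Local Notation nm := (@modulus R).
Local Notation e := (@qexp R).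
Local Notation H := (@upper_half_plane R).

Local Notation eta := (@dedekind R).
Local Notation euler := (@euler R).

Lemma etaE tau : eta tau = e (tau / 24) * euler tau.
Proof. by rewrite dedekind.unlock /Defs.eta euler.unlock qexp.unlock. Qed.

Let rho (y : R) := expR (- (2 * pi * y)).

Let rho01 (y : R) : 0 < y -> 0 <= rho y < 1.
Proof. by move=> y0; rewrite expR_ge0 expR_lt1 oppr_lt0 !mulr_gt0 ?pi_gt0. Qed.

Let qX_le (y : R) tau k : 0 < y -> y <= complex.Im tau -> nm (- e tau ^+ k.+1) <= 1 * rho y ^+ k.
Proof.
move=> y0 yt; have [r0 r1] := andP (rho01 y0); rewrite modulusN modulusX mul1r exprS.
rewrite -[leRHS]mul1r ler_pM ?exprn_ge0 ?modulus_ge0 //.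
  by apply: le_trans (modulus_e_le yt) (ltW r1).
by rewrite lerXn2r ?nnegrE ?modulus_ge0 // modulus_e_le.
Qed.

Lemma euler_tends tau : H tau ->
  tends (fun n => \prod_(0 <= k < n) (1 + - e tau ^+ k.+1)) (euler tau).
Proof.
move=> t0; have [l hl _] := infinite_product_cvg (rho01 t0) ler01 (fun k => qX_le k t0 (lexx _)).
suff -> : euler tau = l by [].
by rewrite euler.unlock; apply: tends_lim; apply: tends_ext hl => n; rewrite big_add1.
Qed.

Lemma one_sub_e_neq0 tau k : H tau -> 1 - e tau ^+ k.+1 != 0.
Proof.
move=> t0; rewrite subr_eq0; apply: contraTneq (modulus_e_lt1 t0) => /(congr1 nm).
rewrite modulus1 modulusX -leNgt => h; rewrite -(@expr_ge1 _ k.+1) ?modulus_ge0 //.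
by rewrite -h.
Qed.

Lemma euler_neq0 tau : H tau -> euler tau != 0.
Proof.
move=> t0; apply: (infinite_product_neq0 (rho01 t0) ler01 (fun k => qX_le k t0 (lexx _))).
  exact: euler_tends.
by move=> k; apply: one_sub_e_neq0.
Qed.

Lemma eta_neq0 tau : H tau -> eta tau != 0.
Proof. by move=> t0; rewrite etaE mulf_neq0 ?e_neq0 ?euler_neq0. Qed.

Section OverA.
Variables (A : comNzRingType) (f : {rmorphism A -> R[i]}).

Lemma Hol_e1 : Hol f 1 e.
Proof. by apply: Hol_ext (Hol_e f 1) => tau _; rewrite divr1. Qed.

Lemma Hol_euler : Hol f 1 euler.
Proof.
apply: Hol_limit => y eps y0 eps0; have [r0 r1] := andP (rho01 y0).
pose S := 1 / (1 - rho y).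
have S0 : 0 <= S by rewrite divr_ge0 //; lra.
have C0 : 0 <= expR S * (S * expR S) by apply: mulr_ge0 (expR_ge0 _) (mulr_ge0 S0 (expR_ge0 _)).
have [n hn] := expr_small (rho01 y0) C0 eps0.
exists (fun tau => \prod_(0 <= k < n) (1 + - e tau ^+ k.+1)).
  by apply: Hol_prod => k _; apply: HolD (Hol1 _ _) (HolN (HolX _ Hol_e1)).
move=> tau yt; have t0 : H tau := lt_le_trans y0 yt.
have [l hl le] := infinite_product_cvg (rho01 y0) ler01 (fun k => qX_le k y0 yt).
rewrite (tends_unique (euler_tends t0) hl); apply: le_trans (le n) _.
by apply: le_trans (hn n (leqnn n)); rewrite -/S !mulrA mulrAC.
Qed.

(** The geometric series in g keeps the coefficients in A. *)
Lemma Hol_inv1B w g : Hol f w g ->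
  (forall y, 0 < y -> exists2 r : R, 0 <= r < 1 & forall tau, y <= complex.Im tau -> nm (g tau) <= r) ->
  Hol f w (fun tau => (1 - g tau)^-1).
Proof.
move=> Hg g1; apply: Hol_limit => y eps y0 eps0.
have [r r01 gr] := g1 y y0; have [r0 r1] := andP r01; have r1' : 0 < 1 - r by lra.
have r2 : 0 <= (1 - r)^-1 by rewrite invr_ge0 ltW.
have [n hn] := expr_small r01 r2 eps0.
exists (fun tau => \sum_(i < n) g tau ^+ i).
  by apply: Hol_sum => i _; apply: HolX.
move=> tau yt; have gt := gr _ yt.
have D0 : 1 - r <= nm (1 - g tau).
  by have := modulus_dist 1 (g tau); rewrite modulus1; lra.
have D1 : 1 - g tau != 0 by rewrite -modulus_gt0; lra.
have -> : (1 - g tau)^-1 - \sum_(i < n) g tau ^+ i = g tau ^+ n / (1 - g tau).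
  apply: (mulIf D1); rewrite mulfVK // mulrBl mulVf // -[1 - g tau]opprB mulrN mulrC -subrX1; ring.
rewrite modulusM modulusV modulusX mulrC.
apply: le_trans (hn n (leqnn n)).
apply: ler_pM; rewrite ?invr_ge0 ?modulus_ge0 ?exprn_ge0 ?modulus_ge0 //.
  by rewrite lef_pV2 ?posrE //; lra.
by rewrite lerXn2r ?nnegrE ?modulus_ge0.
Qed.

(** Inverting an approximant would leave A[x]. Instead each 1 - q^k is inverted by its geometric
    series, and the inverse is written 1 + x_k with x_k = q^k / (1 - q^k), to which the convergence
    of infinite products applies. *)
Lemma Hol_inv_euler : Hol f 1 (fun tau => (euler tau)^-1).
Proof.
apply: Hol_limit => y eps y0 eps0; have [r0 r1] := andP (rho01 y0).
have d0 : 0 < 1 - rho y by lra.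
pose A0 := (1 - rho y)^-1; have A00 : 0 <= A0 by rewrite invr_ge0 ltW.
pose S := A0 / (1 - rho y).
have S0 : 0 <= S by rewrite divr_ge0 // ltW.
have C0 : 0 <= expR S * (S * expR S) by apply: mulr_ge0 (expR_ge0 _) (mulr_ge0 S0 (expR_ge0 _)).
have [n hn] := expr_small (rho01 y0) C0 eps0.
exists (fun tau => \prod_(0 <= k < n) (1 - e tau ^+ k.+1)^-1).
  apply: Hol_prod => k _; apply: Hol_inv1B; first by apply: HolX Hol_e1.
  move=> z z0; exists (rho z); first exact: rho01.
  move=> tau zt; have [a b] := andP (rho01 z0); rewrite modulusX exprS.
  rewrite -[leRHS]mulr1; apply: ler_pM; rewrite ?exprn_ge0 ?modulus_ge0 ?modulus_e_le //.
  by rewrite exprn_ile1 ?modulus_ge0 // (le_trans (modulus_e_le zt)) // ltW.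
move=> tau yt; have t0 : H tau := lt_le_trans y0 yt.
pose x k := e tau ^+ k.+1 / (1 - e tau ^+ k.+1).
have xE k : 1 + x k = (1 - e tau ^+ k.+1)^-1.
  by rewrite /x; field; apply: one_sub_e_neq0.
have x_le k : nm (x k) <= A0 * rho y ^+ k.
  rewrite /x modulusM modulusV mulrC; have := qX_le k y0 yt; rewrite mul1r modulusN => h.
  apply: ler_pM; rewrite ?invr_ge0 ?modulus_ge0 // lef_pV2 ?posrE ?modulus_gt0 ?one_sub_e_neq0 //.
  have := modulus_dist 1 (e tau ^+ k.+1); rewrite modulus1 modulusX exprS => h'.
  suff : nm (e tau) * nm (e tau) ^+ k <= rho y * 1 by lra.
  apply: ler_pM; rewrite ?exprn_ge0 ?modulus_ge0 ?modulus_e_le //.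
  by rewrite exprn_ile1 ?modulus_ge0 // (le_trans (modulus_e_le yt)) // ltW.
have [l hl le] := infinite_product_cvg (rho01 y0) A00 x_le.
have -> : (euler tau)^-1 = l.
  apply: tends_unique hl; apply: tends_ext (tendsV (euler_neq0 t0) (euler_tends t0)) => m.
  by rewrite -prodfV; apply: eq_bigr => k _; rewrite xE.
rewrite (eq_bigr (fun k => 1 + x k)) => [|k _]; last by rewrite xE.
apply: le_trans (le n) _.
by apply: le_trans (hn n (leqnn n)); rewrite -/S !mulrA mulrAC.
Qed.

Lemma Hol_euler_int (k : int) : Hol f 1 (fun tau => euler tau ^ k).
Proof.
case: k => n; first exact: HolX Hol_euler.
by apply: Hol_ext (HolX n.+1 Hol_inv_euler) => tau _; rewrite NegzE -exprnN exprVn.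
Qed.

End OverA.

Lemma tends_infty_e : tends_infty e 0.
Proof.
move=> eps eps0; have [Y hY] := @tends_infty_poly R 'X 1 (ltn0Sn 0) eps eps0.
by exists Y => tau /hY; rewrite hornerX divr1 coefX.
Qed.

Lemma tends_infty_euler : tends_infty euler 1.
Proof.
move=> eps eps0; pose d := Num.min (1 / 2) (eps / (2 * expR 1)).
have E0 := expR_gt0 (1 : R).
have d0 : 0 < d by rewrite lt_min !divr_gt0 ?mulr_gt0.
have [Y hY] := tends_infty_e d0.
exists (Num.max 1 Y) => tau; rewrite ge_max => /andP[t1 /hY]; rewrite subr0 le_min.
move=> /andP[q1 q2]; have t0 : H tau := lt_le_trans ltr01 t1.
apply: (@tends_le _ _ _ _ 1 0 (euler_tends t0)) => n _.
apply: le_trans (modulus_prod1D_sub1 _ _ _) _.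
pose r := nm (e tau); have r0 : 0 <= r := modulus_ge0 _.
have sle : \sum_(0 <= k < n) nm (- e tau ^+ k.+1) <= 2 * r.
  rewrite (@le_trans _ _ (r * \sum_(0 <= k < n) r ^+ k)) //.
    by rewrite mulr_sumr; apply: ler_sum => k _; rewrite modulusN modulusX exprS.
  rewrite mulrC ler_wpM2r // (le_trans (sum_geometric_le _ _ _)) ?r0 //=; first by rewrite -/r in q1; lra.
  by rewrite -/r in q1; rewrite expr0 ler_pdivrMr; lra.
apply: le_trans (expR_sub1_le _) _.
apply: (@le_trans _ _ (2 * r * expR 1)).
  apply: ler_pM; rewrite ?expR_ge0 ?ler_expR //; first by apply: sumr_ge0 => k _; apply: modulus_ge0.
  by rewrite -/r in q1; lra.
by move: q2; rewrite ler_pdivlMr ?mulr_gt0 // -/r; lra.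
Qed.

End EulerFunction.

(** * Functions of level one *)

Section LevelOne.
Variable R : realType.
Implicit Types (h g : R[i] -> R[i]) (w : nat) (tau : R[i]).
Local Notation nm := (@modulus R).
Local Notation e := (@qexp R).
Local Notation H := (@upper_half_plane R).
Local Notation HolC := (Hol (idfun : {rmorphism R[i] -> R[i]})).

Lemma Im_addr tau (x : R) : complex.Im (tau + x%:C) = complex.Im tau.
Proof. by case: tau => a b /=; rewrite addr0. Qed.

Lemma Im_scale tau (x : R) : complex.Im (x%:C * tau) = x * complex.Im tau.
Proof. by case: tau => a b /=; rewrite mul0r addr0. Qed.

Lemma Im_oppV tau : complex.Im (- tau^-1) = complex.Im tau / nm tau ^+ 2.
Proof. by rewrite modulus_sqr; case: tau => a b /=; rewrite opprK. Qed.

Lemma H_neq0 tau : H tau -> tau != 0.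
Proof. by move=> t0; apply: contraTneq t0 => ->; rewrite /upper_half_plane /= ltxx. Qed.

Lemma H_oppV tau : H tau -> H (- tau^-1).
Proof.
move=> t0; rewrite /upper_half_plane /= Im_oppV divr_gt0 ?exprn_gt0 //.
by rewrite modulus_gt0 H_neq0.
Qed.

Lemma intr_C (m : int) : m%:~R = (m%:~R : R)%:C.
Proof. by rewrite rmorph_int. Qed.

Lemma H_addr_int tau (m : int) : H tau -> H (tau + m%:~R).
Proof. by rewrite /upper_half_plane /= intr_C Im_addr. Qed.

Definition invariantT h := forall tau, H tau -> h (tau + 1) = h tau.
Definition invariantS h := forall tau, H tau -> h (- tau^-1) = h tau.

Lemma invariantT_int h tau (m : int) : invariantT h -> H tau -> h (tau + m%:~R) = h tau.
Proof.
move=> hT; have nat_case n t : H t -> h (t + n%:R) = h t.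
  elim: n => [|n IHn] Ht; first by rewrite addr0.
  by rewrite -natr1 addrA hT ?IHn //; have := @H_addr_int t n Ht; rewrite -pmulrn.
case: m => n Ht; first by rewrite -pmulrn nat_case.
have := @H_addr_int tau (Negz n) Ht; rewrite NegzE rmorphN /= -pmulrn => Ht'.
by rewrite -[in RHS](subrK n.+1%:R tau) nat_case.
Qed.

(** As long as Im tau < 3/4, a translation to |Re tau| <= 1/2 gives |tau|^2 <= 9/16 + 1/4 = 13/16,
    and -1/tau then raises the height by a factor of at least 16/13. The induction is on an n with
    (13/16)^n <= Im tau. The value 3/4 is a rational number below sqrt(3)/2. *)
Lemma reduction h tau : invariantT h -> invariantS h -> H tau ->
  exists2 tau', 3 / 4 <= complex.Im tau' & h tau' = h tau.
Proof.
move=> hT hS t0; have r01 : (0 <= 13 / 16 :> R) && (13 / 16 < 1 :> R) by apply/andP; split; lra.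
have [n hn] := @expr_small R (13 / 16) 1 (complex.Im tau) r01 ler01 t0; move: {hn}(hn n (leqnn n)); rewrite mul1r.
elim: n tau t0 => [|n IHn] tau t0 tn; first by exists tau => //; move: tn; rewrite expr0; lra.
pose m := - Num.floor (complex.Re tau + 1 / 2).
pose t := tau + m%:~R.
have Ht : H t by apply: H_addr_int.
have ht : h t = h tau by apply: invariantT_int.
have tI : complex.Im t = complex.Im tau by rewrite /t intr_C Im_addr.
have tR : -(1/2) <= complex.Re t <= 1 / 2.
  have := floor_itv (complex.Re tau + 1 / 2); rewrite /t /m intrD intr_C.
  case: (tau) => a b /=; rewrite rmorphN /=.
  by set k := (Num.floor _)%:~R => /andP[u v]; apply/andP; split; lra.
have [big|small] := leP (3 / 4) (complex.Im t); first by exists t.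
have Hs := H_oppV Ht.
have sI : complex.Im tau * (16 / 13) <= complex.Im (- t^-1).
  rewrite Im_oppV tI ler_pdivlMr ?exprn_gt0 ?modulus_gt0 ?H_neq0 //.
  rewrite modulus_sqr tI -mulrA -[leRHS]mulr1 ler_wpM2l //; first exact: ltW.
  move: small tR; rewrite tI => small /andP[a b].
  have : complex.Im tau ^+ 2 <= (3 / 4) ^+ 2 by rewrite lerXn2r ?nnegrE ?ltW //; lra.
  by have : complex.Re t ^+ 2 <= (1 / 2) ^+ 2; [nra|lra].
have [|t' bt' ht'] := IHn _ Hs; last by exists t' => //; rewrite ht' hS.
by apply: le_trans sI; move: tn; rewrite exprS; set r := _ ^+ n; lra.
Qed.

(** Averaging an approximant over tau + j for j < w removes the exponents that w does not divide. *)
Lemma Hol_periodic w h : (0 < w)%N -> HolC w h -> invariantT h -> HolC 1 h.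
Proof.
move=> w0 Hh hT y eps y0 eps0; have [p hp] := Hh y eps y0 eps0.
rewrite map_poly_id // in hp.
have wC : w%:R != 0 :> R[i] by rewrite pnatr_eq0 -lt0n.
have wR : 0 < w%:R :> R by rewrite ltr0n.
pose q := \sum_(i < size p) (if (w %| i)%N then p`_i *: 'X^(i %/ w) else 0).
exists q => tau yt; rewrite map_poly_id // divr1.
have rou (i : nat) : \sum_(j < w) e (j%:R / w%:R) ^+ i = (if (w %| i)%N then w%:R else 0).
  under eq_bigr => j _ do rewrite -e_natM mulrCA e_natM.
  case: ifP => wi; last first.
    apply: sum_unity_root; first by rewrite -e_natM mulrCA mulfV // mulr1 e_nat.
    by apply/eqP => /(e_frac_eq1 w0); rewrite wi.
  rewrite (eq_bigr (fun=> 1)) ?sumr_const ?card_ord // => j _.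
  by rewrite -(divnK wi) natrM mulfK // e_nat expr1n.
have E : w%:R * q.[e tau] = \sum_(j < w) p.[e ((tau + j%:R) / w%:R)].
  rewrite /q horner_sum mulr_sumr.
  under [RHS]eq_bigr => j _ do rewrite horner_coef.
  rewrite exchange_big; apply: eq_bigr => i _ /=.
  under eq_bigr => j _ do rewrite mulrDl e_add exprMn mulrA.
  rewrite -mulr_sumr rou; case: ifP => wi; last by rewrite horner0 !mulr0.
  rewrite hornerZ hornerXn mulrC; congr (_ * _ * _).
  rewrite -[in RHS](divnK wi) mulnC exprM -[_ ^+ w]e_natM mulrC mulfVK //.
rewrite -(ler_pM2l wR) -[X in X * nm _](modulus_nat R w) -modulusM mulrBr E.
have -> : w%:R * h tau = \sum_(j < w) h (tau + j%:R).
  rewrite (eq_bigr (fun=> h tau)) ?sumr_const ?card_ord ?mulr_natl // => j _.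
  by rewrite pmulrn (invariantT_int _ hT) //; apply: lt_le_trans yt.
rewrite -sumrB; apply: le_trans (modulus_sum _ _ _) _.
have -> : w%:R * eps = \sum_(j < w) eps by rewrite sumr_const card_ord mulr_natl.
apply: ler_sum => j _; apply: hp.
by rewrite -(rmorph_nat (real_complex R)) Im_addr.
Qed.

(* Schwarz-type contraction: Cauchy's estimate on |q| = e^(-pi/2) controls h - c on
   Im tau >= 3/4, hence everywhere by reduction, so the bound on h - c improves. *)
Lemma level_one w h : (0 < w)%N -> HolC w h -> invariantT h -> invariantS h ->
  exists c, forall tau, H tau -> h tau = c.
Proof.
move=> w0 Hw hT hS; have H1 := Hol_periodic w0 Hw hT.
have [c hc] := Hol_tends (ltn0Sn 0) H1; exists c.
have hcH (S : R) : (forall tau, 3 / 4 <= complex.Im tau -> nm (h tau - c) <= S) ->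
    forall tau, H tau -> nm (h tau - c) <= S.
  by move=> hS' tau /(reduction hT hS)[t' t'1 <-]; apply: hS'.
have p2 := pi_ge2 R.
have contract (S : R) : (forall tau, H tau -> nm (h tau - c) <= S) ->
    forall tau, H tau -> nm (h tau - c) <= S / 4.
  move=> hS'; apply: hcH => tau tY; apply/ler_addgt0Pl => d d0.
  have e0' : 0 < d / 3 by lra.
  have q0 : 0 < 1 / 4 :> R by lra.
  have [p hp] := H1 _ _ q0 e0'; rewrite map_poly_id // in hp.
  have p0c := Hol_approx_coef0 (ltn0Sn 0) hc hp.
  have hB tau' : complex.Im tau' = 1 / 4 -> nm (p - c%:P).[e tau'] <= S + d / 3.
    move=> t4; rewrite hornerD hornerN hornerC.
    have -> : p.[e tau'] - c = (h tau' - c) - (h tau' - p.[e (tau' / 1%:R)]) by rewrite divr1; ring.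
    apply: le_trans (modulusB _ _) _; apply: lerD; last by apply: hp; rewrite t4.
    by apply: hS'; rewrite /upper_half_plane /= t4.
  have xle : nm (e tau) <= 1 / 5 * expR (- (2 * pi * (1 / 4))).
    apply: le_trans (modulus_e_le tY) _; apply: le_trans (ler_wpM2r (expR_ge0 _) (expRN2_le R)).
    by rewrite -expRD ler_expR; lra.
  have th : (0 <= 1 / 5 :> R) && (1 / 5 < 1 :> R) by apply/andP; split; lra.
  have := horner_sub_coef0_le hB th xle.
  have -> : 1 / 5 / (1 - 1 / 5) = 1 / 4 :> R by field; lra.
  rewrite hornerD hornerN hornerC coefB coefC /=.
  have -> : p.[e tau] - c - (p`_0 - c) = p.[e tau] - p`_0 by ring.
  have := hp tau; rewrite divr1 => /(_ (le_trans _ tY)) a b; have {}a : nm (h tau - p.[e tau]) <= d / 3 by apply: a; lra.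
  have -> : h tau - c = (h tau - p.[e tau]) + (p.[e tau] - p`_0) + (p`_0 - c) by ring.
  apply: le_trans (modulusD _ _) _; have := modulusD (h tau - p.[e tau]) (p.[e tau] - p`_0).
  by lra.
have y34 : 0 < 3 / 4 :> R by lra.
have [B B0 hB] := Hol_bounded y34 H1.
have start : forall tau, H tau -> nm (h tau - c) <= B + nm c.
  by apply: hcH => tau tY; apply: le_trans (modulusB _ _) _; rewrite lerD2r hB.
have all n : forall tau, H tau -> nm (h tau - c) <= (B + nm c) * (1 / 4) ^+ n.
  elim: n => [|n IHn] tau Ht; first by rewrite expr0 mulr1 start.
  by apply: le_trans (contract _ IHn _ Ht) _; rewrite exprS; lra.
move=> tau Ht; apply/eqP; rewrite -subr_eq0 -modulus_eq0 eq_le modulus_ge0 andbT.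
apply/ler_addgt0Pl => d d0; rewrite addr0.
have r01 : (0 <= 1 / 4 :> R) && (1 / 4 < 1 :> R) by apply/andP; split; lra.
have A0 : 0 <= B + nm c by rewrite addr_ge0 ?modulus_ge0.
have [n hn] := expr_small r01 A0 d0.
exact: le_trans (all n _ Ht) (hn n (leqnn n)).
Qed.

End LevelOne.

(** * The product formula for the sine *)

Section SineProduct.
Variable R : realType.
Local Notation nm := (@modulus R).
Local Notation e := (@qexp R).

Lemma tends_neq0 (u : nat -> R[i]) l : tends u l -> l != 0 ->
  exists N, forall n, (N <= n)%N -> u n != 0.
Proof.
move=> ul l0; have nl0 : 0 < nm l / 2 by rewrite divr_gt0 // modulus_gt0.
have [N hN] := ul _ nl0; exists N => n /hN h; rewrite -modulus_gt0.
by have := modulus_dist l (u n); rewrite modulusC; lra.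
Qed.

(* Tannery's theorem for products. *)
Lemma tannery (x : nat -> nat -> R[i]) (l : nat -> R[i]) (b : nat -> R) L N :
  (forall j, tends (x^~ j) (l j)) ->
  (forall k j, (N <= k)%N -> (j < k)%N -> nm (x k j) <= b j) ->
  (forall eps, 0 < eps -> exists J, forall m n, (J <= m)%N -> \sum_(m <= j < n) b j <= eps) ->
  (forall j, 0 <= b j) ->
  tends (fun k => \prod_(0 <= j < k) (1 + x k j)) L ->
  tends (fun m => \prod_(0 <= j < m) (1 + l j)) L.
Proof.
move=> xl xb bs b0 hL.
have [J1 hJ1] := bs 1 ltr01; pose B := \sum_(0 <= j < J1) b j + 1.
have bB m : \sum_(0 <= j < m) b j <= B.
  have [mJ|Jm] := leqP m J1.
    rewrite /B (@big_cat_nat _ _ _ m 0 J1) //= -addrA lerDl addr_ge0 //.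
    by apply: sumr_ge0.
  by rewrite (@big_cat_nat _ _ _ J1) ?(ltnW Jm) //= /B lerD2l hJ1.
have EB0 : 0 < expR B * expR 1 by rewrite mulr_gt0 ?expR_gt0.
move=> eps eps0; pose eta := Num.min 1 (eps / (expR B * expR 1)).
have eta0 : 0 < eta by rewrite lt_min ltr01 divr_gt0.
have eta1 : eta <= 1 by rewrite ge_min lexx.
have [J hJ] := bs _ eta0; exists J => m Jm.
have hu : tends (fun k => \prod_(0 <= j < m) (1 + x k j) + - \prod_(0 <= j < k) (1 + x k j))
    (\prod_(0 <= j < m) (1 + l j) + - L).
  apply: tendsD (tendsN hL); apply: tends_prod => j _.
  exact: tendsD (tends_cst 1) (xl j).
rewrite -[_ - L]subr0; apply: (@tends_le _ _ _ _ 0 (maxn N m) hu) => k.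
rewrite geq_max subr0 => /andP[Nk mk].
have iotaE : index_iota 0 k = index_iota 0 m ++ index_iota m k.
  by rewrite /index_iota !subn0 -{1}(subnKC mk) iotaD.
rewrite modulusC iotaE; have S1 : \sum_(j <- index_iota 0 m) nm (x k j) <= B.
  apply: le_trans (bB m); apply: ler_sum_nat => j /andP[_ jm].
  by apply: xb => //; apply: leq_trans mk.
have S2 : \sum_(j <- index_iota m k) nm (x k j) <= eta.
  apply: le_trans (hJ m k Jm); apply: ler_sum_nat => j /andP[_ jk]; exact: xb.
apply: le_trans (modulus_prod1D_cat S1 S2) _.
have h : expR eta <= expR 1 by rewrite ler_expR.
have := ler_wpM2l (ltW (expR_gt0 B)) (ler_wpM2l (ltW eta0) h) => /le_trans; apply.
rewrite mulrCA -ler_pdivlMr // ge_min lexx orbT //.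
Qed.

(** This is 2 i sin(pi x). *)
Definition sine (x : R[i]) := e (x / 2) - e (- (x / 2)).

Lemma sine0 : sine 0 = 0. Proof. by rewrite /sine mul0r oppr0 subrr. Qed.

Lemma sineN x : sine (- x) = - sine x.
Proof. by rewrite /sine mulNr opprK opprB. Qed.

Lemma sineE x : sine x = - (e (- (x / 2)) * (1 - e x)).
Proof.
by rewrite mulrBr mulr1 -e_add opprB; congr (e _ - _); field.
Qed.

Lemma e1 : e 1 = 1. Proof. exact: e_nat 1. Qed.

Lemma e_primitive_root n : (0 < n)%N -> n.-primitive_root (e (1 / n%:R)).
Proof.
move=> n0; have nC : n%:R != 0 :> R[i] by rewrite pnatr_eq0 -lt0n.
have zX k : e (1 / n%:R) ^+ k = e (k%:R / n%:R) by rewrite -e_natM mulrA mulr1.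
apply/andP; split => //; apply/forallP => i; rewrite unity_rootE zX.
have [E|ni] := eqVneq i.+1 n; first by rewrite E divff // e1 eqxx.
apply/eqP/negbTE/eqP => /(e_frac_eq1 n0)/(dvdn_leq (ltn0Sn _)) ni'.
by move: ni; rewrite eqn_leq ni' ltn_ord.
Qed.

Let c n j : R[i] := 2 - (e (j%:R / n%:R) + e (- (j%:R / n%:R))).

Let cE n j : c n j = (4 * sin (pi * (j%:R / n%:R)) ^+ 2)%:C.
Proof.
have E : j%:R / n%:R = (j%:R / n%:R : R)%:C :> R[i] by rewrite rmorphM fmorphV !rmorph_nat.
rewrite /c E -rmorphN !e_real mulrN cosN sinN; set t : R := j%:R / n%:R.
have E2 : 2 * pi * t / 2 = pi * t by field.
have -> : 4 * sin (pi * t) ^+ 2 = 2 - 2 * cos (2 * pi * t).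
  by rewrite [cos _]cos_half_sin E2; ring.
have -> : (2 : R[i]) = (2 : R)%:C by rewrite rmorph_nat.
by apply/eqP; rewrite eq_complex /=; apply/andP; split; apply/eqP; ring.
Qed.

(** With j + 1 <= k the angle pi t stays below pi / 2; then sin(pi t) >= pi t / 4 >= t / 2 bounds 4
    sin(pi t)^2 from below by t^2. *)
Let c_ge k j : (j < k)%N ->
  (j.+1%:R / k.*2.+1%:R) ^+ 2 <= nm (c k.*2.+1 j.+1).
Proof.
move=> jk; have n0 : 0 < k.*2.+1%:R :> R by rewrite ltr0n.
have p2 := pi_ge2 R; rewrite cE modulus_real; set t := _ / _.
have t0 : 0 <= t by rewrite divr_ge0 // ltW.
have t1 : t <= 1 / 2.
  rewrite ler_pdivrMr // mulrAC ler_pdivlMr // mul1r -natrM ler_nat; lia.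
have pt : 0 <= pi * t by rewrite mulr_ge0 // pi_ge0.
have pt2 : pi * t <= pi / 2 by rewrite ler_wpM2l ?pi_ge0 // -[2^-1]div1r.
have := sin_ge_quarter pt pt2; set s := sin _ => sq.
have s20 : 0 <= 4 * s ^+ 2 by apply: mulr_ge0 => //; exact: sqr_ge0.
rewrite ger0_norm //.
have : t / 2 <= s by apply: le_trans sq; have := ler_wpM2r t0 p2; lra.
move=> h; have : (t / 2) * (t / 2) <= s * s by apply: ler_pM; lra.
by rewrite !expr2; lra.
Qed.

Lemma prod_pairing k (G : nat -> R[i]) :
  \prod_(0 <= j < k + k) G j = \prod_(0 <= j < k) (G j * G (k + k - j.+1)%N).
Proof.
rewrite (@big_cat_nat _ _ _ k) ?leq_addr //= big_split /=; congr (_ * _).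
rewrite big_nat_rev /= -{1}[k]add0n big_addn addnK.
by apply: eq_big_nat => i /andP[_ ik]; congr G; lia.
Qed.

Let pair_factor n j (z w : R[i]) : (j <= n)%N -> (0 < n)%N -> z * w = 1 ->
  (z - e (1 / n%:R) ^+ j * w) * (z - e (1 / n%:R) ^+ (n - j) * w) = c n j + (z - w) ^+ 2.
Proof.
move=> jn n0 zw; have nC : n%:R != 0 :> R[i] by rewrite pnatr_eq0 -lt0n.
have nj : (n - j)%N%:R * (1 / n%:R) = 1 - j%:R / n%:R :> R[i].
  by rewrite natrB // mul1r mulrBl divff.
rewrite -!e_natM nj mul1r e_sub e1 mul1r -eN /c.
set u := e (_ / _); have uv : u * e (- (j%:R / n%:R)) = 1 by rewrite -e_add subrr e0.
set v := e (- _) in uv *.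
have -> : (z - u * w) * (z - v * w) = z ^+ 2 + (u * v) * w ^+ 2 - (u + v) * (z * w) by ring.
have -> : (z - w) ^+ 2 = z ^+ 2 + w ^+ 2 - 2 * (z * w) by ring.
by rewrite uv zw; ring.
Qed.

(** The value at 1 of (X^n - 1) / (X - 1) for odd n, its conjugate linear factors taken in pairs. *)
Let prod_c k : \prod_(0 <= j < k) c k.*2.+1 j.+1 = k.*2.+1%:R.
Proof.
pose n := k.*2.+1; have n0 : (0 < n)%N by [].
pose z := e (1 / n%:R); have hz := e_primitive_root n0.
have := factor_Xn_sub_1 hz; rewrite big_nat_recl // expr0.
rewrite subrX1 => /mulfI; rewrite polyXsubC_eq0 => /(_ isT) E.
have En : (\sum_(i < n) 'X^i : {poly R[i]}).[1] = n%:R.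
  rewrite horner_sum (eq_bigr (fun=> 1)) ?sumr_const ?card_ord // => i _.
  by rewrite hornerXn expr1n.
rewrite -/n -En -E horner_prod.
rewrite -[in RHS]addnn prod_pairing.
apply: eq_big_nat => j /andP[_ jk].
rewrite !hornerXsubC.
have := @pair_factor n j.+1 1 1; rewrite !mulr1 subrr expr0n addr0 => <- //; last by rewrite /n; lia.
by congr (_ * (1 - _ ^+ _)); rewrite /n; lia.
Qed.

(** With n = 2k + 1, u = e(x / 2n) and v = 1/u, the difference u^n - v^n factors over the n-th roots
    of unity. The root 1 gives u - v, the others pair off as conjugates into c + (u - v)^2, and the
    product of the c is n. *)
Lemma sine_finite_product x k : let X := e (x / 2 / k.*2.+1%:R) - e (- (x / 2 / k.*2.+1%:R)) in
  sine x = k.*2.+1%:R * X * \prod_(0 <= j < k) (1 + X ^+ 2 / c k.*2.+1 j.+1).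
Proof.
move=> X; pose n := k.*2.+1; have n0 : (0 < n)%N by [].
have nC : n%:R != 0 :> R[i] by rewrite pnatr_eq0.
pose z := e (1 / n%:R); have hz := e_primitive_root n0.
pose u := e (x / 2 / n%:R); pose v := e (- (x / 2 / n%:R)); have uv : u * v = 1 by rewrite -e_add subrr e0.
have v0 : v != 0 := e_neq0 _.
have -> : sine x = u ^+ n - v ^+ n.
  by rewrite -!e_natM; congr (e _ - e _); rewrite -/n; field.
have -> : u ^+ n - v ^+ n = \prod_(0 <= j < n) (u - z ^+ j * v).
  have E (y w : R[i]) : n.-primitive_root y -> \prod_(0 <= j < n) (w - y ^+ j) = w ^+ n - 1.
    move=> hy; have := congr1 (fun p => p.[w]) (factor_Xn_sub_1 hy).
    rewrite hornerD hornerN hornerXn -polyC1 hornerC => <-.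
    by rewrite horner_prod; apply: eq_bigr => j _; rewrite hornerXsubC.
  have -> : u ^+ n - v ^+ n = v ^+ n * ((u / v) ^+ n - 1).
    by rewrite mulrBr mulr1 -exprMn mulrC mulfVK.
  rewrite -(E z) // -[n in v ^+ n]subn0 -prodr_const_nat -big_split; apply: eq_bigr => j _.
  by rewrite /= mulrBr mulrCA mulfV // mulr1 [v * _]mulrC.
rewrite big_nat_recl // expr0 mul1r -/X -(prod_c k) [_ * X]mulrC -mulrA; congr (_ * _).
rewrite -big_split /n -addnn prod_pairing; apply: eq_big_nat => j /andP[_ jk] /=.
have cn0 : c n j.+1 != 0.
  by rewrite -modulus_gt0 (lt_le_trans _ (c_ge jk)) // exprn_gt0 // divr_gt0 // ltr0n.
rewrite !addnn -/n [RHS]mulrDr mulr1 [c _ _ * (_ / _)]mulrCA (mulfV cn0) mulr1 -(@pair_factor n j.+1 u v) //; last by rewrite /n; lia.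
by congr (_ * (_ - _ ^+ _ * _)); rewrite /n; lia.
Qed.

Definition kappa : R[i] := 2 * (pi : R)%:C * 'i.

Lemma kappa_neq0 : kappa != 0.
Proof.
rewrite -modulus_gt0 /kappa -[X in 0 < nm X]mulr1 modulus_2pii modulus1.
by rewrite mulr1 mulr_gt0 ?pi_gt0.
Qed.

Let Xn x k := k.*2.+1%:R * (e (x / 2 / k.*2.+1%:R) - e (- (x / 2 / k.*2.+1%:R))).

Let Xn_tends x : tends (Xn x) (kappa * x).
Proof.
move=> eps eps0; pose y := x / 2; pose P := 2 * pi * nm y.
have P0 : 0 <= P by rewrite !mulr_ge0 ?modulus_ge0 ?pi_ge0.
(* For n >= A the first-order expansion of e applies at y / n, and its total error 12 P^2 / n is at
   most eps. *)
pose A := 12 * P ^+ 2 / eps + 2 * P.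
have A1 : 0 <= 12 * P ^+ 2 / eps.
  by apply: divr_ge0 (ltW eps0); apply: mulr_ge0 => //; apply: sqr_ge0.
have A0 : 0 <= A by apply: addr_ge0 => //; apply: mulr_ge0.
exists (Num.Def.archi_bound A) => k Ak.
pose n := k.*2.+1; have nR : 0 < n%:R :> R by rewrite ltr0n.
have nC : n%:R != 0 :> R[i] by rewrite pnatr_eq0.
have An : A <= n%:R.
  apply/ltW/(lt_le_trans (archi_boundP A0)); rewrite ler_nat; apply: leq_trans Ak _.
  by rewrite /n -addnn ltnW // ltnS leq_addr.
have PnE : 2 * pi * nm (y / n%:R) = P / n%:R.
  by rewrite modulusM modulusV modulus_nat mulrA.
have Pn : 2 * pi * nm (y / n%:R) <= 1 / 2.
  rewrite PnE ler_pdivrMr //; apply: le_trans (_ : 2 * P / 2 <= _); first by lra.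
  have : 2 * P <= A by rewrite /A lerDr.
  by lra.
have a := e_sub1_sub_bound Pn; have b := @e_sub1_sub_bound R (- (y / n%:R)).
rewrite modulusN in b; have {}b := b Pn.
rewrite /Xn -/n -/y.
have -> : n%:R * (e (y / n%:R) - e (- (y / n%:R))) - kappa * x =
    n%:R * ((e (y / n%:R) - 1 - 2 * pi%:C * 'i * (y / n%:R)) -
            (e (- (y / n%:R)) - 1 - 2 * pi%:C * 'i * (- (y / n%:R)))).
  by rewrite /kappa /y; field.
rewrite modulusM modulus_nat.
apply: le_trans (ler_wpM2l (ltW nR) (modulusB _ _)) _.
apply: le_trans (ler_wpM2l (ltW nR) (lerD a b)) _; rewrite PnE.
have -> : n%:R * (6 * (P / n%:R) ^+ 2 + 6 * (P / n%:R) ^+ 2) = 12 * P ^+ 2 / n%:R.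
  by field; rewrite gt_eqF.
rewrite ler_pdivrMr // [eps * _]mulrC -ler_pdivrMr //; apply: le_trans An.
by rewrite /A lerDl mulr_ge0.
Qed.

Lemma sum_inv_sqr_tail m n : (0 < m)%N -> \sum_(m <= j < n) (j.+1%:R ^- 2 : R) <= m%:R^-1.
Proof.
move=> m0; have [nm'|mn] := leqP n m; first by rewrite big_geq // invr_ge0.
have mR : 0 < m%:R :> R by rewrite ltr0n.
suff : \sum_(m <= j < n) (j.+1%:R ^- 2 : R) <= m%:R^-1 - n%:R^-1.
  by move=> /le_trans; apply; rewrite lerBlDr lerDl invr_ge0.
elim: n mn => // n IHn; rewrite ltnS leq_eqVlt => /orP[/eqP<-|/[dup] mn /IHn h].
  rewrite big_nat1; have -> : (m.+1%:R : R) = m%:R + 1 by rewrite natr1.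
  have -> : m%:R^-1 - (m%:R + 1)^-1 = (m%:R * (m%:R + 1))^-1 :> R by field; apply/andP; split; apply/eqP; lra.
  by rewrite lef_pV2 ?posrE ?mulr_gt0 ?exprn_gt0 ?addr_gt0 // expr2; nra.
rewrite big_nat_recr /=; last exact: ltnW.
have nR : 0 < n%:R :> R by rewrite ltr0n (leq_ltn_trans _ mn).
suff : (n.+1%:R ^- 2 : R) <= n%:R^-1 - n.+1%:R^-1.
  by move=> q; apply: le_trans (lerD h q) _; rewrite addrA subrK.
have -> : (n.+1%:R : R) = n%:R + 1 by rewrite natr1.
have -> : n%:R^-1 - (n%:R + 1)^-1 = (n%:R * (n%:R + 1))^-1 :> R by field; apply/andP; split; apply/eqP; lra.
by rewrite lef_pV2 ?posrE ?mulr_gt0 ?exprn_gt0 ?addr_gt0 // expr2; nra.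
Qed.

Lemma inv_small (A eps : R) : 0 <= A -> 0 < eps ->
  exists2 J : nat, (0 < J)%N & forall m, (J <= m)%N -> A / m%:R <= eps.
Proof.
move=> A0 eps0; exists (Num.Def.archi_bound (A / eps)).+1 => // m Jm.
have mR : 0 < m%:R :> R by rewrite ltr0n (leq_trans _ Jm).
rewrite ler_pdivrMr // [eps * _]mulrC -ler_pdivrMr //.
have Ae : 0 <= A / eps by rewrite divr_ge0 // ltW.
apply/ltW/(lt_le_trans (archi_boundP Ae)); rewrite ler_nat; exact: ltnW.
Qed.

Lemma sine_product x :
  tends (fun m => kappa * x * \prod_(0 <= j < m) (1 + - x ^+ 2 / j.+1%:R ^+ 2)) (sine x).
Proof.
have [->|x0] := eqVneq x 0.
  by apply: tends_ext (tends_cst _) => m; rewrite mulr0 mul0r sine0.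
have kx0 : kappa * x != 0 by rewrite mulf_neq0 ?kappa_neq0.
suff h : tends (fun m => \prod_(0 <= j < m) (1 + - x ^+ 2 / j.+1%:R ^+ 2)) (sine x / (kappa * x)).
  have := tendsM (tends_cst (kappa * x)) h.
  by rewrite [kappa * x * (_ / _)]mulrCA mulfV // mulr1.
pose a k j := (Xn x k / k.*2.+1%:R) ^+ 2 / c k.*2.+1 j.+1.
(* The denominator c is itself given by [Xn] at the integer j + 1, so each term is a quotient of two
   sequences with known limits. *)
have aE k j : a k j = - (Xn x k) ^+ 2 / (Xn j.+1%:R k) ^+ 2.
  have nC : k.*2.+1%:R != 0 :> R[i] by rewrite pnatr_eq0.
  set n := k.*2.+1 in nC *.
  have -> : (Xn j.+1%:R k) ^+ 2 = - (n%:R ^+ 2 * c n j.+1).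
    rewrite -[RHS]mulrN /Xn -/n exprMn; congr (_ * _).
    have E : e (j.+1%:R / n%:R) = e (j.+1%:R / 2 / n%:R) ^+ 2.
      by rewrite -e_natM; congr e; field.
    rewrite /c !eN E; have := e_neq0 (j.+1%:R / 2 / n%:R : R[i]); set u := e _ => u0.
    by field.
  by rewrite invrN mulrNN /a -/n invfM exprMn exprVn mulrA.
have [K0 hK0 _] := tends_bounded (Xn_tends x).
pose K := nm (kappa * x) + 1; have KK : 0 <= K by rewrite addr_ge0 ?modulus_ge0.
apply: (@tannery a _ (fun j => K ^+ 2 * j.+1%:R ^- 2) _ K0).
- move=> j; apply: tends_ext (_ : tends (fun k => - Xn x k ^+ 2 / Xn j.+1%:R k ^+ 2) _).
    by move=> k; rewrite aE.
  have j0 : j.+1%:R != 0 :> R[i] by rewrite pnatr_eq0.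
  have -> : - x ^+ 2 / j.+1%:R ^+ 2 = - (kappa * x) ^+ 2 / (kappa * j.+1%:R) ^+ 2.
    have := kappa_neq0; move: j0; move: (kappa) (j.+1%:R) => q J J0 q0.
    by field; apply/andP.
  rewrite !expr2; apply: tendsM (tendsN (tendsM (Xn_tends x) (Xn_tends x))) _.
  apply: tendsV (tendsM (Xn_tends _) (Xn_tends _)).
  by have h : kappa * j.+1%:R != 0 by [rewrite mulf_neq0 ?kappa_neq0]; rewrite mulf_neq0.
- move=> k j Kk jk; have n0 : 0 < k.*2.+1%:R :> R by rewrite ltr0n.
  have j0 : 0 < j.+1%:R :> R by rewrite ltr0n.
  rewrite /a modulusM modulusV modulusX modulusM modulusV modulus_nat.
  have h1 := hK0 k Kk; have h2 := c_ge jk.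
  have h3 : 0 < (j.+1%:R / k.*2.+1%:R) ^+ 2 :> R by rewrite exprn_gt0 // divr_gt0.
  have -> : K ^+ 2 / j.+1%:R ^+ 2 = (K / k.*2.+1%:R) ^+ 2 / (j.+1%:R / k.*2.+1%:R) ^+ 2.
    move: n0 j0; move: (_.+1%:R : R) (j.+1%:R : R) => u v u0 v0.
    by field; rewrite !gt_eqF.
  apply: ler_pM; rewrite ?sqr_ge0 ?invr_ge0 ?modulus_ge0 //.
    rewrite lerXn2r ?nnegrE ?divr_ge0 ?modulus_ge0 ?(ltW n0) //.
    by rewrite ler_wpM2r // invr_ge0 ltW.
  by rewrite lef_pV2 ?posrE // (lt_le_trans h3).
- move=> eps eps0; have [J J0 hJ] := inv_small (sqr_ge0 K) eps0; exists J => m n Jm.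
  rewrite -mulr_sumr; apply: le_trans (hJ m Jm).
  by rewrite ler_wpM2l ?sqr_ge0 // sum_inv_sqr_tail // (leq_trans J0).
- by move=> j; rewrite mulr_ge0 ?sqr_ge0 ?invr_ge0 // exprn_ge0.
have [N hN] := tends_neq0 (Xn_tends x) kx0.
apply: (@tends_ext_from _ N (fun k => sine x / Xn x k)); last exact: tendsM (tends_cst _) (tendsV kx0 (Xn_tends x)).
move=> k /hN Xk0; rewrite (sine_finite_product x k) -/(Xn x k) mulrAC mulfV // mul1r.
apply: eq_bigr => j _; rewrite /a /Xn [k.*2.+1%:R * _]mulrC mulfK //.
Qed.

End SineProduct.

(** * Lattice products *)

Section DoubleProduct.
Variable R : realType.
Local Notation nm := (@modulus R).
Variables (x : nat -> nat -> R[i]) (C : R) (k0 : nat).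
Hypotheses (C0 : 0 <= C)
  (x_le : forall i j, (k0 <= maxn i j)%N -> nm (x i j) <= C / (maxn i j)%:R ^+ 3).

Let P A B := \prod_(0 <= i < A) \prod_(0 <= j < B) (1 + x i j).

Let P_pair M A B : (A <= M)%N -> (B <= M)%N ->
  P A B = \prod_(p : 'I_M * 'I_M | (p.1 < A)%N && (p.2 < B)%N) (1 + x p.1 p.2).
Proof.
move=> AM BM; rewrite /P big_mkord (big_ord_widen M (fun i => \prod_(0 <= j < B) (1 + x i j)) AM).
under eq_bigr => i _ do rewrite big_mkord (big_ord_widen M (fun j => 1 + x i j) BM).
by rewrite pair_big.
Qed.

Let tail K M := \sum_(p : 'I_M * 'I_M | ~~ ((p.1 < K)%N && (p.2 < K)%N)) nm (x p.1 p.2).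

Let tail_le K M : (k0 <= K.+1)%N -> (0 < K)%N -> (K < M)%N -> tail K.+1 M <= 3 * C / K%:R.
Proof.
move=> kK K0 KM.
pose g (i j : nat) : R := if (i < K.+1)%N && (j < K.+1)%N then 0 else C / (maxn i j)%:R ^+ 3.
have h1 : tail K.+1 M <= \sum_(i < M) \sum_(j < M) g i j.
  rewrite pair_bigA /= /tail big_mkcond /=; apply: ler_sum => -[i j] _ /=; rewrite /g.
  case: (boolP (_ && _)) => [//|h] /=; apply: x_le; rewrite (leq_trans kK) //.
  by move: h; rewrite negb_and -!leqNgt leq_max => /orP[]->; rewrite ?orbT.
apply: le_trans h1 _.
have h2 : \sum_(i < M) \sum_(j < M) g i j <= 3 * C * \sum_(K <= j < M.-1) (j.+1%:R ^- 2).
  elim: M KM => // M IHM; rewrite ltnS leq_eqVlt => /orP[/eqP<-|KM].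
    rewrite big_geq // mulr0 big1 // => i _; rewrite big1 // => j _.
    by rewrite /g !ltn_ord.
  have M0 : 0 < M%:R :> R by rewrite ltr0n (leq_ltn_trans _ KM).
  rewrite big_ord_recr /=.
  under eq_bigr => i _ do rewrite big_ord_recr /=.
  rewrite big_split /= -[M in \sum_(K <= j < M) _](prednK (leq_ltn_trans (leq0n K) KM)).
  rewrite big_nat_recr /=; last by rewrite -ltnS prednK // (leq_ltn_trans _ KM).
  rewrite mulrDr prednK ?(leq_ltn_trans _ KM) // -addrA; apply: lerD; first exact: IHM.
  have gM i : (i <= M)%N -> g i M = C / M%:R ^+ 3 /\ g M i = C / M%:R ^+ 3.
    move=> iM; rewrite /g [(M < _)%N]ltnNge KM !andbF /=; split; first by rewrite (maxn_idPr iM).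
    by rewrite (maxn_idPl iM).
  rewrite (eq_bigr (fun=> C / M%:R ^+ 3)); last by move=> i _; apply: (gM i (ltnW (ltn_ord i))).1.
  rewrite [X in _ + X](eq_bigr (fun=> C / M%:R ^+ 3)); last first.
    by move=> j _; apply: (gM j _).2; rewrite -ltnS.
  rewrite !sumr_const !card_ord -mulrnDr -(mulr_natl (C / _)).
  have -> : 3 * C * M%:R ^- 2 = 3 * M%:R * (C / M%:R ^+ 3) by field; rewrite gt_eqF.
  rewrite ler_wpM2r ?divr_ge0 ?exprn_ge0 ?(ltW M0) //.
  by rewrite -natrM ler_nat; lia.
apply: le_trans h2 _; rewrite ler_wpM2l ?mulr_ge0 //.
exact: sum_inv_sqr_tail.
Qed.

Let P_sub K A B : (k0 <= K.+1)%N -> (0 < K)%N -> (K < A)%N -> (K < B)%N ->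
  nm (P A B - P K.+1 K.+1) <= nm (P K.+1 K.+1) * (expR (3 * C / K%:R) - 1).
Proof.
move=> kK K0 KA KB; pose M := maxn A B.
have AM : (A <= M)%N by rewrite leq_maxl.
have BM : (B <= M)%N by rewrite leq_maxr.
have KM : (K < M)%N by apply: leq_trans AM.
rewrite !(@P_pair M) //.
rewrite (bigID (fun p : 'I_M * 'I_M => (p.1 < K.+1)%N && (p.2 < K.+1)%N)) /=.
rewrite [X in X * _](eq_bigl (fun p : 'I_M * 'I_M => (p.1 < K.+1)%N && (p.2 < K.+1)%N)); last first.
  move=> p /=; case: (ltnP p.1 K.+1) => h1; rewrite ?andbF //.
  case: (ltnP p.2 K.+1) => h2; rewrite ?andbF // !andbT.
  by rewrite (leq_trans h1) // (leq_trans h2).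
rewrite -[X in _ - X]mulr1 -mulrBr modulusM ler_wpM2l ?modulus_ge0 //.
apply: le_trans (modulus_prod1D_sub1 _ _ _) _; rewrite lerD2r ler_expR.
apply: le_trans (tail_le kK K0 KM); rewrite /tail big_mkcond [leRHS]big_mkcond /=.
apply: ler_sum => p _; case: ifP => [/andP[_ ->]//|_].
by case: ifP => // _; apply: modulus_ge0.
Qed.

(** The shell max(i, j) = m has 2m + 1 entries, each O(m^-3), so the moduli are summable; both
    iterated products then differ from the same square partial products by a vanishing error. *)
Lemma double_product_swap (row col : nat -> R[i]) (r c : R[i]) :
  (forall i, tends (fun B => \prod_(0 <= j < B) (1 + x i j)) (row i)) ->
  tends (fun A => \prod_(0 <= i < A) row i) r ->
  (forall j, tends (fun A => \prod_(0 <= i < A) (1 + x i j)) (col j)) ->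
  tends (fun B => \prod_(0 <= j < B) col j) c -> r = c.
Proof.
move=> hrow hr hcol hc.
have sub_r K : (k0 <= K.+1)%N -> (0 < K)%N ->
    nm (r - P K.+1 K.+1) <= nm (P K.+1 K.+1) * (expR (3 * C / K%:R) - 1).
  move=> kK K0; apply: (@tends_le _ _ _ _ _ K.+1 hr) => A KA.
  have hA : tends (fun B => P A B) (\prod_(0 <= i < A) row i) by apply: tends_prod => i _.
  by apply: (@tends_le _ _ _ _ _ K.+1 hA) => B KB; apply: P_sub.
have sub_c K : (k0 <= K.+1)%N -> (0 < K)%N ->
    nm (c - P K.+1 K.+1) <= nm (P K.+1 K.+1) * (expR (3 * C / K%:R) - 1).
  move=> kK K0; apply: (@tends_le _ _ _ _ _ K.+1 hc) => B KB.
  have hB : tends (fun A => P A B) (\prod_(0 <= j < B) col j).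
    apply: tends_ext (_ : tends (fun A => \prod_(0 <= j < B) \prod_(0 <= i < A) (1 + x i j)) _).
      by move=> A; rewrite /P exchange_big.
    by apply: tends_prod => j _.
  by apply: (@tends_le _ _ _ _ _ K.+1 hB) => A KA; apply: P_sub.
pose K1 := k0.+1; pose D := nm (P K1.+1 K1.+1) * expR (3 * C / K1%:R).
have k01 : (k0 <= K1.+1)%N by rewrite /K1 (leq_trans (leqnSn _)).
have D0 : 0 <= D by rewrite mulr_ge0 ?modulus_ge0 ?expR_ge0.
have PD K : (K1 <= K)%N -> nm (P K.+1 K.+1) <= D.
  move=> KK; have := @P_sub K1 K.+1 K.+1 k01 isT; rewrite !ltnS => /(_ KK KK).
  have := modulus_dist (P K.+1 K.+1) (P K1.+1 K1.+1); rewrite /D mulrBr mulr1; lra.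
apply/eqP; rewrite -subr_eq0 -modulus_eq0 eq_le modulus_ge0 andbT.
apply/ler_addgt0Pl => eps eps0; rewrite addr0.
pose E := 2 * D * expR 1.
have E0 : 0 <= E by rewrite mulr_ge0 ?expR_ge0 // mulr_ge0.
have C30 : 0 <= 3 * C by rewrite mulr_ge0.
have d0 : 0 < Num.min 1 (eps / (E + 1)) by rewrite lt_min ltr01 divr_gt0 //; lra.
have [J J0 hJ] := inv_small C30 d0.
pose K := maxn K1 J; have {}hJ := hJ K (leq_maxr _ _).
have KK1 : (K1 <= K)%N := leq_maxl _ _.
have K0 : (0 < K)%N by apply: leq_trans KK1.
have kK : (k0 <= K.+1)%N by rewrite (leq_trans _ (leq_trans KK1 _)).
have a := sub_r K kK K0; have b := sub_c K kK K0; have d := PD K KK1.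
move: hJ; rewrite le_min; set t := 3 * C / _ in a b * => /andP[t1 t2].
have t0 : 0 <= t by rewrite divr_ge0.
have u : expR t - 1 <= t * expR 1.
  by apply: le_trans (expR_sub1_le t) _; rewrite ler_wpM2l // ler_expR.
have v : nm (P K.+1 K.+1) * (expR t - 1) <= D * (t * expR 1).
  apply: ler_pM => //; first exact: modulus_ge0.
  by rewrite subr_ge0 -expR0 ler_expR.
have -> : r - c = (r - P K.+1 K.+1) - (c - P K.+1 K.+1) by ring.
apply: le_trans (modulusB _ _) _.
have : t * (E + 1) <= eps by rewrite -ler_pdivlMr //; lra.
by rewrite /E; lra.
Qed.

End DoubleProduct.

(** * The lattice product for a difference of two values of wp *)

Section LatticeProduct.
Variable R : realType.
Local Notation nm := (@modulus R).
Local Notation e := (@qexp R).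
Local Notation H := (@upper_half_plane R).
Implicit Types (tau a b w z : R[i]).

(* The product of [wfactor a b] over the lattice Z tau + Z is a multiple of
   wp a - wp b; it converges absolutely since wfactor a b w = 1 + O(w ^- 3). *)
Definition wfactor a b w : R[i] :=
  if w == 0 then (a + b) * (a - b) / (a ^+ 2 * (b * - b))
  else (w + a + b) * (w + a - b) * w ^+ 2 / ((w + a) ^+ 2 * ((w + b) * (w - b))).

(** The lattice points with coordinates +-i and +-j, without repetition when one of them is 0.
    Grouped in this way the lattice is indexed by pairs of natural numbers, which tau -> -1/tau
    merely exchanges. *)
Definition wpoints tau (i j : nat) : seq R[i] :=
  [:: i%:R * tau + j%:R] ++
  (if j == 0 then [::] else [:: i%:R * tau - j%:R]) ++
  (if i == 0 then [::] else [:: - (i%:R * tau) + j%:R] ++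
     if j == 0 then [::] else [:: - (i%:R * tau) - j%:R]).

Definition wquad tau a b i j := \prod_(w <- wpoints tau i j) wfactor a b w.

(** [wfactor] minus 1 is a b^2 (2w + a) over a polynomial of degree 4 in w. For |w| >= 2 (|a| + |b|)
    each linear factor below is at least |w| / 2, and |2w + a| <= 3 |w|, whence 48 = 3 times 16. *)
Lemma wfactor_bound a b : exists2 B, 0 <= B & exists2 r0, 0 < r0 &
  forall w, r0 <= nm w -> nm (wfactor a b w - 1) <= B / nm w ^+ 3.
Proof.
have na := modulus_ge0 a; have nb := modulus_ge0 b.
exists (48 * nm a * nm b ^+ 2); first by rewrite !mulr_ge0 ?sqr_ge0.
exists (2 * (nm a + nm b) + 1); first by lra.
move=> w hw; have w0 : 0 < nm w by lra.
have wn0 : w != 0 by rewrite -modulus_gt0.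
have ha : nm w / 2 <= nm (w + a).
  by have := modulus_dist w (- a); rewrite opprK modulusN; lra.
have hb : nm w / 2 <= nm (w + b).
  by have := modulus_dist w (- b); rewrite opprK modulusN; lra.
have hb' : nm w / 2 <= nm (w - b) by have := modulus_dist w b; lra.
have a0 : w + a != 0 by rewrite -modulus_gt0; lra.
have b0 : w + b != 0 by rewrite -modulus_gt0; lra.
have b0' : w - b != 0 by rewrite -modulus_gt0; lra.
rewrite /wfactor (negPf wn0).
have -> : (w + a + b) * (w + a - b) * w ^+ 2 / ((w + a) ^+ 2 * ((w + b) * (w - b))) - 1 =
  a * b ^+ 2 * (2 * w + a) / ((w + a) ^+ 2 * ((w + b) * (w - b))).
  by field; rewrite a0 b0 b0'.
have -> : nm (a * b ^+ 2 * (2 * w + a) / ((w + a) ^+ 2 * ((w + b) * (w - b)))) =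
    nm a * nm b ^+ 2 * nm (2 * w + a) / (nm (w + a) ^+ 2 * (nm (w + b) * nm (w - b))).
  by rewrite -!modulusX -!modulusM -modulusV -modulusM.
have h3 : nm (2 * w + a) <= 3 * nm w.
  by apply: le_trans (modulusD _ _) _; rewrite modulusM modulus_nat; lra.
have D0 : 0 < nm w ^+ 2 / 4 * (nm w / 2 * (nm w / 2)).
  by rewrite !mulr_gt0 ?exprn_gt0 ?divr_gt0.
have D1 : nm w ^+ 2 / 4 * (nm w / 2 * (nm w / 2)) <= nm (w + a) ^+ 2 * (nm (w + b) * nm (w - b)).
  apply: ler_pM; rewrite ?mulr_ge0 ?exprn_ge0 ?divr_ge0 ?(ltW w0) //; last by apply: ler_pM; lra.
  have -> : nm w ^+ 2 / 4 = (nm w / 2) * (nm w / 2) by field.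
  by rewrite expr2; apply: ler_pM; lra.
rewrite (@le_trans _ _ (nm a * nm b ^+ 2 * (3 * nm w) / (nm w ^+ 2 / 4 * (nm w / 2 * (nm w / 2))))) //.
  apply: ler_pM; rewrite ?invr_ge0 ?mulr_ge0 ?exprn_ge0 ?modulus_ge0 //.
    by apply: ler_wpM2l => //; rewrite mulr_ge0 ?exprn_ge0.
  by rewrite lef_pV2 ?posrE // (lt_le_trans D0).
rewrite le_eqVlt; apply/orP; left; apply/eqP; field.
by rewrite gt_eqF.
Qed.

(** If j <= i or j <= 2 i |tau|, the imaginary part i Im tau is large enough; otherwise j dominates
    by the triangle inequality. *)
Lemma wpoints_bound tau : H tau -> exists2 d, 0 < d & forall i j w,
  w \in wpoints tau i j -> d * (maxn i j)%:R <= nm w.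
Proof.
rewrite /upper_half_plane /= => y0; set y := complex.Im tau in y0.
have yt : y <= nm tau.
  by have := Im_le_modulus tau; rewrite ger0_norm ?(ltW y0).
have t0 : 0 < nm tau by lra.
exists (Num.min y (y / (2 * nm tau))); first by rewrite lt_min y0 divr_gt0 // mulr_gt0.
set d := Num.min _ _; have d1 : d <= y by rewrite ge_min lexx.
have d2 : d <= y / (2 * nm tau) by rewrite ge_min lexx orbT.
have dE : y / (2 * nm tau) <= 1 / 2 by rewrite ler_pdivrMr ?mulr_gt0 //; lra.
move=> i j w.
have main (v : R) : `|v| = 1 -> d * (maxn i j)%:R <= nm (i%:R * tau + (v * j%:R)%:C).
  move=> v1; have Imle : i%:R * y <= nm (i%:R * tau + (v * j%:R)%:C).
    apply: le_trans (Im_le_modulus _); rewrite Im_addr -(rmorph_nat (real_complex R)) Im_scale.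
    by rewrite -/y ler_norm.
  have ij : j%:R - i%:R * nm tau <= nm (i%:R * tau + (v * j%:R)%:C).
    have := modulus_dist (v * j%:R)%:C (- (i%:R * tau)).
    by rewrite opprK addrC modulusN modulusM modulus_nat modulus_real normrM v1 mul1r normr_nat addrC (addrC (v * _)%:C).
  have i0 : 0 <= i%:R :> R := ler0n _ _; have j0 : 0 <= j%:R :> R := ler0n _ _.
  case: (leqP j i) => ji; first by apply: le_trans Imle; rewrite mulrC; apply: ler_wpM2l.
  have [h|h] := leP j%:R (2 * (i%:R * nm tau)).
    apply: le_trans Imle; apply: le_trans (ler_wpM2r j0 d2) _.
    rewrite mulrAC ler_pdivrMr ?mulr_gt0 //.
    by have := ler_wpM2l (ltW y0) h; lra.
  by apply: le_trans ij; have := ler_wpM2r j0 (le_trans d2 dE); lra.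
have m1 : d * (maxn i j)%:R <= nm (i%:R * tau + j%:R).
  by have := main 1; rewrite normr1 mul1r rmorph_nat; apply.
have mN1 : d * (maxn i j)%:R <= nm (i%:R * tau - j%:R).
  by have := main (- 1); rewrite normrN1 mulN1r rmorphN /= rmorph_nat; apply.
have m2 : d * (maxn i j)%:R <= nm (- (i%:R * tau) + j%:R) by rewrite addrC -modulusC.
have mN2 : d * (maxn i j)%:R <= nm (- (i%:R * tau) - j%:R) by rewrite -opprD modulusN.
rewrite /wpoints; case: eqP => _; case: eqP => _; rewrite /= ?in_cons ?in_nil ?orbF.
- by move/eqP->.
- by case/orP=> /eqP->.
- by case/orP=> /eqP->.
by case/or4P=> /eqP->.
Qed.

Lemma wquad_bound tau a b : H tau -> exists2 C, 0 <= C & exists k0, forall i j,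
  (k0 <= maxn i j)%N -> nm (wquad tau a b i j - 1) <= C / (maxn i j)%:R ^+ 3.
Proof.
move=> Ht; have [B B0 [r0 r00 hB]] := wfactor_bound a b; have [d d0 hd] := wpoints_bound Ht.
pose B1 := B / d ^+ 3; have B10 : 0 <= B1 by rewrite divr_ge0 // exprn_ge0 // ltW.
exists (4 * B1 * expR (4 * B1)); first by rewrite mulr_ge0 ?expR_ge0 // mulr_ge0.
exists (maxn 1 (Num.Def.archi_bound (r0 / d))) => i j; rewrite geq_max => /andP[k1 k2].
set k := maxn i j in k1 k2 *.
have kR : 1 <= k%:R :> R by rewrite ler1n.
have kd : r0 <= d * k%:R.
  rewrite mulrC -ler_pdivrMr //; apply/ltW/(lt_le_trans (archi_boundP _)); last by rewrite ler_nat.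
  by rewrite divr_ge0 // ltW.
have hw w : w \in wpoints tau i j -> nm (wfactor a b w - 1) <= B1 / k%:R ^+ 3.
  move=> /hd wk; apply: le_trans (hB w (le_trans kd wk)) _.
  have dk0 : 0 < d * k%:R by rewrite mulr_gt0 // (lt_le_trans ltr01).
  rewrite /B1 -mulrA -invfM -exprMn; apply: ler_wpM2l => //.
  rewrite lef_pV2 ?posrE ?exprn_gt0 ?(lt_le_trans dk0) //.
  by rewrite lerXn2r ?nnegrE ?modulus_ge0 // ltW.
have ds : (size (wpoints tau i j) <= 4)%N by rewrite /wpoints; case: eqP => _; case: eqP.
have sum_le : \sum_(w <- wpoints tau i j) nm (wfactor a b w - 1) <= 4 * (B1 / k%:R ^+ 3).
  have Bk0 : 0 <= B1 / k%:R ^+ 3 by rewrite divr_ge0 // exprn_ge0.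
  rewrite (@le_trans _ _ (\sum_(w <- wpoints tau i j) B1 / k%:R ^+ 3)) //.
    by rewrite !big_seq; apply: ler_sum => w /hw.
  by rewrite big_const_seq count_predT iter_addr_0 -[X in X <= _]mulr_natl ler_wpM2r // ler_nat.
have -> : wquad tau a b i j = \prod_(w <- wpoints tau i j) (1 + (wfactor a b w - 1)).
  by apply: eq_bigr => w _; ring.
apply: le_trans (modulus_prod1D_sub1 _ _ _) _; apply: le_trans (expR_sub1_le _) _.
have h4 : 4 * (B1 / k%:R ^+ 3) <= 4 * B1.
  rewrite ler_wpM2l // ler_pdivrMr ?exprn_gt0 ?(lt_le_trans ltr01) // ler_peMr // exprn_ege1 //.
have -> : 4 * B1 * expR (4 * B1) / k%:R ^+ 3 = 4 * (B1 / k%:R ^+ 3) * expR (4 * B1) by ring.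
apply: ler_pM; rewrite ?expR_ge0 ?ler_expR ?(le_trans sum_le) //.
by apply: sumr_ge0 => w _; apply: modulus_ge0.
Qed.

End LatticeProduct.

(** * Theta functions *)

Section Theta.
Variable R : realType.
Local Notation nm := (@modulus R).
Local Notation e := (@qexp R).
Local Notation H := (@upper_half_plane R).
Local Notation sine := (@sine R).
Implicit Types (tau a b w z x : R[i]).

Lemma tends_shift (u : nat -> R[i]) l : tends (fun n => u n.+1) l -> tends u l.
Proof. by move=> ul eps /ul[K hK]; exists K.+1 => -[|n] // /hK. Qed.

Lemma tends_e_pow tau (f : nat -> nat) : H tau -> (forall n, (n <= f n)%N) ->
  tends (fun n => e tau ^+ f n) 0.
Proof.
move=> t0 nf eps eps0; have r01 : (0 <= nm (e tau)) && (nm (e tau) < 1).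
  by rewrite modulus_ge0 modulus_e_lt1.
have [K hK] := expr_small r01 ler01 eps0; exists K => n Kn.
by rewrite subr0 modulusX -[X in X <= _]mul1r; apply/hK/(leq_trans Kn).
Qed.

Definition jacobi_factor tau x i := (1 - e tau ^+ i * e x) * (1 - e tau ^+ i * e (- x)).

Definition jacobi tau x : R[i] :=
  lim ((fun n => \prod_(0 <= i < n) jacobi_factor tau x i.+1 : R[i]^o) @ \oo).

(** Jacobi's theta_1 up to a factor independent of x. *)
Definition theta tau x := sine x * jacobi tau x.

Let jf1 tau x i : R[i] := - (e tau ^+ i.+1 * (e x + e (- x))) + e tau ^+ i.+1 * e tau ^+ i.+1.

Let jf1E tau x i : jacobi_factor tau x i.+1 = 1 + jf1 tau x i.
Proof.
have E : e x * e (- x) = 1 by rewrite -e_add subrr e0.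
rewrite /jacobi_factor /jf1; set q := e tau ^+ _; set X := e x in E *; set Y := e (- x) in E *.
have -> : (1 - q * X) * (1 - q * Y) = 1 - q * (X + Y) + q * q * (X * Y) by ring.
by rewrite E; ring.
Qed.

Let q01 tau : H tau -> (0 <= nm (e tau)) && (nm (e tau) < 1).
Proof. by move=> t0; rewrite modulus_ge0 modulus_e_lt1. Qed.

Let jfA x := nm (e x) + nm (e (- x)) + 1.
Let jfA0 x : 0 <= jfA x. Proof. by rewrite !addr_ge0 ?modulus_ge0. Qed.

Let jf1_le tau x i : H tau -> nm (jf1 tau x i) <= jfA x * nm (e tau) ^+ i.
Proof.
move=> t0; have [r0 r1] := andP (q01 t0); set r := nm (e tau) in r0 r1 *.
have ri0 : 0 <= r ^+ i by rewrite exprn_ge0.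
have ri1 : r ^+ i.+1 <= r ^+ i by rewrite exprS ler_piMl // ltW.
have ri2 : r ^+ i.+1 <= 1 by rewrite exprn_ile1 // ltW.
have ri3 : 0 <= r ^+ i.+1 by rewrite exprn_ge0.
apply: le_trans (modulusD _ _) _; rewrite modulusN !modulusM modulusX -/r.
have h := modulusD (e x) (e (- x)).
have h1 : r ^+ i.+1 * nm (e x + e (- x)) <= r ^+ i * (nm (e x) + nm (e (- x))).
  by apply: ler_pM; rewrite ?modulus_ge0.
have h2 : r ^+ i.+1 * r ^+ i.+1 <= r ^+ i * 1 by apply: ler_pM.
by rewrite /jfA; lra.
Qed.

Lemma jacobi_tends tau x : H tau ->
  tends (fun n => \prod_(0 <= i < n) jacobi_factor tau x i.+1) (jacobi tau x).
Proof.
move=> t0; have [l hl _] := infinite_product_cvg (q01 t0) (jfA0 x) (fun i => jf1_le x i t0).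
have hl' : tends (fun n => \prod_(0 <= i < n) jacobi_factor tau x i.+1) l.
  by apply: tends_ext hl => n; apply: eq_bigr => i _; rewrite jf1E.
by rewrite /jacobi (tends_lim hl').
Qed.

Lemma jacobi_neq0 tau x : H tau -> (forall i, jacobi_factor tau x i.+1 != 0) ->
  jacobi tau x != 0.
Proof.
move=> t0 h; apply: (infinite_product_neq0 (q01 t0) (jfA0 x) (fun i => jf1_le x i t0)).
  by apply: tends_ext (jacobi_tends x t0) => n; apply: eq_bigr => i _; rewrite jf1E.
by move=> i; rewrite -jf1E.
Qed.

Lemma jacobi_ext tau x z :
  (forall i, jacobi_factor tau x i = jacobi_factor tau z i) -> jacobi tau x = jacobi tau z.
Proof.
move=> h; rewrite /jacobi.
suff -> : (fun n => \prod_(0 <= i < n) jacobi_factor tau x i.+1) =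
  (fun n => \prod_(0 <= i < n) jacobi_factor tau z i.+1) by [].
by apply/funext => n; apply: eq_bigr => i _; rewrite h.
Qed.

Lemma jacobiN tau x : jacobi tau (- x) = jacobi tau x.
Proof.
by apply: jacobi_ext => i; rewrite /jacobi_factor opprK mulrC.
Qed.

Lemma thetaN tau x : theta tau (- x) = - theta tau x.
Proof. by rewrite /theta sineN jacobiN mulNr. Qed.

Lemma thetaD1 tau x : theta tau (x + 1) = - theta tau x.
Proof.
rewrite /theta; have -> : jacobi tau (x + 1) = jacobi tau x.
  by apply: jacobi_ext => i; rewrite /jacobi_factor opprD !e_add (eN 1) e1 invr1 !mulr1.
rewrite -mulNr; congr (_ * _); rewrite !sineE opprK.
have -> : - ((x + 1) / 2) = - (x / 2) - 1 / 2 by field.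
by rewrite !e_add (eN (1 / 2)) e_half e1 invrN invr1; ring.
Qed.

(** Replacing x by x + tau moves one of the two progressions of factors up and the other down by one
    step, so the partial products differ by boundary factors only. *)
Lemma thetaDtau tau x : H tau -> theta tau (x + tau) = - (e (- x - tau / 2) * theta tau x).
Proof.
move=> t0; pose q := e tau; pose X := e x; pose Y := e (- x).
have q0 : q != 0 := e_neq0 _.
have qV : e (- tau) = q^-1 by rewrite eN.
have key : (1 - q * X) * jacobi tau (x + tau) = (1 - Y) * jacobi tau x.
  have h n : (1 - q * X) * (1 - q ^+ n * Y) * \prod_(0 <= i < n) jacobi_factor tau (x + tau) i.+1 =
      (1 - q ^+ n.+1 * X) * (1 - Y) * \prod_(0 <= i < n) jacobi_factor tau x i.+1.
    elim: n => [|n IHn]; first by rewrite !big_geq // expr0 expr1 mul1r.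
    rewrite !big_nat_recr //=.
    move: IHn; set P1 := \prod_(_ <= _ < _) _; set P2 := \prod_(_ <= _ < _) _ => IHn.
    rewrite /jacobi_factor opprD !e_add qV -/q -/X -/Y.
    have -> : q ^+ n.+1 * (Y / q) = q ^+ n * Y by rewrite exprS; field.
    have -> : q ^+ n.+1 * (X * q) = q ^+ n.+2 * X by rewrite [in RHS]exprS; ring.
    transitivity (((1 - q * X) * (1 - q ^+ n * Y) * P1) * ((1 - q ^+ n.+1 * Y) * (1 - q ^+ n.+2 * X))).
      by ring.
    by rewrite IHn; ring.
  have L z : tends (fun n => 1 - q ^+ n * z) 1.
    rewrite -[X in tends _ X]subr0 -[X in _ - X](mul0r z).
    by apply: tendsD (tends_cst _) (tendsN (tendsM (tends_e_pow t0 _) (tends_cst _))).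
  have L' z : tends (fun n => 1 - q ^+ n.+1 * z) 1.
    rewrite -[X in tends _ X]subr0 -[X in _ - X](mul0r z).
    by apply: tendsD (tends_cst _) (tendsN (tendsM (tends_e_pow t0 _) (tends_cst _))).
  have A := tendsM (tendsM (tends_cst (1 - q * X)) (L Y)) (jacobi_tends (x + tau) t0).
  have B := tendsM (tendsM (L' X) (tends_cst (1 - Y))) (jacobi_tends x t0).
  have := tends_unique (tends_ext h A) B; by rewrite mulr1 mul1r.
rewrite /theta !sineE e_add -/q -/X [X * q]mulrC mulNr -mulrA key.
have -> : - ((x + tau) / 2) = (- x - tau / 2) + x / 2 by field.
have XY : X * Y = 1 by rewrite -e_add subrr e0.
have -> : 1 - X = - (X * (1 - Y)) by rewrite mulrBr XY; ring.
have -> : e (- (x / 2)) = Y * e (x / 2) by rewrite -e_add; congr e; field.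
by rewrite e_add; transitivity (- (e (- x - tau / 2) * e (x / 2) * ((X * Y) * (1 - Y) * jacobi tau x))); [rewrite XY|]; ring.
Qed.

(** [a] lies off the lattice Z tau + Z, expressed through [e] so that the factors of the theta
    products are seen to be nonzero. *)
Definition generic tau a := forall m : int, e (m%:~R * tau + a) != 1.

Lemma sine_neq0 x : e x != 1 -> sine x != 0.
Proof. by move=> h; rewrite sineE oppr_eq0 mulf_neq0 ?e_neq0 // subr_eq0 eq_sym. Qed.

Lemma generic_neq0 tau a (m n : int) : generic tau a -> m%:~R * tau + a + n%:~R != 0.
Proof.
move=> /(_ m); apply: contraNneq => E; rewrite -[X in e X](addrK (n%:~R : R[i])) E.
by rewrite sub0r eN e_int invr1.
Qed.

Lemma genericN tau a : generic tau a -> generic tau (- a).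
Proof.
move=> h m; apply: contraNneq (h (- m)) => E.
by rewrite rmorphN /= mulNr -[X in - _ + X]opprK -opprD eN E invr1.
Qed.

Lemma jacobi_factor_neq0 tau x i : generic tau x -> jacobi_factor tau x i != 0.
Proof.
move=> h; rewrite /jacobi_factor -!e_natM -!e_add mulf_neq0 // subr_eq0 eq_sym.
  exact: (h i).
exact: (genericN h i).
Qed.

Lemma theta_neq0 tau x : H tau -> generic tau x -> theta tau x != 0.
Proof.
move=> t0 h; rewrite mulf_neq0 ?jacobi_neq0 ?sine_neq0 //.
  by have := h 0; rewrite mul0r add0r.
by move=> i; apply: jacobi_factor_neq0.
Qed.

Let sprod B x := x * \prod_(0 <= j < B) (1 + - x ^+ 2 / j.+1%:R ^+ 2).

Let sprod_tends x : tends (sprod^~ x) (sine x / kappa R).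
Proof.
have := tendsM (tends_cst (kappa R)^-1) (sine_product x); rewrite [_^-1 * sine x]mulrC; apply: tends_ext => n.
by rewrite /sprod /= -(mulrA (kappa R)) mulKf ?kappa_neq0.
Qed.

(** The factors at z + J and z - J combine into factors of the product for the sine; a whole row of
    the lattice thereby becomes a quotient of sines. *)
Let wfactor_pair a b z j : let J : R[i] := j.+1%:R in let G x := 1 + - x ^+ 2 / J ^+ 2 in
  z + J != 0 -> z - J != 0 ->
  z + a + J != 0 -> z + a - J != 0 -> z + b + J != 0 -> z + b - J != 0 ->
  z - b + J != 0 -> z - b - J != 0 ->
  wfactor a b (z + J) * wfactor a b (z - J) =
    G (z + a + b) * G (z + a - b) * G z ^+ 2 / (G (z + a) ^+ 2 * (G (z + b) * G (z - b))).
Proof.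
move=> J G zp zm ap am bp bm cp cm.
have J0 : J != 0 by rewrite pnatr_eq0.
have GE x : G x = - ((x + J) * (x - J)) / J ^+ 2 by rewrite /G; field.
rewrite /wfactor (negPf zp) (negPf zm) !GE.
move: J0 zp zm ap am bp bm cp cm {G GE}; move: (J) => {J} J J0 zp zm ap am bp bm cp cm.
have E1 y : z + J + y = z + y + J by ring.
have E2 y : z - J + y = z + y - J by ring.
rewrite !E1 !E2.
by field; rewrite J0 ap am bp bm cp cm.
Qed.

Let wrow a b z B := wfactor a b z *
  \prod_(0 <= j < B) (wfactor a b (z + j.+1%:R) * wfactor a b (z - j.+1%:R)).

Let wrowE a b z B : (forall n : int, z + n%:~R != 0) ->
  (forall n : int, z + a + n%:~R != 0) -> (forall n : int, z + b + n%:~R != 0) ->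
  (forall n : int, z - b + n%:~R != 0) ->
  wrow a b z B = sprod B (z + a + b) * sprod B (z + a - b) * sprod B z ^+ 2 /
    (sprod B (z + a) ^+ 2 * (sprod B (z + b) * sprod B (z - b))).
Proof.
move=> hz ha hb hc; elim: B => [|B IHB].
  rewrite /wrow /sprod !big_geq // !mulr1 /wfactor.
  by have := hz 0; rewrite addr0 => /negPf->.
have -> : wrow a b z B.+1 = wrow a b z B * (wfactor a b (z + B.+1%:R) * wfactor a b (z - B.+1%:R)).
  by rewrite /wrow big_nat_recr //= mulrA.
have sS x : sprod B.+1 x = sprod B x * (1 + - x ^+ 2 / B.+1%:R ^+ 2).
  by rewrite /sprod big_nat_recr //= mulrA.
have q : (- B.+1%:Z)%:~R = (- B.+1%:R : R[i]) by rewrite rmorphN /= -pmulrn.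
rewrite wfactor_pair ?IHB ?sS.
- by rewrite !exprMn mulf_div; congr (_ / _); ring.
- by have := hz B.+1; rewrite -pmulrn.
- by have := hz (- B.+1%:Z); rewrite q.
- by have := ha B.+1; rewrite -pmulrn.
- by have := ha (- B.+1%:Z); rewrite q.
- by have := hb B.+1; rewrite -pmulrn.
- by have := hb (- B.+1%:Z); rewrite q.
- by have := hc B.+1; rewrite -pmulrn.
- by have := hc (- B.+1%:Z); rewrite q.
Qed.

Let wrow0E a b B :
  (forall n : int, a + n%:~R != 0) -> (forall n : int, b + n%:~R != 0) ->
  (forall n : int, - b + n%:~R != 0) ->
  wrow a b 0 B = sprod B (a + b) * sprod B (a - b) /
    (sprod B a ^+ 2 * (sprod B b * sprod B (- b))).
Proof.
move=> ha hb hc; elim: B => [|B IHB].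
  by rewrite /wrow /sprod !big_geq // !mulr1 /wfactor eqxx.
have -> : wrow a b 0 B.+1 = wrow a b 0 B * (wfactor a b (0 + B.+1%:R) * wfactor a b (0 - B.+1%:R)).
  by rewrite /wrow big_nat_recr //= mulrA.
have sS x : sprod B.+1 x = sprod B x * (1 + - x ^+ 2 / B.+1%:R ^+ 2).
  by rewrite /sprod big_nat_recr //= mulrA.
have q : (- B.+1%:Z)%:~R = (- B.+1%:R : R[i]) by rewrite rmorphN /= -pmulrn.
rewrite wfactor_pair ?IHB ?sS ?add0r ?sub0r ?oppr_eq0 ?pnatr_eq0 //.
- by rewrite expr0n /= oppr0 mul0r addr0 expr1n mulr1 !exprMn mulf_div; congr (_ / _); ring.
- by have := ha B.+1; rewrite -pmulrn.
- by have := ha (- B.+1%:Z); rewrite q.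
- by have := hb B.+1; rewrite -pmulrn.
- by have := hb (- B.+1%:Z); rewrite q.
- by have := hc B.+1; rewrite -pmulrn.
- by have := hc (- B.+1%:Z); rewrite q.
Qed.

Let rho a b z := sine (z + a + b) * sine (z + a - b) * sine z ^+ 2 /
  (sine (z + a) ^+ 2 * (sine (z + b) * sine (z - b))).

(** The row through the origin: the factor at w = 0 omits w^2, so the square of sine z gives way to
    the square of its derivative [kappa] at z = 0. *)
Let rho0 a b := kappa R ^+ 2 * (sine (a + b) * sine (a - b)) /
  (sine a ^+ 2 * (sine b * sine (- b))).

Let wrow_tends a b z : (forall n : int, z + n%:~R != 0) ->
  (forall n : int, z + a + n%:~R != 0) -> (forall n : int, z + b + n%:~R != 0) ->
  (forall n : int, z - b + n%:~R != 0) ->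
  sine (z + a) != 0 -> sine (z + b) != 0 -> sine (z - b) != 0 ->
  tends (wrow a b z) (rho a b z).
Proof.
move=> hz ha hb hc sa sb sc; have k0 := kappa_neq0 R.
apply: tends_ext (fun B => esym (wrowE B hz ha hb hc)) _.
have -> : rho a b z = (sine (z + a + b) / kappa R) * (sine (z + a - b) / kappa R) * (sine z / kappa R) ^+ 2 /
  ((sine (z + a) / kappa R) ^+ 2 * ((sine (z + b) / kappa R) * (sine (z - b) / kappa R))).
  rewrite /rho; move: (kappa R) k0 => k k0; field.
  by rewrite k0 sa sb sc.
have T x : tends (fun B => sprod B x) (sine x / kappa R) := sprod_tends x.
have dk x : x != 0 -> x / kappa R != 0 by move=> x0; rewrite mulf_neq0 ?invr_eq0.
apply: tendsM; first by rewrite expr2; apply: tendsM (tendsM (T _) (T _)) (tendsM (T _) (T _)).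
apply: tendsV; first by apply: mulf_neq0 (expf_neq0 _ (dk _ sa)) (mulf_neq0 (dk _ sb) (dk _ sc)).
by rewrite expr2; apply: tendsM (tendsM (T _) (T _)) (tendsM (T _) (T _)).
Qed.

Let wrow0_tends a b :
  (forall n : int, a + n%:~R != 0) -> (forall n : int, b + n%:~R != 0) ->
  (forall n : int, - b + n%:~R != 0) ->
  sine a != 0 -> sine b != 0 -> tends (wrow a b 0) (rho0 a b).
Proof.
move=> ha hb hc sa sb; have k0 := kappa_neq0 R.
have sc : sine (- b) != 0 by rewrite sineN oppr_eq0.
apply: tends_ext (fun B => esym (wrow0E B ha hb hc)) _.
have -> : rho0 a b = (sine (a + b) / kappa R) * (sine (a - b) / kappa R) /
  ((sine a / kappa R) ^+ 2 * ((sine b / kappa R) * (sine (- b) / kappa R))).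
  rewrite /rho0; move: (kappa R) k0 => k k0; field.
  by rewrite k0 sa sb sc.
have T x : tends (fun B => sprod B x) (sine x / kappa R) := sprod_tends x.
have dk x : x != 0 -> x / kappa R != 0 by move=> x0; rewrite mulf_neq0 ?invr_eq0.
apply: tendsM; first exact: tendsM (T _) (T _).
apply: tendsV; first by apply: mulf_neq0 (expf_neq0 _ (dk _ sa)) (mulf_neq0 (dk _ sb) (dk _ sc)).
by rewrite expr2; apply: tendsM (tendsM (T _) (T _)) (tendsM (T _) (T _)).
Qed.

Let wlim tau a b i := if i is i'.+1 then rho a b (i%:R * tau) * rho a b (- (i%:R * tau)) else rho0 a b.

Let wquad_row tau a b i : H tau -> generic tau a -> generic tau b ->
  tends (fun B => \prod_(0 <= j < B) wquad tau a b i j) (wlim tau a b i).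
Proof.
move=> t0 ga gb; have gc := genericN gb.
have nz x (m n : int) : generic tau x -> m%:~R * tau + x + n%:~R != 0 by move=> g; apply: generic_neq0.
have sz x (m : int) : generic tau x -> sine (m%:~R * tau + x) != 0 by move=> g; apply/sine_neq0/g.
apply: tends_shift; case: i => [|i] /=.
  have z0 x n : generic tau x -> x + n%:~R != 0 by move/(nz x 0 n); rewrite mul0r add0r.
  have s0 x : generic tau x -> sine x != 0 by move/(sz x 0); rewrite mul0r add0r.
  apply: tends_ext (wrow0_tends _ _ _ _ _) => [B|n|n|n||]; try by [apply: z0|apply: s0].
  rewrite /wrow big_nat_recl //= {1}/wquad /wpoints /= big_seq1 mul0r add0r; congr (_ * _).
  by apply: eq_bigr => j _; rewrite /wquad /wpoints /= mul0r big_cons big_seq1.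
pose z : R[i] := i.+1%:R * tau.
have zE : z = i.+1%:~R * tau by rewrite /z -pmulrn.
have zN : - z = (- i.+1%:Z)%:~R * tau by rewrite zE rmorphN mulNr.
have Imz : complex.Im z != 0.
  by rewrite /z -(rmorph_nat (real_complex R)) Im_scale mulf_neq0 ?pnatr_eq0 // gt_eqF.
have z0 (n : int) : z + n%:~R != 0.
  by apply: contraNneq Imz => E; rewrite -(Im_addr z n%:~R) rmorph_int E.
have z0' (n : int) : - z + n%:~R != 0.
  by have := z0 (- n); rewrite rmorphN /= -oppr_eq0 opprB addrC.
have A : tends (wrow a b z) (rho a b z).
  by apply: wrow_tends => // [n|n|n|||]; rewrite zE; try apply: nz; try apply: sz.
have B : tends (wrow a b (- z)) (rho a b (- z)).
  by apply: wrow_tends => // [n|n|n|||]; rewrite zN; try apply: nz; try apply: sz.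
apply: tends_ext (tendsM A B) => n.
rewrite /wrow mulrACA -big_split big_nat_recl //=; congr (_ * _).
  by rewrite /wquad /wpoints /= big_cons big_seq1 addr0 addr0.
apply: eq_bigr => j _; rewrite /wquad /wpoints /= !big_cons big_nil mulr1 -/z !mulrA //.
Qed.

(** Minus the square of [kappa] times this is wp a - wp b: the classical quotient of sigma functions
    in theta form, where the exponential factors cancel. *)
Definition wpD tau a b := theta tau (a + b) * theta tau (a - b) * jacobi tau 0 ^+ 2 /
  (theta tau a ^+ 2 * theta tau b ^+ 2).

Let wlim_tends tau a b : H tau -> generic tau a -> generic tau b ->
  tends (fun A => \prod_(0 <= i < A) wlim tau a b i) (- (kappa R ^+ 2 * wpD tau a b)).
Proof.
move=> t0 ga gb; apply: tends_shift.
pose J x n := \prod_(0 <= i < n) jacobi_factor tau x i.+1.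
have hJ x : tends (J x) (jacobi tau x) := jacobi_tends x t0.
have j0 x : generic tau x -> jacobi tau x != 0.
  by move=> g; apply: jacobi_neq0 => // i; apply: jacobi_factor_neq0.
have s0 x : generic tau x -> sine x != 0.
  by move=> g; have := g 0; rewrite mul0r add0r; apply: sine_neq0.
have -> : - (kappa R ^+ 2 * wpD tau a b) = rho0 a b * (jacobi tau (a + b) * jacobi tau (a - b) * jacobi tau 0 ^+ 2 /
    (jacobi tau a ^+ 2 * jacobi tau b ^+ 2)).
  rewrite /wpD /rho0 /theta sineN; move: (kappa R) (s0 a ga) (s0 b gb) (j0 a ga) (j0 b gb) => k sa sb ja jb.
  by field; rewrite sa sb ja jb.
have L : tends (fun n => rho0 a b * (J (a + b) n * J (a - b) n * J 0 n ^+ 2 / (J a n ^+ 2 * J b n ^+ 2)))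
    (rho0 a b * (jacobi tau (a + b) * jacobi tau (a - b) * jacobi tau 0 ^+ 2 /
    (jacobi tau a ^+ 2 * jacobi tau b ^+ 2))).
  apply: tendsM (tends_cst _) (tendsM _ (tendsV _ _)).
  - by rewrite expr2; apply: tendsM (tendsM (hJ _) (hJ _)) (tendsM (hJ _) (hJ _)).
  - by rewrite mulf_neq0 ?expf_neq0 ?j0.
  - by rewrite !expr2; apply: tendsM (tendsM (hJ _) (hJ _)) (tendsM (hJ _) (hJ _)).
apply: tends_ext L => n; rewrite big_nat_recl //=; congr (_ * _).
rewrite /J -!prodrXl -!big_split /= -prodf_div; apply: eq_bigr => i _ /=.
set z := i.+1%:R * tau.
(* A factor of [jacobi] is made of sines from the rows of z and -z; the powers of e z cancel, four
   above against four below. *)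
have qE x : jacobi_factor tau x i.+1 = - (e z * (sine (z + x) * sine (- z + x))).
  rewrite /jacobi_factor /sine -!e_natM -/z.
  have -> : - ((- z + x) / 2) = z / 2 - x / 2 by field.
  have -> : (- z + x) / 2 = - (z / 2) + x / 2 by field.
  have -> : - ((z + x) / 2) = - (z / 2) - x / 2 by field.
  have -> : (z + x) / 2 = z / 2 + x / 2 by field.
  have -> : e z = e (z / 2) ^+ 2 by rewrite -e_natM; congr e; field.
  have -> : e x = e (x / 2) ^+ 2 by rewrite -e_natM; congr e; field.
  have -> : e (- x) = e (- (x / 2)) ^+ 2 by rewrite -e_natM; congr e; field.
  rewrite !e_add !eN; have := e_neq0 (z / 2); have := e_neq0 (x / 2).
  by move: (e (x / 2)) (e (z / 2)) => X Z X0 Z0; field; rewrite X0 Z0.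
have zE : z = i.+1%:~R * tau by rewrite /z -pmulrn.
have zN : - z = (- i.+1%:Z)%:~R * tau by rewrite zE rmorphN mulNr.
have sz x : generic tau x -> sine (z + x) != 0 by move=> g; rewrite zE; apply/sine_neq0/g.
have sz' x : generic tau x -> sine (- z + x) != 0 by move=> g; rewrite zN; apply/sine_neq0/g.
have jb : jacobi_factor tau b i.+1 = jacobi_factor tau (- b) i.+1.
  by rewrite /jacobi_factor opprK mulrC.
have -> : jacobi_factor tau b i.+1 ^+ 2 = jacobi_factor tau b i.+1 * jacobi_factor tau (- b) i.+1.
  by rewrite -jb expr2.
have gc := genericN gb.
rewrite !qE !addr0 /rho !addrA.
have := e_neq0 z; move: (sz a ga) (sz b gb) (sz (- b) gc) (sz' a ga) (sz' b gb) (sz' (- b) gc).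
move: (e z) (sine (z + a)) (sine (z + b)) (sine (z - b)) (sine (- z + a)) (sine (- z + b)) (sine (- z - b)).
move=> E s1 s2 s3 s4 s5 s6 n1 n2 n3 n4 n5 n6 n7.
by field; rewrite n1 n2 n3 n4 n5 n6 n7.
Qed.

Let wfactor_scale k a b w : k != 0 ->
  wfactor (k * a) (k * b) (k * w) = (if w == 0 then k ^- 2 else 1) * wfactor a b w.
Proof.
move=> k0; rewrite /wfactor mulf_eq0 (negPf k0) /=.
have scale x y (m n : nat) : (k ^+ m * x) / (k ^+ n * y) = k ^+ m / k ^+ n * (x / y).
  by rewrite invfM mulrACA.
case: eqP => _.
  have := scale ((a + b) * (a - b)) (a ^+ 2 * (b * - b)) 2 4.
  have -> : k ^+ 2 / k ^+ 4 = k ^- 2 by field.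
  by move=> <-; congr (_ / _); ring.
have := scale ((w + a + b) * (w + a - b) * w ^+ 2) ((w + a) ^+ 2 * ((w + b) * (w - b))) 4 4.
by rewrite mulfV ?expf_neq0 // => <-; congr (_ / _); ring.
Qed.

(** Dividing the lattice by tau exchanges the two coordinates. Away from 0 [wfactor] is homogeneous
    of degree 0; at 0 it has degree -2, which is the source of the weight. *)
Let wquad_swap tau a b i j : H tau ->
  wquad tau a b i j = (if (i == 0) && (j == 0) then tau ^- 2 else 1) *
    wquad (- tau^-1) (a / tau) (b / tau) j i.
Proof.
move=> t0; have tn0 := H_neq0 t0.
have [d d0 hd] := wpoints_bound t0.
have sc w : wfactor a b (tau * w) = (if w == 0 then tau ^- 2 else 1) * wfactor (a / tau) (b / tau) w.
  by rewrite -wfactor_scale // ![tau * (_ / _)]mulrCA mulfV // !mulr1.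
have E1 : i%:R * tau + j%:R = tau * (- (j%:R * - tau^-1) + i%:R) by field.
have E2 : i%:R * tau - j%:R = tau * (j%:R * - tau^-1 + i%:R) by field.
have E3 : - (i%:R * tau) + j%:R = tau * (- (j%:R * - tau^-1) - i%:R) by field.
have E4 : - (i%:R * tau) - j%:R = tau * (j%:R * - tau^-1 - i%:R) by field.
have [/andP[/eqP -> /eqP ->]|ij] := boolP ((i == 0) && (j == 0)).
  rewrite /wquad /wpoints /= !big_seq1 !mul0r !addr0.
  by have := sc 0; rewrite mulr0 eqxx.
have nz w : tau * w \in wpoints tau i j -> w != 0.
  move=> /hd h; apply: contraTneq h => ->; rewrite mulr0 modulus0 -ltNge mulr_gt0 //.
  by rewrite ltr0n lt0n -leqn0 geq_max !leqn0.
have nzE w v : v = tau * w -> v \in wpoints tau i j -> wfactor a b v = wfactor (a / tau) (b / tau) w.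
  by move=> -> /nz h; rewrite sc (negPf h) mul1r.
rewrite mul1r /wquad; move: nzE; rewrite /wpoints.
have [i0|i0] := eqVneq i 0%N; have [j0|j0] := eqVneq j 0%N; rewrite /= => nzE.
- by rewrite i0 j0 in ij.
- rewrite !big_cons !big_nil !mulr1 (nzE _ _ E1) ?in_cons ?eqxx // (nzE _ _ E2) ?in_cons ?eqxx ?orbT //.
  by rewrite i0 !addr0 mulrC.
- rewrite !big_cons !big_nil !mulr1 (nzE _ _ E1) ?in_cons ?eqxx // (nzE _ _ E3) ?in_cons ?eqxx ?orbT //.
  by rewrite j0 !mul0r oppr0.
rewrite !big_cons !big_nil !mulr1 (nzE _ _ E1) ?in_cons ?eqxx // (nzE _ _ E2) ?in_cons ?eqxx ?orbT //.
rewrite (nzE _ _ E3) ?in_cons ?eqxx ?orbT // (nzE _ _ E4) ?in_cons ?eqxx ?orbT //.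
by ring.
Qed.

(** The weight 2 of wp: rows for tau are columns for -1/tau, and absolute convergence makes the two
    orders of multiplication agree. *)
Lemma wpD_oppV tau a b : H tau -> generic tau a -> generic tau b ->
  generic (- tau^-1) (a / tau) -> generic (- tau^-1) (b / tau) ->
  wpD tau a b = tau ^- 2 * wpD (- tau^-1) (a / tau) (b / tau).
Proof.
move=> t0 ga gb ga' gb'; have t0' := H_oppV t0.
have [C C0 [k0 hk]] := wquad_bound a b t0.
pose x i j := wquad tau a b i j - 1.
have xE i j : 1 + x i j = wquad tau a b i j by rewrite /x addrC subrK.
pose col j := (if j == 0 then tau ^- 2 else 1) * wlim (- tau^-1) (a / tau) (b / tau) j.
have := @double_product_swap R x C k0 C0 hk (wlim tau a b) col (- (kappa R ^+ 2 * wpD tau a b))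
  (tau ^- 2 * - (kappa R ^+ 2 * wpD (- tau^-1) (a / tau) (b / tau))).
have k20 : kappa R ^+ 2 != 0 by rewrite expf_neq0 ?kappa_neq0.
move=> h; apply: (mulfI k20); apply: oppr_inj; rewrite h.
- by rewrite mulrN mulrCA.
- move=> i; apply: tends_ext (wquad_row i t0 ga gb) => B.
  by apply: eq_bigr => j _; rewrite xE.
- exact: wlim_tends.
- move=> j; apply: tends_shift.
  have T : tends (fun A => (if j == 0 then tau ^- 2 else 1) *
      \prod_(0 <= i < A.+1) wquad (- tau^-1) (a / tau) (b / tau) j i) (col j).
    apply: tendsM (tends_cst _) _.
    exact: (@tends_comp _ _ _ succn (fun n => leqnSn n) (wquad_row j t0' ga' gb')).
  apply: tends_ext T => A; rewrite !big_nat_recl // xE (wquad_swap _ _ _ _ t0) mulrA /=; congr (_ * _).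
  by apply: eq_bigr => i _; rewrite xE (wquad_swap _ _ _ _ t0) mul1r.
apply: tends_shift.
have T := tendsM (tends_cst (tau ^- 2)) (@tends_comp _ _ _ succn (fun n => leqnSn n) (wlim_tends t0' ga' gb')).
apply: tends_ext T => B /=; rewrite !big_nat_recl // {1}/col eqxx mulrA; congr (_ * _).
by apply: eq_bigr => j _; rewrite /col mul1r.
Qed.

End Theta.

(** * The inversion formula for eta *)

Section EtaInversion.
Variable R : realType.
Local Notation nm := (@modulus R).
Local Notation e := (@qexp R).
Local Notation H := (@upper_half_plane R).
Local Notation eta := (@dedekind R).
Implicit Types (tau a b w z x : R[i]).

Lemma generic_im tau a (c : R) : H tau -> complex.Im a = c * complex.Im tau ->
  (forall m : int, m%:~R + c != 0) -> generic tau a.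
Proof.
move=> t0 ac hc m; apply: contraNneq (hc m) => /(congr1 (@modulus R)).
rewrite modulus1 modulus_e -[RHS](@expR0 R) => /expR_inj/eqP.
have -> : complex.Im (m%:~R * tau + a) = (m%:~R + c) * complex.Im tau.
  by rewrite intr_C mulrDl -ac; case: (tau) (a) => [? ?] [? ?] /=; rewrite mul0r addr0.
by rewrite oppr_eq0 !mulf_eq0 (gt_eqF (pi_gt0 R)) (gt_eqF t0) pnatr_eq0 /= orbF.
Qed.

Lemma intr_half_neq0 (m : int) : m%:~R + 1 / 2 != 0 :> R.
Proof.
apply/eqP => h; have : (2 * m + 1)%:~R = 0 :> R by rewrite rmorphD rmorphM /=; lra.
by move/eqP; rewrite intr_eq0; lia.
Qed.

Lemma intr_Nhalf_neq0 (m : int) : m%:~R + - (1 / 2) != 0 :> R.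
Proof.
apply/eqP => h; have : (2 * m - 1)%:~R = 0 :> R by rewrite rmorphB rmorphM /=; lra.
by move/eqP; rewrite intr_eq0; lia.
Qed.

Lemma half_C : (1 / 2 : R[i]) = (1 / 2 : R)%:C.
Proof. by rewrite rmorphM fmorphV rmorph_nat. Qed.

Lemma Im_half tau : complex.Im (tau / 2) = 1 / 2 * complex.Im tau.
Proof.
have -> : tau / 2 = (1 / 2 : R)%:C * tau by rewrite -half_C; field.
by rewrite Im_scale.
Qed.

Lemma generic_half tau : H tau -> generic tau (1 / 2).
Proof.
move=> t0 m; rewrite e_add e_half; apply/eqP => h.
have := congr1 (@modulus R) h; rewrite modulusM modulusN modulus1 mulr1 modulus_e -[RHS](@expR0 R).
move=> /expR_inj/eqP; rewrite intr_C Im_scale oppr_eq0 !mulf_eq0 (gt_eqF (pi_gt0 R)) (gt_eqF t0).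
rewrite pnatr_eq0 /= orbF => /eqP m0; move: h; rewrite intr_C m0 mul0r e0 mul1r => /eqP.
by rewrite eq_sym -subr_eq0 opprK -(natrD _ 1 1) pnatr_eq0.
Qed.

Lemma generic_tau_half tau : H tau -> generic tau (tau / 2).
Proof. by move=> t0; apply: (generic_im t0 (Im_half tau)) intr_half_neq0. Qed.

Lemma generic_half_add tau : H tau -> generic tau (1 / 2 + tau / 2).
Proof.
move=> t0; apply: (@generic_im tau _ (1 / 2)) => //; last exact: intr_half_neq0.
by rewrite addrC half_C Im_addr Im_half.
Qed.

Lemma generic_half_sub tau : H tau -> generic tau (1 / 2 - tau / 2).
Proof.
move=> t0; apply: (@generic_im tau _ (- (1 / 2))) => //; last exact: intr_Nhalf_neq0.
rewrite addrC half_C Im_addr mulNr -Im_half; by case: (tau / 2).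
Qed.

Lemma e_quarter : e (1 / 4) ^+ 2 = - 1.
Proof. by rewrite -e_natM -e_half; congr e; field. Qed.

Lemma jacobi0 tau : H tau -> jacobi tau 0 = euler tau ^+ 2.
Proof.
move=> t0; apply: tends_unique (jacobi_tends 0 t0) _; rewrite expr2.
apply: tends_ext (tendsM (euler_tends t0) (euler_tends t0)) => n.
rewrite -big_split; apply: eq_bigr => i _.
by rewrite /jacobi_factor oppr0 e0 !mulr1.
Qed.

(* The three nonzero 2-torsion values multiply to a constant times a power of q,
   by Euler's identity prod (1 + q^n) (1 - q^(2n-1)) = 1. *)
Lemma theta_two_torsion tau : H tau ->
  theta tau (1 / 2) * theta tau (tau / 2) * theta tau (1 / 2 + tau / 2) = 2 * e (- (tau / 2)).
Proof.
move=> t0; pose q := e tau; pose r := e (tau / 2); pose p := e (tau / 4); pose I := e (1 / 4).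
have p0 : p != 0 := e_neq0 _; have I0 : I != 0 := e_neq0 _; have r0 : r != 0 := e_neq0 _.
have II : I ^+ 2 = - 1 := e_quarter.
have rp : r = p ^+ 2 by rewrite -e_natM; congr e; field.
have qr : q = r ^+ 2 by rewrite -e_natM; congr e; field.
have S : sine (1 / 2) * sine (tau / 2) * sine (1 / 2 + tau / 2) = 2 * r^-1 * (1 - q).
  have -> : sine (1 / 2 : R[i]) = I - I^-1.
    by rewrite /sine eN (_ : 1 / 2 / 2 = 1 / 4 :> R[i]) //; field.
  have -> : sine (tau / 2) = p - p^-1 by rewrite /sine eN (_ : tau / 2 / 2 = tau / 4) //; field.
  have -> : sine (1 / 2 + tau / 2) = I * p - (I * p)^-1.
    by rewrite /sine eN (_ : (1 / 2 + tau / 2) / 2 = 1 / 4 + tau / 4) ?e_add //; field.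
  have IV : I^-1 = - I by apply: (mulfI I0); rewrite mulfV // mulrN -expr2 II opprK.
  rewrite invfM IV qr rp.
  transitivity (I ^+ 2 * (2 * (p - p^-1) * (p + p^-1))); first by ring.
  by rewrite II; field.
pose J n := \prod_(0 <= i < n) (jacobi_factor tau (1 / 2) i.+1 *
  jacobi_factor tau (tau / 2) i.+1 * jacobi_factor tau (1 / 2 + tau / 2) i.+1).
pose E n := \prod_(0 <= k < n) (1 + - q ^+ k.+1).
have JE i : jacobi_factor tau (1 / 2) i.+1 * jacobi_factor tau (tau / 2) i.+1 *
    jacobi_factor tau (1 / 2 + tau / 2) i.+1 =
    (1 + q ^+ i.+1) ^+ 2 * (1 - q ^+ (i.+1 + i.+2)) * (1 - q ^+ (i + i.+1)).
  rewrite /jacobi_factor opprD !e_add !eN e_half -/q -/r.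
  have -> : q ^+ (i.+1 + i.+2) = (q ^+ i.+1) ^+ 2 * q by rewrite addnS exprS exprD mulrC expr2.
  have -> : q ^+ (i + i.+1) = (q ^+ i.+1) ^+ 2 / q.
    by rewrite exprD [q ^+ i.+1]exprS; have := e_neq0 tau; rewrite -/q; move: (q) (q ^+ i) => a b a0; field.
  by rewrite qr invrN invr1; field.
(* A finite form of Euler's identity: even and odd powers reassemble into the partial product of
   length 2n. *)
have key n : (1 - q) * J n * E n ^+ 2 = E (n + n)%N ^+ 2 * (1 - q ^+ (n + n.+1)).
  elim: n => [|n IHn]; first by rewrite /J /E !big_geq // add0n expr1; ring.
  have -> : J n.+1 = J n * ((1 + q ^+ n.+1) ^+ 2 * (1 - q ^+ (n.+1 + n.+2)) * (1 - q ^+ (n + n.+1))).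
    by rewrite /J big_nat_recr //= JE.
  have ES k : E k.+1 = E k * (1 + - q ^+ k.+1) by rewrite /E big_nat_recr.
  have EE : E (n.+1 + n.+1)%N = E (n + n)%N * (1 + - q ^+ (n + n.+1)) * (1 - (q ^+ n.+1) ^+ 2).
    have -> : (n.+1 + n.+1 = (n + n).+2)%N by lia.
    rewrite !ES; congr (_ * (1 - q ^+ _) * (1 - _)); first by lia.
    by rewrite -exprM; congr (_ ^+ _); lia.
  rewrite EE ES.
  transitivity (((1 - q) * J n * E n ^+ 2) * ((1 + q ^+ n.+1) ^+ 2 * (1 - q ^+ n.+1) ^+ 2 *
    (1 - q ^+ (n.+1 + n.+2)) * (1 - q ^+ (n + n.+1)))); first by ring.
  by rewrite IHn; ring.
have tE : tends E (euler tau) := euler_tends t0.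
have tJ : tends J (jacobi tau (1 / 2) * jacobi tau (tau / 2) * jacobi tau (1 / 2 + tau / 2)).
  apply: tends_ext (tendsM (tendsM (jacobi_tends (1 / 2) t0) (jacobi_tends (tau / 2) t0))
    (jacobi_tends (1 / 2 + tau / 2) t0)) => n.
  by rewrite -!big_split.
have L : tends (fun n => (1 - q) * J n * E n ^+ 2) ((1 - q) *
    (jacobi tau (1 / 2) * jacobi tau (tau / 2) * jacobi tau (1 / 2 + tau / 2)) * euler tau ^+ 2).
  by rewrite expr2; apply: tendsM (tendsM (tends_cst _) tJ) (tendsM tE tE).
have L' : tends (fun n => (1 - q) * J n * E n ^+ 2) (euler tau ^+ 2 * (1 - 0)).
  apply: (tends_ext (fun n => esym (key n))).
  have tE2 : tends (fun n => E (n + n)%N) (euler tau).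
    exact: (@tends_comp _ _ _ (fun n => n + n)%N (fun n => leq_addr n n) tE).
  rewrite expr2; apply: tendsM (tendsM tE2 tE2) (tendsD (tends_cst 1) (tendsN _)).
  by apply: tends_e_pow => // n; rewrite leq_addr.
have := tends_unique L L'; rewrite subr0 mulr1 -[RHS]mul1r => /mulIf h.
have {}h := h (expf_neq0 _ (euler_neq0 t0)).
rewrite /theta eN -/r; transitivity ((sine (1 / 2) * sine (tau / 2) * sine (1 / 2 + tau / 2)) *
  (jacobi tau (1 / 2) * jacobi tau (tau / 2) * jacobi tau (1 / 2 + tau / 2))); first by ring.
by rewrite S -[2 / r * _ * _]mulrA h mulr1.
Qed.

Let theta_half_sub tau : H tau -> theta tau (1 / 2 - tau / 2) = theta tau (1 / 2 + tau / 2).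
Proof.
move=> t0; have := thetaDtau (1 / 2 - tau / 2) t0.
have -> : 1 / 2 - tau / 2 + tau = 1 / 2 + tau / 2 by field.
have -> : - (1 / 2 - tau / 2) - tau / 2 = - (1 / 2) by ring.
by move=> ->; rewrite eN e_half invrN invr1 mulN1r opprK.
Qed.

(** At the half periods the three differences of wp multiply to a square root of the discriminant,
    up to a constant; hence the exponent 12. *)
Lemma wpD_prod tau : H tau ->
  wpD tau (1 / 2) (tau / 2) * wpD tau (1 / 2) (1 / 2 + tau / 2) *
    wpD tau (tau / 2) (1 / 2 + tau / 2) = - (eta tau ^+ 12 / 4).
Proof.
move=> t0; have p3 := theta_two_torsion t0.
have n1 := theta_neq0 t0 (generic_half t0).
have n2 := theta_neq0 t0 (generic_tau_half t0).
have n3 := theta_neq0 t0 (generic_half_add t0).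
rewrite /wpD jacobi0 // theta_half_sub //.
have -> : 1 / 2 + (1 / 2 + tau / 2) = tau / 2 + 1 by field.
have -> : 1 / 2 - (1 / 2 + tau / 2) = - (tau / 2) by ring.
have -> : tau / 2 + (1 / 2 + tau / 2) = 1 / 2 + tau by field.
have -> : tau / 2 - (1 / 2 + tau / 2) = - (1 / 2) by ring.
rewrite thetaD1 !thetaN thetaDtau //.
have -> : - (1 / 2) - tau / 2 = - (1 / 2) + - (tau / 2) :> R[i] by [].
have r0 := e_neq0 (- (tau / 2)).
have -> : eta tau ^+ 12 = (e (- (tau / 2)))^-1 * euler tau ^+ 12.
  by rewrite etaE exprMn -e_natM -eN opprK; congr (e _ * _); field.
rewrite e_add eN e_half invrN invr1.
move: p3 n1 n2 n3 r0; move: (theta tau (1 / 2)) (theta tau (tau / 2)) (theta tau (1 / 2 + tau / 2)).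
move: (e (- (tau / 2))) (euler tau) => r E u v w p3 n1 n2 n3 r0.
transitivity (- (r * E ^+ 12 / (u * v * w) ^+ 2)); first by field; rewrite n1 n2 n3.
by rewrite p3; field.
Qed.

(** Division by tau carries the half periods of [wpD_prod] to these points for -1/tau. Modulo the
    lattice the first two have changed places, so one difference, and with it the product, changes
    sign: this is the minus sign of [eta_oppV]. *)
Lemma wpD_prod' tau : H tau ->
  wpD tau (- (tau / 2)) (1 / 2) * wpD tau (- (tau / 2)) (1 / 2 - tau / 2) *
    wpD tau (1 / 2) (1 / 2 - tau / 2) = eta tau ^+ 12 / 4.
Proof.
move=> t0; have p3 := theta_two_torsion t0.
have n1 := theta_neq0 t0 (generic_half t0).
have n2 := theta_neq0 t0 (generic_tau_half t0).
have n3 := theta_neq0 t0 (generic_half_add t0).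
rewrite /wpD jacobi0 // [- (tau / 2) + 1 / 2]addrC theta_half_sub //.
have -> : - (tau / 2) - 1 / 2 = - (1 / 2 + tau / 2) by ring.
have -> : - (tau / 2) + (1 / 2 - tau / 2) = 1 / 2 - tau by field.
have -> : - (tau / 2) - (1 / 2 - tau / 2) = - (1 / 2) by ring.
have -> : 1 / 2 + (1 / 2 - tau / 2) = - (tau / 2) + 1 by field.
have -> : 1 / 2 - (1 / 2 - tau / 2) = tau / 2 by ring.
have E1 : theta tau (1 / 2) = e (tau / 2) * theta tau (1 / 2 - tau).
  have := thetaDtau (1 / 2 - tau) t0; rewrite subrK => ->.
  have -> : - (1 / 2 - tau) - tau / 2 = - (1 / 2) + tau / 2 by field.
  by rewrite e_add eN e_half invrN invr1; ring.
have -> : theta tau (1 / 2 - tau) = e (- (tau / 2)) * theta tau (1 / 2).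
  by rewrite E1 mulrA -e_add addNr e0 [RHS]mul1r.
rewrite thetaD1 !thetaN.
have r0 := e_neq0 (- (tau / 2)).
have -> : eta tau ^+ 12 = (e (- (tau / 2)))^-1 * euler tau ^+ 12.
  by rewrite etaE exprMn -e_natM -eN opprK; congr (e _ * _); field.
move: p3 n1 n2 n3 r0; move: (theta tau (1 / 2)) (theta tau (tau / 2)) (theta tau (1 / 2 + tau / 2)).
move: (e (- (tau / 2))) (euler tau) => r E u v w p3 n1 n2 n3 r0.
transitivity (r * E ^+ 12 / (u * v * w) ^+ 2); first by field; rewrite n1 n2 n3.
by rewrite p3; field.
Qed.

Lemma eta_oppV tau : H tau -> eta (- tau^-1) ^+ 12 = - (tau ^+ 6 * eta tau ^+ 12).
Proof.
move=> t0; have t0' := H_oppV t0; have tn0 := H_neq0 t0.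
have A := wpD_prod t0; have B := wpD_prod' t0'.
have ga := generic_half t0; have gb := generic_tau_half t0; have gc := generic_half_add t0.
have E1 : 1 / 2 / tau = - (- tau^-1 / 2) by field.
have E2 : tau / 2 / tau = 1 / 2 by field.
have E3 : (1 / 2 + tau / 2) / tau = 1 / 2 - - tau^-1 / 2 by field.
have ga' : generic (- tau^-1) (1 / 2 / tau) by rewrite E1; apply/genericN/generic_tau_half.
have gb' : generic (- tau^-1) (tau / 2 / tau) by rewrite E2; apply: generic_half.
have gc' : generic (- tau^-1) ((1 / 2 + tau / 2) / tau) by rewrite E3; apply: generic_half_sub.
rewrite (wpD_oppV t0 ga gb ga' gb') (wpD_oppV t0 ga gc ga' gc') (wpD_oppV t0 gb gc gb' gc') in A.
rewrite E1 E2 E3 in A.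
have A2 : tau ^- 6 * (eta (- tau^-1) ^+ 12 / 4) = - (eta tau ^+ 12 / 4).
  by rewrite -A -B; field.
have t6 : tau ^+ 6 != 0 by rewrite expf_neq0.
transitivity (4 * tau ^+ 6 * (tau ^- 6 * (eta (- tau^-1) ^+ 12 / 4))); first by field.
by rewrite A2; field.
Qed.

End EtaInversion.

(** * Eta quotients under the modular group *)

(** A record, so that matrix identities reduce to [ring] on four entries; [to2] and [of2] translate
    to the matrices of the statement. *)
Record mat2 := Mat2 { m11 : int; m12 : int; m21 : int; m22 : int }.

Definition mul2 (g h : mat2) := Mat2
  (m11 g * m11 h + m12 g * m21 h) (m11 g * m12 h + m12 g * m22 h)
  (m21 g * m11 h + m22 g * m21 h) (m21 g * m12 h + m22 g * m22 h).

Definition det2 (g : mat2) := m11 g * m22 g - m12 g * m21 g.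

Definition adj2 (g : mat2) := Mat2 (m22 g) (- m12 g) (- m21 g) (m11 g).

Lemma mul2A : associative mul2.
Proof. by case=> ? ? ? ? [? ? ? ?] [? ? ? ?]; rewrite /mul2 /=; congr Mat2; ring. Qed.

Lemma det2M g h : det2 (mul2 g h) = det2 g * det2 h.
Proof. by case: g => ? ? ? ?; case: h => ? ? ? ?; rewrite /det2 /=; ring. Qed.

Lemma det2_adj g : det2 (adj2 g) = det2 g.
Proof. by case: g => ? ? ? ?; rewrite /det2 /=; ring. Qed.

Lemma mul2_adj g : det2 g = 1 -> mul2 g (adj2 g) = Mat2 1 0 0 1.
Proof. by case: g => a b c d; rewrite /det2 /mul2 /= => E; congr Mat2; lia. Qed.

Lemma mul2_adjl g : det2 g = 1 -> mul2 (adj2 g) g = Mat2 1 0 0 1.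
Proof. by case: g => a b c d; rewrite /det2 /mul2 /= => E; congr Mat2; lia. Qed.

Lemma mul2_1l g : mul2 (Mat2 1 0 0 1) g = g.
Proof. by case: g => ? ? ? ?; rewrite /mul2 /=; congr Mat2; ring. Qed.

Lemma mul2_1r g : mul2 g (Mat2 1 0 0 1) = g.
Proof. by case: g => ? ? ? ?; rewrite /mul2 /=; congr Mat2; ring. Qed.

Definition upper (a b d : nat) := Mat2 a b 0 d.

(** Bezout coefficients of the first column give the row operation, and k reduces the upper right
    entry modulo d. That a is the gcd of the first column is recorded because it fixes the arguments
    of the eta factors at a cusp. *)
Lemma hermite (B : mat2) (N : nat) : (0 < N)%N -> det2 B = N ->
  exists g, exists a, exists b, exists d, [/\ det2 g = 1, B = mul2 g (upper a b d),
    (0 < a)%N, (a * d = N)%N & (b < d)%N] /\ a = gcdn `|m11 B| `|m21 B|.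
Proof.
case: B => p q r s N0; rewrite /det2 /= => detB.
have A0 : (0 < gcdn `|p| `|r|)%N.
  rewrite gcdn_gt0 !absz_gt0; apply: contraT; rewrite negb_or !negbK => /andP[/eqP p0 /eqP r0].
  by move: detB N0; rewrite p0 r0; lia.
set A := gcdn _ _ in A0 *.
have [u [v uv]] : exists u v : int, u * p + v * r = A by case: (Bezoutz p r) => u [v E]; exists u, v.
have [p' pE] : exists p' : int, p = p' * A%:Z.
  by exists (p %/ A)%Z; rewrite divzK // dvdzE /= dvdn_gcdl.
have [r' rE] : exists r' : int, r = r' * A%:Z.
  by exists (r %/ A)%Z; rewrite divzK // dvdzE /= dvdn_gcdr.
have An0 : A%:Z != 0 by rewrite eqz_nat -lt0n.
have pr : u * p' + v * r' = 1.
  by apply: (mulIf An0); rewrite mul1r -[RHS]uv mulrDl -!mulrA -pE -rE.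
have ND : N%:Z = A%:Z * (p' * s - q * r') by rewrite -detB pE rE; ring.
have D0 : 0 < p' * s - q * r'.
  by rewrite -(pmulr_rgt0 _ (_ : 0 < A%:Z)) -?ND ?ltz_nat.
pose D := absz (p' * s - q * r')%R.
have DE : D%:Z = p' * s - q * r' by rewrite /D gez0_abs // ltW.
have Dn0 : D%:Z != 0 by rewrite DE gt_eqF.
pose x := u * q + v * s; pose k := (x %/ D)%Z.
have bE : (absz (x %% D)%Z)%:Z = x - k * D by rewrite gez0_abs ?modz_ge0 // /k [x in RHS](divz_eq x D) addrAC subrr add0r.
exists (Mat2 p' (p' * k - v) r' (r' * k + u)), A, (absz (x %% D)%Z), D.
split=> //; split=> //.
- rewrite /det2 /=; transitivity (u * p' + v * r'); [by ring|exact: pr].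
- rewrite /mul2 /upper /= bE; congr Mat2; rewrite ?mulr0 ?addr0 //.
  + transitivity (q * (u * p' + v * r')); first by rewrite pr mulr1.
    by rewrite /x DE; ring.
  + transitivity (s * (u * p' + v * r')); first by rewrite pr mulr1.
    by rewrite /x DE; ring.
- by apply/eqP; rewrite -eqz_nat PoszM DE -ND.
by rewrite -ltz_nat gez0_abs ?modz_ge0 // -[X in _ < X]gtz0_abs ?ltz_mod // DE.
Qed.

Section Action.
Variable R : realType.
Local Notation nm := (@modulus R).
Local Notation e := (@qexp R).
Local Notation H := (@upper_half_plane R).
Local Notation eta := (@dedekind R).
Implicit Types (g h : mat2) (tau : R[i]).

Definition den g tau : R[i] := (m21 g)%:~R * tau + (m22 g)%:~R.
Definition act g tau : R[i] := ((m11 g)%:~R * tau + (m12 g)%:~R) / den g tau.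

Lemma den_neq0 g tau : H tau -> 0 < det2 g -> den g tau != 0.
Proof.
case: g => a b c d t0; rewrite /det2 /= => D0; rewrite /den /=; apply/eqP => E.
have := congr1 (@complex.Im R) E; rewrite !intr_C Im_addr Im_scale => /eqP.
rewrite mulf_eq0 (gt_eqF t0) orbF intr_eq0 => /eqP c0; move: E; rewrite c0 mul0r add0r.
by move/eqP; rewrite intr_eq0 => /eqP d0; move: D0; rewrite c0 d0; lia.
Qed.

Lemma Im_div (z w : R[i]) : complex.Im (z / w) =
  (complex.Im z * complex.Re w - complex.Re z * complex.Im w) / nm w ^+ 2.
Proof. by rewrite modulus_sqr; case: z => a b; case: w => c d /=; ring. Qed.

Lemma Im_act g tau : H tau -> 0 < det2 g ->
  complex.Im (act g tau) = (det2 g)%:~R * complex.Im tau / nm (den g tau) ^+ 2.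
Proof.
move=> _ _; rewrite /act Im_div modulus_sqr /den /det2 !intr_C rmorphB !rmorphM /=.
by case: tau => x y /=; congr (_ / _); ring.
Qed.

Lemma H_act g tau : H tau -> 0 < det2 g -> H (act g tau).
Proof.
move=> t0 D0; rewrite /upper_half_plane /= Im_act //; apply: divr_gt0.
  by rewrite mulr_gt0 ?ltr0z.
by rewrite exprn_gt0 // modulus_gt0 den_neq0.
Qed.

Lemma denM g h tau : H tau -> 0 < det2 h -> den (mul2 g h) tau = den g (act h tau) * den h tau.
Proof.
move=> t0 D0; have n0 := den_neq0 t0 D0; move: n0; rewrite /act; case: g => a b c d; case: h {D0} => p q r s.
rewrite /den /= => n0; rewrite mulrDl mulrA divfK // !rmorphD !rmorphM /=; ring.
Qed.

Lemma actM g h tau : H tau -> 0 < det2 g -> 0 < det2 h ->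
  act (mul2 g h) tau = act g (act h tau).
Proof.
move=> t0 Dg D0; have n1 := den_neq0 (H_act t0 D0) Dg; have n0 := den_neq0 t0 D0.
rewrite {1}/act denM // [in RHS]/act.
have -> : (m11 (mul2 g h))%:~R * tau + (m12 (mul2 g h))%:~R =
    ((m11 g)%:~R * act h tau + (m12 g)%:~R) * den h tau.
  have := @denM (Mat2 0 0 (m11 g) (m12 g)) h tau t0 D0; rewrite {1 2}/den /= => <-.
  by case: (g) (h) => ? ? ? ? [? ? ? ?].
by rewrite -mulf_div divff // mulr1.
Qed.

Lemma act1 tau : act (Mat2 1 0 0 1) tau = tau.
Proof. by rewrite /act /den /= mul0r add0r addr0 mul1r divr1. Qed.

Lemma act_T (n : int) tau : act (Mat2 1 n 0 1) tau = tau + n%:~R.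
Proof. by rewrite /act /den /= mul0r add0r mul1r divr1. Qed.

Lemma act_S tau : act (Mat2 0 1 (-1) 0) tau = - tau^-1.
Proof. by rewrite /act /den /= mul0r add0r addr0 mulN1r invrN mulrN mul1r. Qed.

Lemma act_upper a b d tau : act (upper a b d) tau = (a%:R * tau + b%:R) / d%:R.
Proof. by rewrite /act /den /= mul0r add0r -!pmulrn. Qed.

Lemma det_upper a b d : det2 (upper a b d) = (a * d)%N.
Proof. by rewrite /det2 /= mulr0 subr0 PoszM. Qed.

Lemma euler_addr_int tau (n : int) : euler (tau + n%:~R) = euler tau.
Proof.
rewrite euler.unlock; suff -> : e (tau + n%:~R) = e tau by [].
by rewrite e_add e_int mulr1.
Qed.

Lemma eta_addr_int tau (n : int) : eta (tau + n%:~R) = e (n%:~R / 24) * eta tau.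
Proof. by rewrite !etaE euler_addr_int mulrDl e_add mulrCA mulrA. Qed.

Definition delta tau := eta tau ^+ 24.

Lemma delta_addr_int tau (n : int) : delta (tau + n%:~R) = delta tau.
Proof.
rewrite /delta eta_addr_int exprMn -e_natM (_ : 24 * (n%:~R / 24) = n%:~R :> R[i]).
  by rewrite e_int mul1r.
by field.
Qed.

Lemma delta_oppV tau : H tau -> delta (- tau^-1) = tau ^+ 12 * delta tau.
Proof.
have E (x : R[i]) m : (x ^+ m) ^+ 2 = x ^+ (m * 2)%N by rewrite exprM.
move=> t0; rewrite /delta -(E (eta tau) 12%N) -(E (eta (- tau^-1)) 12%N) eta_oppV //.
by rewrite sqrrN exprMn (E tau).
Qed.

(** Euclid's algorithm on the bottom row: g = h ST, where ST sends tau to -1/(tau + k) for the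
    quotient k of d by c, and the remainder becomes the lower left entry of h. For c = 0 the matrix
    g is a translation up to sign. *)
Lemma delta_act g tau : H tau -> det2 g = 1 -> delta (act g tau) = den g tau ^+ 12 * delta tau.
Proof.
have [n] := ubnP `|m21 g|%N; elim: n g tau => // n IHn [a b c d] tau cn t0 D1; rewrite /= ltnS in cn.
have [c0|c0] := eqVneq c 0.
  rewrite /det2 /= c0 mulr0 subr0 in D1.
  have dd : (d == 1) || (d == -1).
    have /eqP := congr1 absz D1; rewrite abszM muln_eq1 => /andP[_ /eqP d1]; lia.
  have ad : a = d by case/orP: dd => /eqP E; rewrite E in D1 *; lia.
  have d12 : den (Mat2 a b c d) tau ^+ 12 = 1.
    by rewrite /den /= c0 mul0r add0r; case/orP: dd => /eqP->; rewrite ?expr1n // rmorphN /= -signr_odd.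
  rewrite d12 mul1r; have -> : act (Mat2 a b c d) tau = tau + (d * b)%:~R.
    rewrite /act /den /= c0 mul0r add0r ad rmorphM /=.
    by case/orP: dd => /eqP->; rewrite ?rmorphN /= ?divr1 ?invrN ?invr1 ?mul1r //; ring.
  by rewrite delta_addr_int.
pose k := (d %/ c)%Z; pose d' := (d %% c)%Z.
have dE : d = k * c + d' by rewrite /k /d' -divz_eq.
have d'c : (`|d'| < `|c|)%N by rewrite -ltz_nat abszE ger0_norm ?modz_ge0 // ltz_mod.
have Hs : H (- (tau + k%:~R)^-1) by apply/H_oppV/H_addr_int.
pose h := Mat2 (b - k * a) (- a) d' (- c).
have hD : det2 h = 1 by move: D1; rewrite /det2 /= dE; lia.
pose ST := Mat2 0 1 (-1) (- k).
have gE : Mat2 a b c d = mul2 h ST by rewrite /mul2 /=; congr Mat2; rewrite ?dE; ring.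
have STD : det2 ST = 1 by rewrite /det2 /=; ring.
have denST : den ST tau = - (tau + k%:~R) by rewrite /den /= mulN1r rmorphN opprD.
have actST : act ST tau = - (tau + k%:~R)^-1.
  by rewrite /act denST /= mul0r add0r mul1r invrN.
rewrite gE actM ?hD ?STD // denM ?STD // denST actST IHn //; last exact: leq_trans d'c cn.
rewrite delta_oppV ?delta_addr_int; last exact: H_addr_int.
by rewrite mulrN exprNn -signr_odd expr0 mul1r exprMn mulrA.
Qed.

Lemma continuousH_comp (f g : R[i] -> R[i]) : continuousH f -> continuousH g ->
  (forall tau, H tau -> H (g tau)) -> continuousH (f \o g).
Proof.
move=> cf cg gH t Ht eps eps0; have [d d0 hd] := cf _ (gH t Ht) _ eps0.
have [r r0 hr] := cg t Ht _ d0; exists r => // s Hs /(hr _ Hs) h.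
by apply: hd => //; apply: gH.
Qed.

Lemma continuousH_id : continuousH (fun tau : R[i] => tau).
Proof. by move=> t Ht eps eps0; exists eps. Qed.

Lemma continuousH_affine (a b : R[i]) : continuousH (fun tau => a * tau + b).
Proof.
exact: continuousHD (continuousHM (continuousH_cst a) continuousH_id) (continuousH_cst b).
Qed.

Lemma continuousH_act g : 0 < det2 g -> continuousH (act g).
Proof.
move=> D0; apply: continuousHM (continuousH_affine _ _) (continuousHV _ (continuousH_affine _ _)).
by move=> tau t0; exact: den_neq0.
Qed.

Lemma continuousH_exprz (f : R[i] -> R[i]) (k : int) : (forall tau, H tau -> f tau != 0) ->
  continuousH f -> continuousH (fun tau => f tau ^ k).
Proof.
move=> f0 cf; have X n : continuousH (fun tau => f tau ^+ n).
  elim: n => [|n IHn]; first exact: continuousH_cst.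
  by apply: continuousH_ext (continuousHM cf IHn) => tau _; rewrite exprS.
case: k => n; first exact: X.
apply: continuousH_ext (continuousHV _ (X n.+1)) => [tau _|tau /f0 h]; first by rewrite NegzE -exprnN.
by rewrite expf_neq0.
Qed.

Lemma continuousH_eta : continuousH (@dedekind R).
Proof.
apply: continuousH_ext (continuousHM (continuousH_e (24%:R)^-1)
  (Hol_continuous (Hol_euler (idfun : {rmorphism R[i] -> R[i]})))) => tau _.
by rewrite etaE.
Qed.

Lemma continuousH_prod (I : eqType) (s : seq I) (F : I -> R[i] -> R[i]) :
  {in s, forall i, continuousH (F i)} -> continuousH (fun tau => \prod_(i <- s) F i tau).
Proof.
elim: s => [|i s IHs] cF.
  by apply: continuousH_ext (continuousH_cst 1) => tau _; rewrite big_nil.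
apply: continuousH_ext (continuousHM (cF i (mem_head _ _)) (IHs _)) => [tau _|j js].
  by rewrite big_cons.
by apply: cF; rewrite in_cons js orbT.
Qed.

(** The values are among the roots of X^n - c, so connectedness applies. *)
Lemma power_cst (f : R[i] -> R[i]) (n : nat) (c : R[i]) : (0 < n)%N -> continuousH f ->
  (forall tau, H tau -> f tau ^+ n = c) -> forall t u, H t -> H u -> f t = f u.
Proof.
move=> n0 cf fn; have [s hs] := closed_field_poly_normal ('X^n - c%:P).
have p0 : 'X^n - c%:P != 0 :> {poly R[i]} by rewrite -size_poly_eq0 size_XnsubC.
apply: (continuousH_finite_range (s := s) cf) => tau t0.
have : root ('X^n - c%:P) (f tau) by rewrite rootE !hornerE fn // subrr.
by rewrite hs rootZ ?lead_coef_eq0 // root_prod_XsubC.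
Qed.

Definition etaq (rs : seq (nat * int)) tau := \prod_(p <- rs) eta (p.1%:R * tau) ^ p.2.

Definition etaq_at (rs : seq (nat * int)) (hf : nat -> nat * nat * nat) tau :=
  \prod_(p <- rs) eta (act (upper (hf p.1).1.1 (hf p.1).1.2 (hf p.1).2) tau) ^ p.2.

Definition weight0 (rs : seq (nat * int)) := \sum_(p <- rs) p.2 = 0.

(* By the modularity of Delta the quotient of the two sides has a constant 24th power,
   hence is constant by connectedness. *)
Lemma etaq_act rs g : det2 g = 1 -> weight0 rs -> all (fun p => 0 < p.1)%N rs ->
  exists hf, (forall d, (0 < d)%N -> [/\ (0 < (hf d).1.1)%N, ((hf d).1.1 * (hf d).2 = d)%N,
      ((hf d).1.2 < (hf d).2)%N & (hf d).1.1 = gcdn d `|m21 g|]) /\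
    exists2 c, c != 0 & forall tau, H tau -> etaq rs (act g tau) = c * etaq_at rs hf tau.
Proof.
move=> Dg w0 pos.
have /choice[hf hhf] : forall d : nat, exists f : nat * nat * nat, (0 < d)%N -> [/\ (0 < f.1.1)%N, (f.1.1 * f.2 = d)%N,
      (f.1.2 < f.2)%N & f.1.1 = gcdn d `|m21 g|] /\
      exists2 h, det2 h = 1 & mul2 (Mat2 d 0 0 1) g = mul2 h (upper f.1.1 f.1.2 f.2).
  case=> [|d]; first by exists (0, 0, 0)%N.
  have Dd : det2 (mul2 (Mat2 d.+1 0 0 1) g) = d.+1 by rewrite det2M Dg /det2 /= !mulr1 subr0.
  have [h [a [b [d' [[Dh E a0 ad bd] aE]]]]] := hermite (ltn0Sn d) Dd.
  exists (a, b, d') => _; split; last by exists h.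
  split=> //; rewrite aE /= !mul0r addr0 add0r mul1r abszM /=.
  (* gcd(d m11, m21) = gcd(d, m21), because the first column of g is coprime. *)
  rewrite gcdnC Gauss_gcdl; first by rewrite gcdnC.
  rewrite coprime_sym /coprime.
  have : (gcdz (m11 g) (m21 g) %| 1)%Z.
    rewrite (esym Dg : 1%Z = det2 g); apply: rpredB; [apply/dvdz_mulr/dvdz_gcdl|apply/dvdz_mull/dvdz_gcdr].
  by rewrite dvdzE /= dvdn1.
exists hf; split=> [d /hhf[]//|].
pose D d := (hf d).2.
(* The relation diag(d, 1) g = h (a b; 0 d') turns the automorphy factor of h into that of g, up to
   the constant d'^-12. *)
have key d tau : (0 < d)%N -> H tau ->
    eta (d%:R * act g tau) ^+ 24 = den g tau ^+ 12 * (D d)%:R ^- 12 *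
      eta (act (upper (hf d).1.1 (hf d).1.2 (hf d).2) tau) ^+ 24.
  move=> d0 t0; have [[a0 ad bd _] [h Dh E]] := hhf d d0.
  have Dpos : (0 < D d)%N by apply: leq_ltn_trans bd.
  have DU : 0 < det2 (upper (hf d).1.1 (hf d).1.2 (hf d).2) by rewrite det_upper ad ltz_nat.
  have Dd : 0 < det2 (Mat2 d 0 0 1) by rewrite /det2 /= mulr1 subr0 ltz_nat.
  have g0 : 0 < det2 g by rewrite Dg.
  have h0 : 0 < det2 h by rewrite Dh.
  have -> : d%:R * act g tau = act h (act (upper (hf d).1.1 (hf d).1.2 (hf d).2) tau).
    by rewrite -actM // -E actM // {2}/act /den /= mul0r add0r addr0 divr1.
  rewrite -!/(delta _) delta_act //; last exact: H_act.
  congr (_ * _); have := denM h t0 DU; rewrite -E denM //.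
  rewrite {1}/den /= mul0r add0r mul1r {3}/den /= mul0r add0r -pmulrn => ->.
  by rewrite exprMn mulfK // expf_neq0 // pnatr_eq0 -lt0n.
have eta0 d tau : (0 < d)%N -> H tau -> eta (act (upper (hf d).1.1 (hf d).1.2 (hf d).2) tau) != 0.
  by move=> /hhf[[a0 ad bd _] _] t0; apply/eta_neq0/H_act; rewrite // det_upper ltz_nat muln_gt0 a0 (leq_ltn_trans _ bd).
pose f tau := etaq rs (act g tau) / etaq_at rs hf tau.
have g0 : 0 < det2 g by rewrite Dg.
have Hd (d : nat) tau : (0 < d)%N -> H tau -> H (d%:R * tau).
  move=> d0 t0; rewrite /upper_half_plane /= -(rmorph_nat (real_complex R)) Im_scale.
  by rewrite mulr_gt0 ?ltr0n.
have at0 tau : H tau -> etaq_at rs hf tau != 0.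
  move=> t0; rewrite /etaq_at prodf_seq_neq0; apply/allP => p /(allP pos) p0 /=.
  by rewrite expfz_neq0 // eta0.
have q0 tau : H tau -> etaq rs tau != 0.
  move=> t0; rewrite /etaq prodf_seq_neq0; apply/allP => p /(allP pos) p0 /=.
  by apply/expfz_neq0/eta_neq0/Hd.
have i0 : H 'i by rewrite /upper_half_plane /= ltr01.
pose c := f 'i.
have fc tau : H tau -> f tau = c.
  move=> t0; apply: (@power_cst f 24 (\prod_(p <- rs) ((D p.1)%:R ^- 12) ^ p.2)) => //.
    apply: continuousHM (continuousHV at0 _).
      apply: (@continuousH_comp (etaq rs) (act g)); last by move=> t Ht; apply: H_act.
        apply: continuousH_prod => p /(allP pos) p0; apply: continuousH_exprz => [t Ht|].
          by apply/eta_neq0/Hd.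
        apply: (@continuousH_comp eta (fun t => p.1%:R * t)) continuousH_eta _ _ => [|t Ht]; last exact: Hd.
        by apply: continuousH_ext (continuousH_affine p.1%:R 0) => t _; rewrite addr0.
      exact: continuousH_act.
    apply: continuousH_prod => p /(allP pos) p0; apply: continuousH_exprz => [t Ht|]; first exact: eta0.
    have [[a0 ad bd _] _] := hhf _ p0.
    have U0 : 0 < det2 (upper (hf p.1).1.1 (hf p.1).1.2 (hf p.1).2).
      by rewrite det_upper ltz_nat muln_gt0 a0 (leq_ltn_trans _ bd).
    apply: (@continuousH_comp eta) continuousH_eta (continuousH_act U0) _ => t Ht.
    exact: H_act.
  move=> t Ht; rewrite /f /etaq /etaq_at -prodfV -big_split /= -prodrXl.
  have gt0 := den_neq0 Ht g0.
  transitivity (\prod_(p <- rs) ((den g t ^+ 12) ^ p.2 * ((D p.1)%:R ^- 12) ^ p.2)).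
    apply: eq_big_seq => p /(allP pos) p0.
    have e1 := eta0 p.1 t p0 Ht; have k := key p.1 t p0 Ht.
    have XZ (x : R[i]) (r : int) n : (x ^ r) ^+ n = (x ^+ n) ^ r.
      by rewrite -[LHS]/((x ^ r) ^ n%:Z) exprzAC.
    rewrite exprMn exprVn !XZ k (expfzMl (den g t ^+ 12 * (D p.1)%:R ^- 12)).
    rewrite (expfzMl (den g t ^+ 12)) mulfK //.
    by apply/expfz_neq0/expf_neq0.
  (* The automorphy factors of g occur with total exponent 0. *)
  rewrite big_split /= -[RHS]mul1r; congr (_ * _).
  have prodz (x : R[i]) (s : seq (nat * int)) : x != 0 -> \prod_(p <- s) x ^ p.2 = x ^ (\sum_(p <- s) p.2).
    move=> x0; elim: s => [|p s IHs]; first by rewrite !big_nil expr0z.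
    by rewrite !big_cons IHs expfzDr.
  by rewrite prodz ?expf_neq0 // w0 expr0z.
exists c; first by apply: mulf_neq0 (q0 _ (H_act i0 g0)) (invr_neq0 (at0 _ i0)).
by move=> tau t0; rewrite -(fc _ t0) /f divfK // at0.
Qed.

End Action.

(** * Certificates for the multiplier systems *)

(* The exponents r_d of the eta quotients, as pairs (d, r_d). *)
Definition exponents (M : nat) : seq (nat * int) :=
  match M with
  | 2 => [:: (1, 24%:Z); (2, - 24%:Z)]
  | 3 => [:: (1, 12%:Z); (3, - 12%:Z)]
  | 4 => [:: (1, 8%:Z); (4, - 8%:Z)]
  | 5 => [:: (1, 6%:Z); (5, - 6%:Z)]
  | 6 => [:: (1, 5%:Z); (3, 1%:Z); (2, - 1%:Z); (6, - 5%:Z)]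
  | 7 => [:: (1, 4%:Z); (7, - 4%:Z)]
  | 8 => [:: (1, 4%:Z); (4, 2%:Z); (2, - 2%:Z); (8, - 4%:Z)]
  | 9 => [:: (1, 3%:Z); (9, - 3%:Z)]
  | 10 => [:: (1, 3%:Z); (5, 1%:Z); (2, - 1%:Z); (10, - 3%:Z)]
  | 12 => [:: (1, 3%:Z); (4, 1%:Z); (6, 2%:Z); (2, - 2%:Z); (3, - 1%:Z); (12, - 3%:Z)]
  | 13 => [:: (1, 2%:Z); (13, - 2%:Z)]
  | 16 => [:: (1, 2%:Z); (8, 1%:Z); (2, - 1%:Z); (16, - 2%:Z)]
  | 18 => [:: (1, 2%:Z); (6, 1%:Z); (9, 1%:Z); (2, - 1%:Z); (3, - 1%:Z); (18, - 2%:Z)]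
  | 25 => [:: (1, 1%:Z); (25, - 1%:Z)]
  | _ => [::]
  end%N.

Definition levels := [:: 2; 3; 4; 5; 6; 7; 8; 9; 10; 12; 13; 16; 18; 25]%N.

(* [bigop] does not compute, hence the explicit [foldr]. *)
Definition sumz (f : nat -> int) (rs : seq (nat * int)) : int :=
  foldr (fun p s => p.2 * f p.1 + s) 0 rs.

Lemma sumzE f rs : sumz f rs = \sum_(p <- rs) p.2 * f p.1.
Proof. by elim: rs => [|p rs IH]; rewrite ?big_nil // big_cons -IH. Qed.

Section Certificates.
Variables (M : nat) (rs : seq (nat * int)).

(* The bottom row of an elliptic matrix, of trace tr. *)
Definition elliptic_row (c d : int) : bool :=
  has (fun tr : int => (c %| (tr - d) * d - 1)%Z) [:: 0; 1; -1].

(* The bottom row of a conjugate of T^w or -T^w by a matrix with first column (p, s). *)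
Definition parabolic_row (c d : int) : bool :=
  has (fun s : nat => (s ^ 2 %| `|c|)%N && (let w := (`|c| %/ s ^ 2)%N in
    [&& all (fun p => p.1 %| w * gcdn p.1 s ^ 2)%N rs,
        (24 %| sumz (fun d => (w * gcdn d s ^ 2 %/ d)%N) rs)%Z &
        has (fun p : nat => coprime p s &&
          ((c %| d + (1 + p%:Z * s%:Z * w%:Z)) || (c %| d - (1 + p%:Z * s%:Z * w%:Z)))%Z) (iota 0 s)]))
    (iota 1 M).

Definition fixing_row (c d : int) : bool :=
  [&& 0 < c, (M %| c)%Z & elliptic_row c d || parabolic_row c d].

(** Right multiplication by a translation changes d by a multiple of c, hence the congruence. *)
Definition known_row (D : seq (int * int)) (c d : int) : bool :=
  fixing_row c d || has (fun q => (q.1 == c) && (c %| d - q.2)%Z) D.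

(* Each new bottom row is that of a product of two matrices with known bottom rows;
   the quadruple is the right-hand factor. *)
Fixpoint derivation_ok (D : seq (int * int)) (l : seq ((int * int) * (int * int * int * int))) : bool :=
  if l is ((c, d), (a1, b1, c1, d1)) :: l' then
    let c2 := c * d1 - d * c1 in let d2 := d * a1 - c * b1 in
    [&& 0 < c, (M %| c)%Z, a1 * d1 - b1 * c1 == 1, known_row D c1 d1,
        (0 < c2) && known_row D c2 d2 || (c2 < 0) && known_row D (- c2) (- d2) &
        derivation_ok ((c, d) :: D) l']
  else true.

(* The open intervals ](d - 1) / c, (d + 1) / c[ cover [r / s, 1] except for breakpoints,
   which are either bottom rows already known or not bottom rows of Gamma_0(M). *)
Fixpoint covering_ok (D : seq (int * int)) (r s : int) (l : seq ((int * int) * (int * int))) : bool :=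
  if l is ((c, d), (r', s')) :: l' then
    [&& (M %| c)%Z && (0 < c), coprimez c d, known_row D c d, (d - 1) * s <= r * c, r' * c <= (d + 1) * s', 0 < s',
        coprimez r' s', ~~ (M %| s')%Z || known_row D s' r' & covering_ok D r' s' l']
  else (r == 1) && (s == 1).

Definition certificate l k :=
  derivation_ok [::] l && covering_ok (rev [seq q.1 | q <- l]) 0 1 k.

(** Weight 0, divisors of M, order -1 at infinity, and order at least 0 at the cusps of denominator
    g with M not dividing g: the last sum is a positive multiple of the order of the eta quotient
    there. Since every d divides M, g matters modulo M only. *)
Definition exponents_ok : bool :=
  [&& (1 < M)%N, sumz (fun=> 1) rs == 0, all (fun p => (0 < p.1)%N && (p.1 %| M)%N) rs,
      sumz (fun d => d) rs == -24 &
      all (fun g => (M %| g)%N || (0 <= sumz (fun d => (gcdn d g ^ 2 * (M %/ d))%N) rs)) (iota 0 M)].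

End Certificates.

(** At the other levels of the list, elliptic and parabolic rows alone suffice for the covering. *)
Definition derivation (M : nat) : seq ((int * int) * (int * int * int * int)) :=
  match M with
  | 12 => [:: ((24, 7), (5,2,12,5)); ((24, 19), (11,10,12,11))]
  | 13 => [:: ((13, 2), (9,2,13,3)); ((13, 6), (10,3,13,4)); ((13, 7), (11,5,13,6)); ((13, 11),
      (5,3,13,8))]
  | 25 => [:: ((25, 3), (19,3,25,4)); ((25, 8), (21,5,25,6)); ((25, 12), (22,7,25,8)); ((25,
      13), (23,11,25,12)); ((25, 17), (2,1,25,13)); ((25, 22), (7,5,25,18)); ((25, 23),
      (8,7,25,22)); ((25, 2), (1,0,25,1))]
  | _ => [::]
  end.

(** An entry is a bottom row (c, d), the centre d / c of an interval, followed by the breakpoint up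
    to which the interval is used. The range from 0 to 1 is enough since d matters modulo c only. *)
Definition covering (M : nat) : seq ((int * int) * (int * int)) :=
  match M with
  | 2 => [:: ((2, 1), (1, 1))]
  | 3 => [:: ((3, 1), (2, 3)); ((3, 2), (1, 1))]
  | 4 => [:: ((4, 1), (1, 2)); ((4, 3), (1, 1))]
  | 5 => [:: ((5, 1), (2, 5)); ((5, 3), (4, 5)); ((5, 4), (1, 1))]
  | 6 => [:: ((6, 1), (1, 3)); ((12, 5), (1, 2)); ((12, 7), (2, 3)); ((6, 5), (1, 1))]
  | 7 => [:: ((7, 1), (2, 7)); ((7, 3), (4, 7)); ((7, 5), (6, 7)); ((7, 6), (1, 1))]
  | 8 => [:: ((8, 1), (1, 4)); ((8, 3), (1, 2)); ((8, 5), (3, 4)); ((8, 7), (1, 1))]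
  | 9 => [:: ((9, 1), (2, 9)); ((9, 2), (1, 3)); ((9, 4), (5, 9)); ((9, 5), (2, 3)); ((9, 7),
      (8, 9)); ((9, 8), (1, 1))]
  | 10 => [:: ((10, 1), (1, 5)); ((10, 3), (2, 5)); ((20, 9), (1, 2)); ((20, 11), (3, 5)); ((10,
      7), (4, 5)); ((10, 9), (1, 1))]
  | 12 => [:: ((12, 1), (1, 6)); ((36, 7), (2, 9)); ((48, 11), (1, 4)); ((48, 13), (7, 24));
      ((36, 11), (1, 3)); ((12, 5), (1, 2)); ((12, 7), (2, 3)); ((36, 25), (13, 18)); ((48, 35),
      (3, 4)); ((48, 37), (19, 24)); ((36, 29), (5, 6)); ((12, 11), (1, 1))]
  | 13 => [:: ((13, 1), (2, 13)); ((13, 3), (4, 13)); ((13, 5), (6, 13)); ((52, 25), (1, 2));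
      ((52, 27), (7, 13)); ((13, 8), (9, 13)); ((13, 10), (11, 13)); ((13, 12), (1, 1))]
  | 16 => [:: ((16, 1), (1, 8)); ((16, 3), (1, 4)); ((16, 5), (3, 8)); ((16, 7), (1, 2)); ((16,
      9), (5, 8)); ((16, 11), (3, 4)); ((16, 13), (7, 8)); ((16, 15), (1, 1))]
  | 18 => [:: ((18, 1), (1, 9)); ((36, 5), (1, 6)); ((36, 7), (2, 9)); ((18, 5), (1, 3)); ((18,
      7), (4, 9)); ((36, 17), (1, 2)); ((36, 19), (5, 9)); ((18, 11), (2, 3)); ((18, 13), (7,
      9)); ((36, 29), (5, 6)); ((36, 31), (8, 9)); ((18, 17), (1, 1))]
  | 25 => [:: ((25, 1), (2, 25)); ((100, 9), (1, 10)); ((100, 11), (3, 25)); ((25, 4), (1, 5));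
      ((25, 6), (7, 25)); ((25, 7), (8, 25)); ((25, 9), (2, 5)); ((25, 11), (12, 25)); ((100,
      49), (1, 2)); ((100, 51), (13, 25)); ((25, 14), (3, 5)); ((25, 16), (17, 25)); ((25, 18),
      (19, 25)); ((25, 19), (4, 5)); ((25, 21), (22, 25)); ((100, 89), (9, 10)); ((100, 91),
      (23, 25)); ((25, 24), (1, 1))]
  | _ => [::]
  end.

Lemma levels_ok M : M \in levels ->
  exponents_ok M (exponents M) && certificate M (exponents M) (derivation M) (covering M).
Proof.
have : all (fun M => exponents_ok M (exponents M) &&
  certificate M (exponents M) (derivation M) (covering M)) levels by vm_compute.
by move/allP/(_ M).
Qed.

Lemma hauptmodulE (R : realType) M : M \in levels ->
  @hauptmodul R M =1 etaq (exponents M).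
Proof.
move=> hM tau; rewrite /etaq /hauptmodul.
have -> : @Defs.eta R = dedekind by rewrite dedekind.unlock.
pose x k := dedekind (k%:R * tau).
rewrite -[X in _ = X]/(\prod_(p <- exponents M) x p.1 ^ p.2) -!/(x _).
move: x => x {tau}.
have N (n k : nat) : x n ^ (- k%:Z) = (x n ^+ k)^-1 by rewrite exprnN.
move: hM; rewrite !inE.
do ?[case/orP=> [/eqP->|]]; [..|move/eqP->].
all: rewrite /exponents !big_cons big_nil ![(_, _).1]/= ![(_, _).2]/=.
all: rewrite [LHS]/= !N -!exprnP ?invfM mulr1 ?mulrA //.
Qed.

(** * Invariance under the congruence subgroup *)

Section Invariance.
Variables (R : realType) (M : nat) (rs : seq (nat * int)).
Local Notation e := (@qexp R).
Local Notation H := (@upper_half_plane R).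
Local Notation eta := (@dedekind R).
Local Notation t := (@etaq R rs).
Hypothesis ok : exponents_ok M rs.

Lemma level_gt1 : (1 < M)%N. Proof. by case/and5P: ok. Qed.

Lemma exponents_pos : all (fun p => 0 < p.1)%N rs.
Proof. by case/and5P: ok => _ _ /allP h _ _; apply/allP => p /h/andP[]. Qed.

Lemma exponents_dvd p : p \in rs -> (p.1 %| M)%N.
Proof. by case/and5P: ok => _ _ /allP h _ _ /h/andP[]. Qed.

Lemma exponents_weight0 : weight0 rs.
Proof.
case/and5P: ok => _ /eqP h _ _ _; apply: etrans h; rewrite sumzE.
by apply: eq_bigr => p _; rewrite mulr1.
Qed.

Lemma exponents_order : \sum_(p <- rs) p.2 * p.1%:Z = -24.
Proof. by case/and5P: ok => _ _ _ /eqP<- _; rewrite sumzE. Qed.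

Lemma H_nat_mul (d : nat) tau : (0 < d)%N -> H tau -> H (d%:R * tau).
Proof.
move=> d0 t0; rewrite /upper_half_plane /= -(rmorph_nat (real_complex R)) Im_scale.
by rewrite mulr_gt0 ?ltr0n.
Qed.

Lemma etaq_neq0 tau : H tau -> t tau != 0.
Proof.
move=> t0; rewrite /etaq prodf_seq_neq0; apply/allP => p /(allP exponents_pos) p0 /=.
exact/expfz_neq0/eta_neq0/H_nat_mul.
Qed.

(** Every d divides M, hence the lower left entry, so the Hermite form of diag(d, 1) g has a = d: it
    is diag(d, 1) itself, and each eta factor returns. *)
Lemma etaq_multiplier g : det2 g = 1 -> (M %| m21 g)%Z ->
  exists C, forall tau, H tau -> t (act g tau) = C * t tau.
Proof.
move=> Dg Mg; have [hf [hhf [C _ hC]]] := etaq_act R Dg exponents_weight0 exponents_pos.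
exists C => tau t0; rewrite (hC _ t0); congr (_ * _); apply: eq_big_seq => p pr.
have p0 := allP exponents_pos _ pr; have [a0 ad bd aE] := hhf _ p0.
have {}aE : (hf p.1).1.1 = p.1.
  rewrite aE; apply/gcdn_idPl; apply: dvdn_trans (exponents_dvd pr) _.
  by move: Mg; rewrite dvdzE.
have d1 : (hf p.1).2 = 1%N.
  by apply/eqP; rewrite -(eqn_pmul2l p0) -{1}aE ad muln1.
by move: bd; rewrite d1 ltnS leqn0 => /eqP->; rewrite act_upper aE addr0 divr1.
Qed.

Definition fixing g := det2 g = 1 /\ forall tau, H tau -> t (act g tau) = t tau.

Lemma det1_gt0 g : det2 g = 1 -> 0 < det2 g. Proof. by move->. Qed.

Lemma fixingM g h : fixing g -> fixing h -> fixing (mul2 g h).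
Proof.
move=> [Dg fg] [Dh fh]; split; first by rewrite det2M Dg Dh.
move=> tau t0; have g0 := det1_gt0 Dg; have h0 := det1_gt0 Dh.
by rewrite (actM t0 g0 h0) (fg _ (H_act t0 h0)) (fh _ t0).
Qed.

Lemma fixing_adj g : fixing g -> fixing (adj2 g).
Proof.
move=> [Dg fg]; split; first by rewrite det2_adj.
move=> tau t0; have g0 := det1_gt0 Dg; have a0 : 0 < det2 (adj2 g) by rewrite det2_adj.
by rewrite -(fg _ (H_act t0 a0)) -(actM t0 g0 a0) (mul2_adj Dg) act1.
Qed.

(** The factors contribute e(n / 24) to the power -24, the sum of the d r_d. *)
Lemma fixing_T n : fixing (Mat2 1 n 0 1).
Proof.
split; first by rewrite /det2 /= mulr1 mulr0 subr0.
move=> tau t0; rewrite act_T /etaq.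
transitivity (\prod_(p <- rs) (e (n%:~R / 24) ^ (p.2 * p.1) * eta (p.1%:R * tau) ^ p.2)).
  apply: eq_bigr => p _; rewrite mulrDr (_ : p.1%:R * n%:~R = (p.1%:Z * n)%:~R :> R[i]); last by rewrite rmorphM.
  rewrite eta_addr_int expfzMl; congr (_ * _).
  rewrite (_ : _ / 24 = p.1%:R * (n%:~R / 24) :> R[i]); last by rewrite rmorphM /= mulrA.
  by rewrite e_natM -[_ ^+ p.1]/(_ ^ p.1%:Z) exprzAC exprz_exp.
rewrite big_split /=; set X := (X in X * _); suff -> : X = 1 by rewrite mul1r.
have -> : X = e (n%:~R / 24) ^ (\sum_(p <- rs) p.2 * p.1%:Z).
  rewrite /X; elim: (rs : seq _) => [|p s IH]; first by rewrite !big_nil.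
  by rewrite !big_cons IH expfzDr // e_neq0.
rewrite exponents_order (_ : (-24 : int) = - 24%:Z) // -exprnN -e_natM (_ : 24 * (n%:~R / 24) = n%:~R); last by field.
by rewrite e_int invr1.
Qed.

Lemma fixing_opp a b c d : fixing (Mat2 a b c d) -> fixing (Mat2 (- a) (- b) (- c) (- d)).
Proof.
move=> [Dg fg]; split; first by rewrite -Dg /det2 /= !mulrNN.
move=> tau t0; rewrite -[RHS](fg _ t0); congr (t _); rewrite /act /den /=.
by rewrite !rmorphN !mulNr -!opprD invrN mulrNN.
Qed.

Definition fixing_bottom c d := forall a b, a * d - b * c = 1 -> fixing (Mat2 a b c d).

(* Matrices with the same bottom row differ by a translation on the left. *)
Lemma fixing_bottomP a b c d : fixing (Mat2 a b c d) -> fixing_bottom c d.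
Proof.
move=> fg a' b' D'; have [Dg _] := fg.
have -> : Mat2 a' b' c d = mul2 (Mat2 1 (b' * a - a' * b) 0 1) (Mat2 a b c d).
  move: Dg; rewrite /det2 /mul2 /= => Dg; congr Mat2; rewrite ?mul0r ?mul1r ?add0r //.
    transitivity (a' * (a * d - b * c) + a * (1 - (a' * d - b' * c))); last by ring.
    by rewrite Dg D'; ring.
  transitivity (b' * (a * d - b * c) + b * (1 - (a' * d - b' * c))); last by ring.
  by rewrite Dg D'; ring.
exact: fixingM (fixing_T _) fg.
Qed.

Lemma fixing_bottom_shift c d k : fixing_bottom c (d + k * c) -> fixing_bottom c d.
Proof.
move=> fb a b D.
have -> : Mat2 a b c d = mul2 (Mat2 a (b + k * a) c (d + k * c)) (Mat2 1 (- k) 0 1).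
  by rewrite /mul2 /=; congr Mat2; ring.
by apply: fixingM (fixing_T _); apply: fb; rewrite -D; ring.
Qed.

Lemma fixing_bottom_mod c d d' : fixing_bottom c d' -> (c %| d - d')%Z -> fixing_bottom c d.
Proof.
move=> fb /dvdzP[k E]; apply: (@fixing_bottom_shift _ _ (- k)).
by rewrite mulNr -E opprB addrC subrK.
Qed.

Lemma fixing_bottom_opp c d : fixing_bottom (- c) (- d) -> fixing_bottom c d.
Proof.
move=> fb a b D; rewrite -[a]opprK -[b]opprK -[c]opprK -[d]opprK.
by apply/fixing_opp/fb; rewrite -D; ring.
Qed.

(** The row in the premise belongs to the product with the inverse of the fixing matrix. *)
Lemma fixing_bottomM c d a1 b1 c1 d1 : fixing (Mat2 a1 b1 c1 d1) ->
  fixing_bottom (c * d1 - d * c1) (d * a1 - c * b1) -> fixing_bottom c d.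
Proof.
move=> f1 fb a b D; have [D1 _] := f1.
have E : mul2 (Mat2 a b c d) (adj2 (Mat2 a1 b1 c1 d1)) =
    Mat2 (a * d1 - b * c1) (b * a1 - a * b1) (c * d1 - d * c1) (d * a1 - c * b1).
  by rewrite /mul2 /=; congr Mat2; ring.
rewrite -(mul2_1r (Mat2 a b c d)) -(mul2_adjl D1) mul2A E.
apply: fixingM f1; apply: fb; transitivity ((a * d - b * c) * det2 (Mat2 a1 b1 c1 d1)); last by rewrite D D1.
by rewrite /det2 /=; ring.
Qed.

(* The multiplier is read off at the fixed point, where t does not vanish. *)
Lemma fixing_elliptic c d : 0 < c -> (M %| c)%Z -> elliptic_row c d -> fixing_bottom c d.
Proof.
move=> c0 Mc /hasP[tr htr /dvdzP[b Eb]]; pose a := tr - d.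
have tr2 : (tr ^+ 2 <= 1)%R by move: htr; rewrite !inE => /or3P[]/eqP->.
have D : a * d - b * c = 1 by rewrite /a -Eb; ring.
apply: (@fixing_bottomP a b); split; first by rewrite -D /det2 /=.
have [C hC] := etaq_multiplier (g := Mat2 a b c d) D Mc.
(* The fixed point in the upper half plane is (a - d + i sqrt(4 - tr^2)) / 2c; the radicand is
   positive as |tr| <= 1. *)
pose y : R := Num.sqrt (4 - tr%:~R ^+ 2).
have y2 : y ^+ 2 = 4 - tr%:~R ^+ 2.
  rewrite sqr_sqrtr // subr_ge0 -(rmorphXn (intmul (1 : R))) /= (_ : 4 = (4%:Z)%:~R) // ler_int.
  exact: le_trans tr2 _.
have y0 : 0 < y.
  rewrite sqrtr_gt0 subr_gt0 -(rmorphXn (intmul (1 : R))) /= (_ : 4 = (4%:Z)%:~R) // ltr_int.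
  exact: le_lt_trans tr2 _.
have cR : (0 < c%:~R :> R) by rewrite ltr0z.
pose x0 : R[i] := ((a - d)%:~R / (2 * c%:~R) +i* (y / (2 * c%:~R))).
have Hx : H x0 by rewrite /upper_half_plane /= divr_gt0 // mulr_gt0.
have n0 := den_neq0 (g := Mat2 a b c d) Hx (det1_gt0 (g := Mat2 a b c d) D).
have fx : act (Mat2 a b c d) x0 = x0.
  apply: (mulIf n0); rewrite /act divfK // /den /= !intr_C.
  have Eb' : (c%:~R * b%:~R : R) = (tr%:~R - d%:~R) * d%:~R - 1.
    have := congr1 (intmul (1 : R)) Eb; rewrite rmorphB !rmorphM rmorphB /= => ->; exact: mulrC.
  have c1 : c%:~R != 0 :> R by rewrite gt_eqF.
  have bE : b%:~R = ((tr%:~R - d%:~R) * d%:~R - 1) / c%:~R :> R by rewrite -Eb' mulrC mulKf.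
  apply/eqP; rewrite eq_complex /= /a !rmorphB /= bE; apply/andP; split; apply/eqP.
    rewrite !mul0r !addr0 !subr0.
    have E2 : y / (2 * c%:~R) * (c%:~R * (y / (2 * c%:~R))) = (4 - tr%:~R ^+ 2) / (4 * c%:~R).
      by rewrite -y2; field.
    by rewrite E2; field.
  by field.
have : C = 1 by apply: (mulIf (etaq_neq0 Hx)); rewrite -hC // fx mul1r.
by move=> C1 tau t0; rewrite hC // C1 mul1r.
Qed.

(** Under tau -> tau + w the argument (a tau + b) / d' of the factor for d moves by w a / d' = w
    gcd(d, s)^2 / d, an integer by assumption; the whole quotient gains e(1/24) to a power divisible
    by 24. *)
Lemma etaq_cusp_width g w : det2 g = 1 -> let s := `|m21 g|%N in
  all (fun p => p.1 %| w * gcdn p.1 s ^ 2)%N rs ->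
  (24 %| sumz (fun d => (w * gcdn d s ^ 2 %/ d)%N) rs)%Z ->
  forall tau, H tau -> t (act g (tau + w%:R)) = t (act g tau).
Proof.
move=> Dg s dvd /dvdzP[k sum24] tau t0.
have t1 : H (tau + w%:R) by have := H_addr_int w t0; rewrite -pmulrn.
have [hf [hhf [C _ hC]]] := etaq_act R Dg exponents_weight0 exponents_pos.
rewrite (hC _ t1) (hC _ t0); congr (_ * _); rewrite /etaq_at.
transitivity (\prod_(p <- rs) (e 24^-1 ^ (p.2 * (w * gcdn p.1 s ^ 2 %/ p.1)%N) *
    eta (act (upper (hf p.1).1.1 (hf p.1).1.2 (hf p.1).2) tau) ^ p.2)).
  apply: eq_big_seq => p pr; have p0 := allP exponents_pos _ pr; have [a0 ad bd aE] := hhf _ p0.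
  have /dvdnP[n En] := allP dvd _ pr; rewrite En mulnK //; rewrite -aE in En.
  set a := (hf p.1).1.1 in a0 ad En *; set b := (hf p.1).1.2 in bd *; set d := (hf p.1).2 in ad bd *.
  have wE : (w * a = n * d)%N.
    by apply/eqP; rewrite -(eqn_pmul2r a0) -mulnA mulnn En -ad mulnAC mulnA.
  have d0 : d%:R != 0 :> R[i] by rewrite pnatr_eq0 -lt0n (leq_ltn_trans _ bd).
  have -> : act (upper a b d) (tau + w%:R) = act (upper a b d) tau + (n%:Z)%:~R.
    rewrite !act_upper -pmulrn mulrDr -natrM mulnC wE natrM addrAC mulrDl mulfK //.
  rewrite eta_addr_int expfzMl; congr (_ * _).
  rewrite -pmulrn e_natM -[_ ^+ n]/(_ ^ n%:Z) exprz_exp mulrC //.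
rewrite big_split /=; set X := (X in X * _); suff -> : X = 1 by rewrite mul1r.
have -> : X = e 24^-1 ^ sumz (fun d => (w * gcdn d s ^ 2 %/ d)%N) rs.
  rewrite sumzE /X; elim: (rs : seq _) => [|p l IH]; first by rewrite !big_nil.
  by rewrite !big_cons IH expfzDr // e_neq0.
rewrite sum24 mulrC -exprz_exp -[e _ ^ 24]/(e _ ^+ 24) -e_natM mulfV ?pnatr_eq0 //.
by rewrite e1 exp1rz.
Qed.

(** The matrix is g T^w g^-1, where the first column (p, s) of g is completed by Bezout; t after g
    has period w. *)
Lemma fixing_parabolic (p : int) (s w : nat) : coprimez p s ->
  all (fun p => p.1 %| w * gcdn p.1 s ^ 2)%N rs ->
  (24 %| sumz (fun d => (w * gcdn d s ^ 2 %/ d)%N) rs)%Z ->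
  fixing (Mat2 (1 - w%:Z * p * s) (w%:Z * p ^+ 2) (- (w%:Z * s ^+ 2)) (1 + w%:Z * p * s)).
Proof.
move=> /coprimezP[[u v] /= uv] dvd sum24; pose g := Mat2 p (- v) s u.
have Dg : det2 g = 1 by rewrite -uv /det2 /=; ring.
have E : Mat2 (1 - w%:Z * p * s) (w%:Z * p ^+ 2) (- (w%:Z * s ^+ 2)) (1 + w%:Z * p * s) =
    mul2 (mul2 g (Mat2 1 w 0 1)) (adj2 g).
  have uvE : v * s = 1 - u * p by rewrite -uv; ring.
  rewrite /mul2 /=; congr Mat2; try (by ring).
    transitivity (u * p + v * s - w%:Z * p * s); [by rewrite uv|by ring].
  by transitivity (u * p + v * s + w%:Z * p * s); [rewrite uv|ring].
have D1 : det2 (Mat2 1 w 0 1) = 1 by rewrite /det2 /= mulr1 mulr0 subr0.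
split; first by rewrite E !det2M det2_adj Dg D1.
have a0 : 0 < det2 (adj2 g) by rewrite det2_adj Dg.
have g0 := det1_gt0 Dg; have T0 := det1_gt0 D1.
have gT0 : 0 < det2 (mul2 g (Mat2 1 w 0 1)) by rewrite det2M Dg D1.
move=> tau t0; have s0 := H_act t0 a0; rewrite E (actM t0 gT0 a0) (actM s0 g0 T0) act_T -pmulrn.
by rewrite (etaq_cusp_width Dg dvd sum24 s0) -(actM t0 g0 a0) (mul2_adj Dg) act1.
Qed.

Lemma fixing_parabolic_row c d : 0 < c -> parabolic_row M rs c d -> fixing_bottom c d.
Proof.
move=> c0 /hasP[s _ /andP[/dvdnP[w cE]] /=].
have [s0|s0] := posnP s; first by move: cE; rewrite s0 exp0n // muln0; lia.
rewrite cE mulnK ?expn_gt0 ?s0 // => /and3P[dvd sum24 /hasP[p _ /andP[cop]]].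
have {}cE : c = w%:Z * s%:Z ^+ 2 by rewrite -[c]gez0_abs ?ltW // cE PoszM.
(* To make the lower left entry positive, take the negative of the parabolic matrix, or the inverse
   of the one for -p. *)
case/orP=> [h|h].
  apply: (@fixing_bottom_mod c d (- (1 + w%:Z * p%:Z * s))); last first.
    by rewrite opprK (_ : w%:Z * p%:Z * s = p%:Z * s%:Z * w%:Z) //; ring.
  apply: fixing_bottom_opp; rewrite opprK cE.
  exact: fixing_bottomP (fixing_parabolic (p := p) cop dvd sum24).
apply: (@fixing_bottom_mod c d (1 + w%:Z * p%:Z * s)); last first.
  by rewrite (_ : w%:Z * p%:Z * s = p%:Z * s%:Z * w%:Z) //; ring.
have cop' : coprimez (- p%:Z) s by rewrite /coprimez /gcdz abszN.
have := fixing_adj (fixing_parabolic cop' dvd sum24).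
rewrite /adj2 /= opprK -cE => /fixing_bottomP.
by rewrite mulrN mulNr opprK.
Qed.

Lemma fixing_known D c d : {in D, forall q, fixing_bottom q.1 q.2} ->
  known_row M rs D c d -> fixing_bottom c d.
Proof.
move=> hD /orP[/and3P[c0 Mc /orP[]]|]; first exact: fixing_elliptic.
  exact: fixing_parabolic_row.
move=> /hasP[q qD /andP[/eqP<- h]]; exact: fixing_bottom_mod (hD _ qD) h.
Qed.

Lemma derivation_sound D l : {in D, forall q, fixing_bottom q.1 q.2} -> derivation_ok M rs D l ->
  {in [seq q.1 | q <- l], forall q, fixing_bottom q.1 q.2}.
Proof.
elim: l D => [|[[c d] [[[a1 b1] c1] d1]] l IH] D hD //= /and5P[c0 Mc /eqP D1 k1 /andP[k2 ok']].
have hc : fixing_bottom c d.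
  apply: (fixing_bottomM (fixing_known hD k1 D1)).
  case/orP: k2 => /andP[_ /(fixing_known hD)] //; exact: fixing_bottom_opp.
have hD' : {in (c, d) :: D, forall q, fixing_bottom q.1 q.2}.
  by move=> q; rewrite inE => /orP[/eqP->|/hD].
move=> q; rewrite inE => /orP[/eqP->|] //; exact: IH hD' ok' q.
Qed.

(* If d / c lies in the open interval around d0 / c0, then multiplying on the right by the
   inverse of a matrix with bottom row (c0, d0) decreases the lower left entry. *)
Lemma covering_sound D r s l c d : {in D, forall q, fixing_bottom q.1 q.2} -> covering_ok M rs D r s l ->
  0 < s -> 0 < c -> (M %| c)%Z -> coprimez c d -> r * c < d * s -> d <= c ->
  fixing_bottom c d \/ exists c0, exists d0, [/\ fixing_bottom c0 d0, coprimez c0 d0, (M %| c0)%Z &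
    `|c * d0 - d * c0| < c].
Proof.
move=> hD + + c0 Mc cop + dc; elim: l r s => [|[[c1 d1] [r' s']] l IH] r s /=.
  by move=> /andP[/eqP-> /eqP->] _; lia.
move=> /and5P[/andP[Mc1 c10] cop1 k1 lo /and5P[hi s'0 cop' bp ok']] s0 rd.
have [lt|gt|eq] := ltgtP (d * s') (r' * c).
- right; exists c1, d1; split=> //; first exact: fixing_known k1.
  rewrite ltr_norml; apply/andP; split.
    rewrite -(ltr_pM2r s'0); nia.
  rewrite -(ltr_pM2r s0); nia.
- exact: IH ok' s'0 gt.
(* At a breakpoint both fractions are reduced, so (c, d) is the breakpoint itself; as M divides c,
   it is a known row. *)
left; have [E1 E2] : c = s' /\ d = r'.
  have h1 : (c %| s')%Z by rewrite -(Gauss_dvdzr _ cop) eq dvdz_mull.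
  have h2 : (s' %| c)%Z by rewrite -(Gauss_dvdzr _ (_ : coprimez s' r')) ?(coprimez_sym s') // -eq dvdz_mull.
  have E : c = s' by apply/eqP; rewrite -(gtz0_abs c0) -(gtz0_abs s'0) eqz_nat eqn_dvd -!dvdzE h1 h2.
  split=> //; rewrite E in eq; apply: (mulIf (lt0r_neq0 s'0)); exact: eq.
by move: bp; rewrite -E1 -E2 Mc => /(fixing_known hD).
Qed.

Lemma etaq_invariant l k g : certificate M rs l k -> det2 g = 1 -> (M %| m21 g)%Z ->
  forall tau, H tau -> t (act g tau) = t tau.
Proof.
move=> /andP[okl okk] Dg Mg; suff [] : fixing g by [].
have hD : {in rev [seq q.1 | q <- l], forall q, fixing_bottom q.1 q.2}.
  by move=> q; rewrite mem_rev; apply: (derivation_sound (D := [::])) okl q.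
case: g Dg Mg => a b c d; rewrite /det2 /= => Dg Mg.
have [n] := ubnP `|c|%N; elim: n a b c d Dg Mg => // n IHn.
have pos a b c d : a * d - b * c = 1 -> (M %| c)%Z -> 0 < c -> (`|c| <= n)%N -> fixing (Mat2 a b c d).
  move=> Dg Mc c0 cn; pose k0 := (d %/ c)%Z; pose d' := (d %% c)%Z; pose b' := b - k0 * a.
  have dE : d = k0 * c + d' by rewrite /k0 /d' -divz_eq.
  suff fb : fixing_bottom c d'.
    by apply: (fixing_bottom_mod fb) => //; rewrite dE addrK dvdz_mull.
  have D' : a * d' - b' * c = 1 by rewrite -Dg dE /b'; ring.
  have cop : coprimez c d'.
    by apply/coprimezP; exists (- b', a); rewrite /= -D'; ring.
  have d'0 : 0 <= d' by rewrite modz_ge0 // gt_eqF.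
  have d'c : d' < c by rewrite ltz_pmod.
  (* d' = 0 would force |c| = 1 by coprimality, against M > 1. The covering starts strictly to the
     right of 0. *)
  have d'1 : 0 < d'.
    rewrite lt_neqAle d'0 andbT; apply/eqP => E; move: cop; rewrite -E /coprimez gcdz0 => /eqP c1.
    have {}c1 : `|c|%N = 1%N by move: c1; lia.
    by move: Mc level_gt1; rewrite dvdzE c1 dvdn1 /= => /eqP->.
  have [] := covering_sound hD okk (ltr01) c0 Mc cop _ (ltW d'c); first by rewrite mul0r mulr1.
    by [].
  case=> c1 [d1 [fb1 cop1 Mc1 lt]].
  have [[u v] /= uv] := coprimezP _ _ cop1.
  have f1 : fixing (Mat2 v (- u) c1 d1) by apply: fb1; rewrite -uv; ring.
  apply: (fixing_bottomM f1) => a2 b2 D2; apply: IHn => //.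
    by apply: rpredB; [apply: dvdz_mulr|apply: dvdz_mull].
  by apply: leq_trans cn; rewrite -ltz_nat !abszE [`|c|]gtr0_norm.
move=> a b c d Dg Mc; rewrite ltnS => cn; have [c0|c0|c0] := ltgtP c 0.
- rewrite -[a]opprK -[b]opprK -[c]opprK -[d]opprK; apply/fixing_opp/pos; rewrite ?rpredN ?oppr_gt0 ?abszN //.
  by rewrite -Dg; ring.
- exact: pos.
rewrite c0 mulr0 subr0 in Dg.
have /eqP := congr1 absz Dg; rewrite abszM muln_eq1 => /andP[_ /eqP d1].
have /orP[/eqP dE|/eqP dE] : (d == 1) || (d == -1) by lia.
  have aE : a = 1 by rewrite dE mulr1 in Dg.
  by rewrite c0 aE dE; apply: fixing_T.
have aE : a = - 1 by rewrite dE mulrN1 in Dg; rewrite -Dg opprK.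
by have := fixing_opp (fixing_T (- b)); rewrite c0 aE dE opprK oppr0.
Qed.

End Invariance.

(** * Expansions at the cusps *)

Section Cusps.
Variables (R : realType) (M : nat) (rs : seq (nat * int)).
Local Notation e := (@qexp R).
Local Notation H := (@upper_half_plane R).
Local Notation eta := (@dedekind R).
Local Notation HolC := (Hol (idfun : {rmorphism R[i] -> R[i]})).
Local Notation t := (@etaq R rs).
Hypothesis ok : exponents_ok M rs.

Lemma e_exprz (n : int) (z : R[i]) : e z ^ n = e (n%:~R * z).
Proof.
case: n => n; first by rewrite -pmulrn e_natM.
by rewrite NegzE -exprnN rmorphN /= -pmulrn mulNr eN e_natM.
Qed.

(** The fractional powers of q in the eta factors multiply to q^-1, since the sum of the d r_d is
    -24. *)
Lemma etaq_euler tau : H tau -> e tau * t tau = \prod_(p <- rs) euler (p.1%:R * tau) ^ p.2.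
Proof.
move=> t0; have -> : t tau = \prod_(p <- rs) (e (tau / 24) ^ (p.2 * p.1%:Z) * euler (p.1%:R * tau) ^ p.2).
  apply: eq_bigr => p _; rewrite etaE expfzMl; congr (_ * _).
  by rewrite !e_exprz rmorphM /=; congr (e _); rewrite -!mulrA.
rewrite big_split /= mulrA; set X := \prod_(p <- rs) e _ ^ _.
have -> : X = e (tau / 24) ^ (\sum_(p <- rs) p.2 * p.1%:Z).
  rewrite /X; elim: (rs : seq _) => [|p l IH]; first by rewrite !big_nil.
  by rewrite !big_cons IH expfzDr // e_neq0.
rewrite (exponents_order ok) e_exprz -e_add (_ : tau + _ = 0) ?e0 ?mul1r //.
by rewrite (_ : (-24 : int) = - 24%:Z) // rmorphN /=; field.
Qed.

Lemma Hol_euler_mul (A : comNzRingType) (f : {rmorphism A -> R[i]}) (d : nat) (k : int) : (0 < d)%N ->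
  Hol f 1 (fun tau => euler (d%:R * tau) ^ k).
Proof.
move=> d0 y eps y0 eps0; have dR : 0 < d%:R :> R by rewrite ltr0n.
have [p hp] := Hol_euler_int f k (mulr_gt0 dR y0) eps0.
exists (p \Po 'X^d) => tau yt; rewrite map_comp_poly map_polyXn horner_comp hornerXn divr1 -e_natM.
have := hp (d%:R * tau); rewrite divr1; apply.
by rewrite -(rmorph_nat (real_complex R)) Im_scale ler_pM2l.
Qed.

Lemma Hol_etaq : Hol (intr : {rmorphism int -> R[i]}) 1 (fun tau => e tau * t tau).
Proof.
apply: Hol_ext (fun tau t0 => esym (etaq_euler t0)) _.
have h : {in rs, forall p, Hol (intr : {rmorphism int -> R[i]}) 1 (fun tau => euler (p.1%:R * tau) ^ p.2)}.
  by move=> p /(allP (exponents_pos ok)) p0; apply: Hol_euler_mul.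
elim: (rs : seq _) h => [|p l IH] h; first by apply: Hol_ext (Hol1 _ _) => tau _; rewrite big_nil.
apply: Hol_ext (HolM (h p (mem_head _ _)) (IH _)) => [tau _|q ql]; first by rewrite big_cons.
by apply: h; rewrite in_cons ql orbT.
Qed.

Lemma tends_inftyM (f g : R[i] -> R[i]) a b : tends_infty f a -> tends_infty g b ->
  tends_infty (fun tau => f tau * g tau) (a * b).
Proof.
move=> hf hg eps eps0; pose B := modulus b + 1; pose A := modulus a + 1.
have A0 : 1 <= A by rewrite lerDr modulus_ge0.
have B0 : 1 <= B by rewrite lerDr modulus_ge0.
pose d := Num.min 1 (eps / (A + B)).
have d0 : 0 < d by rewrite lt_min ltr01 divr_gt0 //; lra.
have [Y hY] := hf _ d0; have [Z hZ] := hg _ d0.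
exists (Num.max Y Z) => tau; rewrite ge_max => /andP[/hY u /hZ v].
have -> : f tau * g tau - a * b = (f tau - a) * (g tau - b) + (f tau - a) * b + a * (g tau - b) by ring.
apply: le_trans (modulusD _ _) _; apply: le_trans (lerD (modulusD _ _) (lexx _)) _; rewrite !modulusM.
have d1 : d <= 1 by rewrite ge_min lexx.
have d2 : d * (A + B) <= eps by rewrite -ler_pdivlMr ?ge_min ?lexx ?orbT //; lra.
have := modulus_ge0 (f tau - a); have := modulus_ge0 (g tau - b).
have := modulus_ge0 a; have := modulus_ge0 b; move: u v d2; rewrite /A /B; nra.
Qed.

Lemma tends_infty_cst (c : R[i]) : tends_infty (fun=> c) c.
Proof. by move=> eps eps0; exists 0 => tau _; rewrite subrr modulus0 ltW. Qed.

Lemma tends_infty_exprz (f : R[i] -> R[i]) (k : int) : tends_infty f 1 -> tends_infty (fun tau => f tau ^ k) 1.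
Proof.
move=> hf.
have hX n : tends_infty (fun tau => f tau ^+ n) 1.
  elim: n => [|n IH]; first exact: tends_infty_cst.
  by have := tends_inftyM hf IH; rewrite mulr1; under [in X in X -> _]eq_fun do rewrite -exprS.
case: k => n; first exact: hX.
move=> eps eps0; pose d := Num.min (1 / 2) (eps / 2).
have d0 : 0 < d by rewrite lt_min; apply/andP; split; lra.
have [Y hY] := hX n.+1 _ d0; exists Y => tau /hY; rewrite NegzE -exprnN; set x := f tau ^+ n.+1 => hx.
have d1 : d <= 1 / 2 by rewrite ge_min lexx.
have d2 : d <= eps / 2 by rewrite ge_min lexx orbT.
have x2 : 1 / 2 <= modulus x.
  by have := modulus_dist 1 x; rewrite modulus1 modulusC; lra.
have x0 : x != 0 by rewrite -modulus_gt0; lra.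
have -> : x^-1 - 1 = (1 - x) * x^-1 by field.
rewrite modulusM modulusV modulusC ler_pdivrMr; last by lra.
by nra.
Qed.

Lemma tends_infty_etaq : tends_infty (fun tau => e tau * t tau) 1.
Proof.
have h : tends_infty (fun tau : R[i] => \prod_(p <- rs) euler (p.1%:R * tau) ^ p.2) 1.
  have : {in rs, forall p, tends_infty (fun tau : R[i] => euler (p.1%:R * tau) ^ p.2) 1}.
    move=> p pr; have p0 := allP (exponents_pos ok) _ pr; apply: tends_infty_exprz => eps eps0.
    have [Y hY] := @tends_infty_euler R _ eps0; exists `|Y| => tau yt; apply: hY.
    rewrite -(rmorph_nat (real_complex R)) Im_scale.
    have p1 : 1 <= p.1%:R :> R by rewrite ler1n.
    by apply: le_trans (ler_norm _) _; have := normr_ge0 Y; nra.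
  elim: (rs : seq _) => [|p l IH] h eps eps0; first by exists 0 => tau _; rewrite big_nil subrr modulus0 ltW.
  have hl : {in l, forall p, tends_infty (fun tau : R[i] => euler (p.1%:R * tau) ^ p.2) 1}.
    by move=> q ql; apply: h; rewrite in_cons ql orbT.
  have [Y hY] := tends_inftyM (h p (mem_head _ _)) (IH hl) eps0.
  by exists Y => tau /hY; rewrite big_cons mul1r.
move=> eps eps0; have [Y hY] := h _ eps0; exists (Num.max Y 1) => tau; rewrite ge_max => /andP[Yt t1].
by rewrite etaq_euler ?hY //; apply: lt_le_trans t1.
Qed.

(** The factor for d has argument (a tau + b) / d' with a d' = d, so it adds r_d gcd(d, c)^2 M / d
    to the exponent k of e(tau / 24M). The sum k is nonnegative by [exponents_ok], which tests the
    residue of c modulo M. *)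
Lemma Hol_etaq_cusp g : det2 g = 1 -> ~~ (M %| m21 g)%Z -> HolC (24 * M) (fun tau => t (act g tau)).
Proof.
move=> Dg Mg; have [hf [hhf [C _ hC]]] := etaq_act R Dg (exponents_weight0 ok) (exponents_pos ok).
have M0 : (0 < M)%N := ltnW (level_gt1 ok).
pose c := `|m21 g|%N; pose k := sumz (fun d => (gcdn d c ^ 2 * (M %/ d))%N) rs.
have k0 : 0 <= k.
  have : (M %| c %% M)%N || (0 <= sumz (fun d => (gcdn d (c %% M) ^ 2 * (M %/ d))%N) rs).
    by case/and5P: ok => _ _ _ _ /allP; apply; rewrite mem_iota add0n ltn_mod.
  rewrite /dvdn modn_mod -/(dvdn M c) (negPf (_ : ~~ (M %| c)%N)) //=; congr (0 <= _).
  rewrite /k !sumzE; apply: eq_big_seq => p /(exponents_dvd ok) pM.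
  suff -> : gcdn p.1 (c %% M) = gcdn p.1 c by [].
  by rewrite -gcdn_modr modn_dvdm // gcdn_modr.
have W0 : (0 < 24 * M)%N by rewrite muln_gt0.
have h1 p : p \in rs -> HolC (24 * M) (fun tau => euler (act (upper (hf p.1).1.1 (hf p.1).1.2 (hf p.1).2) tau) ^ p.2).
  move=> pr; have p0 := allP (exponents_pos ok) _ pr; have [a0 ad bd _] := hhf _ p0.
  have d0 : (0 < (hf p.1).2)%N by apply: leq_ltn_trans bd.
  have dM : ((hf p.1).2 %| 24 * M)%N.
    by apply: dvdn_mull; apply: dvdn_trans (exponents_dvd ok pr); rewrite -[X in (_ %| X)%N]ad dvdn_mull.
  have := Hol_affine (b := (hf p.1).1.2%:R) (ltn0Sn 0) a0 d0 _ (Hol_euler_int (idfun : {rmorphism R[i] -> R[i]}) p.2).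
  rewrite -(rmorph_nat (real_complex R)) => /(_ erefl); rewrite mul1n => h.
  have E : (24 * M = (hf p.1).2 * (24 * M %/ (hf p.1).2))%N by rewrite [RHS]mulnC divnK.
  rewrite [X in HolC X]E; apply: Hol_widen; [exact: d0|by rewrite divn_gt0 // dvdn_leq|].
  by apply: Hol_ext h => tau _; rewrite act_upper rmorph_nat.
have hprod : HolC (24 * M) (fun tau => \prod_(p <- rs) euler (act (upper (hf p.1).1.1 (hf p.1).1.2 (hf p.1).2) tau) ^ p.2).
  elim: (rs : seq _) h1 => [|p l IH] h; first by apply: Hol_ext (Hol1 _ _) => tau _; rewrite big_nil.
  apply: Hol_ext (HolM (h p (mem_head _ _)) (IH _)) => [tau _|q ql]; first by rewrite big_cons.
  by apply: h; rewrite in_cons ql orbT.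
pose B := \prod_(p <- rs) e ((hf p.1).1.2%:R / (hf p.1).2%:R / 24) ^ p.2.
have main tau : H tau -> t (act g tau) = C * B * e (tau / (24 * M)%:R) ^+ `|k|%N *
    \prod_(p <- rs) euler (act (upper (hf p.1).1.1 (hf p.1).1.2 (hf p.1).2) tau) ^ p.2.
  move=> t0; rewrite (hC _ t0) -!mulrA; congr (_ * _).
  have -> : e (tau / (24 * M)%:R) ^+ `|k|%N = e (tau / (24 * M)%:R) ^ k.
    by rewrite -[in RHS](gez0_abs k0).
  have -> : e (tau / (24 * M)%:R) ^ k = \prod_(p <- rs) e (tau / (24 * M)%:R) ^ (p.2 * (gcdn p.1 c ^ 2 * (M %/ p.1))%N).
    rewrite /k sumzE; elim: (rs : seq _) => [|p l IH]; first by rewrite !big_nil.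
    by rewrite !big_cons expfzDr ?IH // e_neq0.
  rewrite /B -!big_split /=; apply: eq_big_seq => p pr.
  have p0 := allP (exponents_pos ok) _ pr; have [a0 ad bd aE] := hhf _ p0.
  have d0 : (0 < (hf p.1).2)%N by apply: leq_ltn_trans bd.
  have pM := exponents_dvd ok pr.
  rewrite etaE expfzMl mulrA; congr (_ * _); rewrite -/c in aE; rewrite -aE.
  rewrite !e_exprz -e_add; congr (e _); rewrite rmorphM /= -[p.2%:~R * _ * _]mulrA -mulrDr; congr (_ * _).
  rewrite act_upper -pmulrn.
  have nz (n : nat) : (0 < n)%N -> n%:R != 0 :> R[i] by move=> n0; rewrite pnatr_eq0 -lt0n.
  have n1 := nz _ a0; have n2 := nz _ d0; have n3 := nz _ M0.
  have E : (M %/ p.1)%:R = M%:R / ((hf p.1).1.1%:R * (hf p.1).2%:R) :> R[i].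
    by rewrite -natrM ad -[in RHS](divnK pM) natrM mulfK // nz.
  rewrite -?pmulrn !natrM ?natrX E; move: n1 n2 n3.
  move: ((hf p.1).1.1%:R : R[i]) ((hf p.1).2%:R : R[i]) (M%:R : R[i]) ((hf p.1).1.2%:R : R[i]) => x1 x2 x3 x4 n1 n2 n3.
  by field; rewrite n1 n2 n3.
apply: Hol_ext (fun tau t0 => esym (main tau t0)) _.
exact: HolM (HolM (Hol_cst (idfun : {rmorphism R[i] -> R[i]}) _ (C * B)) (HolX _ (Hol_e _ _))) hprod.
Qed.

End Cusps.

(** * Hermite normal forms *)

Definition triple := (nat * nat * nat)%type.
Implicit Types (x y : triple).

Definition up x := upper x.1.1 x.1.2 x.2.
Definition content x := gcdn (gcdn x.1.1 x.1.2) x.2.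

Definition factorisations (N : nat) : seq (nat * nat) :=
  [seq p <- [seq (a, d) | a <- index_iota 1 N.+1, d <- index_iota 1 N.+1] | p.1 * p.2 == N]%N.

Definition triples (N : nat) : seq triple :=
  [seq (p.1, b, p.2) | p <- factorisations N, b <- index_iota 0 p.2].

Lemma mem_factorisations N a d : (0 < N)%N -> ((a, d) \in factorisations N) = (a * d == N)%N.
Proof.
move=> N0; rewrite mem_filter /=; apply/andb_idr => /eqP E.
apply/allpairsP; exists (a, d); rewrite !mem_index_iota !ltnS /=.
have /andP[a0 d0] : (0 < a)%N && (0 < d)%N by rewrite -muln_gt0 E.
by rewrite a0 d0 -E leq_pmulr // leq_pmull.
Qed.

Lemma factorisations_uniq N : uniq (factorisations N).
Proof. by apply/filter_uniq/allpairs_uniq; rewrite ?iota_uniq // => -[? ?] [? ?]. Qed.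

Lemma mem_triples N a b d : (0 < N)%N -> ((a, b, d) \in triples N) = (a * d == N)%N && (b < d)%N.
Proof.
move=> N0; apply/allpairsPdep/andP.
  by move=> [[a' d'] [b' [+ + [-> -> ->]]]]; rewrite mem_factorisations // mem_index_iota.
by move=> [ad bd]; exists (a, d), b; rewrite mem_factorisations // mem_index_iota.
Qed.

Lemma triples_uniq N : uniq (triples N).
Proof.
apply: allpairs_uniq_dep; [exact: factorisations_uniq|by move=> *; apply: iota_uniq|].
by move=> [[a d] b] [[a' d'] b'] _ _ /= [-> -> ->].
Qed.

Lemma size_triples N : size (triples N) = \sum_(p <- factorisations N) p.2.
Proof.
rewrite size_allpairs_dep sumnE big_map; apply: eq_bigr => p _.
by rewrite size_iota subn0.
Qed.

Lemma sum_factorisations N : (\sum_(p <- factorisations N) p.1 = \sum_(p <- factorisations N) p.2)%N.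
Proof.
rewrite !big_filter [LHS]big_mkcond [RHS]big_mkcond !big_allpairs exchange_big /=.
by apply: eq_bigr => a _; apply: eq_bigr => d _; rewrite mulnC.
Qed.

Lemma det_up x : det2 (up x) = (x.1.1 * x.2)%N.
Proof. exact: det_upper. Qed.

Lemma triple_gt0 N x : (0 < N)%N -> x \in triples N -> (0 < x.1.1)%N /\ (0 < x.2)%N.
Proof.
move=> N0; case: x => [[a b] d]; rewrite mem_triples // => /andP[/eqP ad _] /=.
by apply/andP; rewrite -muln_gt0 ad.
Qed.

(** k is upper triangular, positivity makes its diagonal 1, and the bounds b < d and b' < d' leave
    no translation. *)
Lemma hermite_uniq N x y k : (0 < N)%N -> x \in triples N -> y \in triples N -> det2 k = 1 ->
  mul2 k (up x) = up y -> x = y.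
Proof.
move=> N0; case: x y k => [[a b] d] [[a' b'] d'] [k1 k2 k3 k4].
move=> hx hy; have [a0 d0] := triple_gt0 N0 hx; have [a'0 d'0] := triple_gt0 N0 hy.
move: hx hy; rewrite !mem_triples // => /andP[_ bd] /andP[_ b'd']; rewrite /det2 /mul2 /up /upper /= in a0 d0 a'0 d'0 *.
move=> D [E1 E2 E3 E4]; have k30 : k3 = 0.
  by apply/eqP; move: E3; rewrite mulr0 addr0 => /eqP; rewrite mulf_eq0 eqz_nat (gtn_eqF a0) orbF.
move: D E1 E2 E4; rewrite k30 !mulr0 subr0 !addr0 mul0r add0r => D E1 E2 E4.
have k11 : k1 = 1.
  have k1p : 0 < k1 by rewrite -(pmulr_lgt0 _ (_ : 0 < a%:Z)) ?ltz_nat // E1 ltz_nat.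
  have /eqP := congr1 absz D; rewrite abszM muln_eq1 => /andP[/eqP k1a _].
  by rewrite -[k1]gez0_abs ?k1a // ltW.
rewrite k11 !mul1r in D E1 E2; rewrite D mul1r in E4.
have k20 : k2 = 0.
  move: E1 E4 E2 => [_] [ed]; rewrite ed => E; apply/eqP; rewrite -absz_eq0 -leqn0 -ltnS; nia.
by move: E2 E1 E4; rewrite k20 mul0r addr0 => -[->] [->] [->].
Qed.

Section CosetTriples.
Variables (N : nat) (N0 : (0 < N)%N).

Lemma ex_hermite_triple B : det2 B = N -> exists x, [/\ x \in triples N &
  exists2 h, det2 h = 1 & B = mul2 h (up x)].
Proof.
move=> DB; have [h [a [b [d [[Dh E a0 ad bd] _]]]]] := hermite N0 DB.
by exists (a, b, d); split; [rewrite mem_triples // ad eqxx|exists h].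
Qed.

(* The Hermite normal form of diag(N, 1) g, which classifies the coset Gamma_0(N) g. *)
Definition coset_triple g : triple :=
  if pselect (det2 (mul2 (Mat2 N 0 0 1) g) = N) is left D
  then projT1 (cid (ex_hermite_triple D)) else (0, 0, 0)%N.

Lemma coset_tripleP g : det2 g = 1 -> coset_triple g \in triples N /\
  exists2 h, det2 h = 1 & mul2 (Mat2 N 0 0 1) g = mul2 h (up (coset_triple g)).
Proof.
move=> Dg; rewrite /coset_triple; case: pselect => [D|]; last first.
  by rewrite det2M Dg /det2 /= !mulr1 mulr0 subr0.
by case: cid => x /= [].
Qed.

(** Conjugation by diag(N, 1) maps (p q; r s) to (p, N q; r / N, s), which is integral exactly when
    N divides r; having the same Hermite form means equivalence under SL_2(Z) on the left. *)
Lemma coset_triple_eq g g' : det2 g = 1 -> det2 g' = 1 ->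
  (coset_triple g == coset_triple g') = (N %| m21 (mul2 g' (adj2 g)))%Z.
Proof.
move=> Dg Dg'; have [xN [h Dh E]] := coset_tripleP Dg; have [xN' [h' Dh' E']] := coset_tripleP Dg'.
have NZ : N%:Z != 0 by rewrite eqz_nat -lt0n.
apply/eqP/idP => [eqx|/dvdzP[q Eq]].
  have : mul2 (Mat2 N 0 0 1) (mul2 g' (adj2 g)) = mul2 (mul2 h' (adj2 h)) (Mat2 N 0 0 1).
    rewrite mul2A E' -eqx -(mul2_1l (up _)) -(mul2_adjl Dh) -(mul2A (adj2 h)) -E.
    by rewrite !mul2A -(mul2A (mul2 (mul2 h' _) _)) mul2_adj // mul2_1r.
  move: (mul2 g' _) (mul2 h' _) => [p1 p2 p3 p4] [q1 q2 q3 q4]; rewrite /mul2 /= => -[_ _ + _].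
  by rewrite mul0r mul1r add0r mulr0 addr0 => ->; rewrite dvdz_mull.
move: Eq; have : det2 (mul2 g' (adj2 g)) = 1 by rewrite det2M det2_adj Dg Dg'.
move eG : (mul2 g' (adj2 g)) => G DG; case: G eG DG => p1 p2 p3 p4 eG DG /= Eq.
have g'E : g' = mul2 (Mat2 p1 p2 p3 p4) g by rewrite -eG -mul2A mul2_adjl // mul2_1r.
pose k := Mat2 p1 (N%:Z * p2) q p4.
have Dk : det2 k = 1 by rewrite -DG /det2 /= Eq; ring.
apply: (@hermite_uniq N _ _ (mul2 (adj2 h') (mul2 k h))) => //.
  by rewrite !det2M det2_adj Dh Dh' Dk.
rewrite -!mul2A -E -[RHS](mul2_1l) -(mul2_adjl Dh') -mul2A -E' g'E; congr (mul2 _ _).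
by rewrite !mul2A; congr (mul2 _ _); rewrite /k /mul2 /= Eq; congr Mat2; ring.
Qed.

End CosetTriples.

Section Hecke.
Variables (M N : nat) (N0 : (0 < N)%N) (coMN : coprime M N).

(** The lower left entries of up(x) g = h up(s x) give d m21(g) = m21(h) a', where d and a' divide N
    and so are prime to M. Uniqueness of Hermite forms makes s injective. *)
Lemma hecke_perm g : det2 g = 1 -> exists s : triple -> triple, perm_eq (map s (triples N)) (triples N) /\
  forall x, x \in triples N -> exists h, [/\ det2 h = 1, mul2 (up x) g = mul2 h (up (s x)) &
     (M %| m21 h)%Z = (M %| m21 g)%Z].
Proof.
move=> Dg; have hx x : x \in triples N -> det2 (mul2 (up x) g) = N.
  case: x => [[a b] d]; rewrite mem_triples // det2M Dg mulr1 det_up => /andP[/eqP E _].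
  by rewrite /= E.
pose s x := if pselect (det2 (mul2 (up x) g) = N) is left D then projT1 (cid (ex_hermite_triple N0 D)) else x.
have sP x : x \in triples N -> s x \in triples N /\ exists2 h, det2 h = 1 & mul2 (up x) g = mul2 h (up (s x)).
  by move=> xN; rewrite /s; case: pselect => [D|[]]; [case: cid => y /= []|exact: hx].
exists s; split; last first.
  move=> x xN; have [sN [h Dh E]] := sP x xN; exists h; split=> //.
  move: x xN (s x) sN E => [[a b] d] + [[a' b'] d']; rewrite !mem_triples // => /andP[/eqP ad _] /andP[/eqP ad' _].
  rewrite /up /upper /mul2 /=; case: g {Dg s sP hx} => g1 g2 g3 g4; case: h Dh => h1 h2 h3 h4 _ /= [_ _ E _].
  move: E; rewrite mul0r add0r mulr0 addr0 => E.
  have cd : coprimez M d by rewrite /coprimez /gcdz /=; apply: coprime_dvdr coMN; rewrite -ad dvdn_mull.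
  have ca : coprimez M a' by rewrite /coprimez /gcdz /=; apply: coprime_dvdr coMN; rewrite -ad' dvdn_mulr.
  by rewrite -(Gauss_dvdzl _ ca) -E Gauss_dvdzr.
have u : uniq (map s (triples N)).
  rewrite map_inj_in_uniq ?triples_uniq // => x y xN yN sxy.
  have [_ [h Dh E]] := sP x xN; have [_ [h' Dh' E']] := sP y yN.
  apply: (@hermite_uniq N _ _ (mul2 h' (adj2 h)) N0 xN yN); first by rewrite det2M det2_adj Dh Dh'.
  have cancel z : z = mul2 (mul2 z g) (adj2 g) by rewrite -mul2A mul2_adj // mul2_1r.
  rewrite [up x]cancel [up y]cancel E E' sxy !mul2A -(mul2A h') mul2_adjl // mul2_1r //.
have sub : {subset map s (triples N) <= triples N} by move=> _ /mapP[x xN ->]; case: (sP x xN).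
by rewrite uniq_perm ?triples_uniq //; case: (uniq_min_size u sub); rewrite ?size_map.
Qed.

End Hecke.

(** * Modular functions as polynomials in the Hauptmodul *)

Section ModularFunctions.
Variable R : realType.
Local Notation nm := (@modulus R).
Local Notation e := (@qexp R).
Local Notation H := (@upper_half_plane R).
Local Notation HolC := (Hol (idfun : {rmorphism R[i] -> R[i]})).
Local Notation HolZ := (Hol (intr : {rmorphism int -> R[i]})).
Implicit Types (F G t : R[i] -> R[i]).

Lemma Hol_HolC (A : comNzRingType) (f : {rmorphism A -> R[i]}) w F : Hol f w F -> HolC w F.
Proof.
move=> hF y eps y0 eps0; have [p hp] := hF y eps y0 eps0; exists (map_poly f p) => tau yt.
by rewrite map_poly_id // hp.
Qed.

(** Dropping the constant coefficient of an approximant p allows division by q, but this coefficient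
    is only close to 0. So p is compared with ever finer approximants [p2], and Cauchy's estimate on
    Im = y / 2 yields the factor |q| that the division consumes. *)
Lemma Hol_div_e (A : comNzRingType) (f : {rmorphism A -> R[i]}) F :
  Hol f 1 F -> tends_infty F 0 -> Hol f 1 (fun tau => F tau / e tau).
Proof.
move=> hF F0 y eps y0 eps0; have y20 : 0 < y / 2 by lra.
pose rho : R := expR (- (2 * pi * (y / 2))).
have r0 : 0 < rho by apply: expR_gt0.
have r1 : rho < 1 by rewrite expR_lt1 oppr_lt0 !mulr_gt0 ?pi_gt0 ?invr_gt0.
pose e' := eps * rho * (1 - rho) / 4.
have e'0 : 0 < e' by rewrite /e' divr_gt0 // !mulr_gt0 //; lra.
have [p hp] := hF _ _ y20 e'0.
exists (drop_poly 1 p) => tau yt; rewrite divr1; set x := e tau.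
have x0 : x != 0 := e_neq0 _; have xn : 0 < nm x by rewrite modulus_gt0.
have xr : nm x <= rho ^+ 2.
  rewrite /rho -expRM_natr; apply: le_trans (modulus_e_le yt) _.
  by rewrite ler_expR; lra.
have E : (map_poly f p).[x] = (map_poly f p)`_0 + x * (map_poly f (drop_poly 1 p)).[x].
  rewrite -{1}(poly_take_drop 1 p) rmorphD rmorphM /= map_polyXn hornerD hornerM hornerXn expr1 mulrC; congr (_ + _).
  rewrite (size1_polyC (_ : (size (take_poly 1 p) <= 1)%N)) ?size_take_poly // map_polyC hornerC.
  by rewrite coef_take_poly coef_map.
have -> : F tau / x - (map_poly f (drop_poly 1 p)).[x] = (F tau - x * (map_poly f (drop_poly 1 p)).[x]) / x.
  by rewrite mulrBl mulrAC divff // mul1r.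
rewrite modulusM modulusV ler_pdivrMr //; apply/ler_addgt0Pl => d d0.
pose e2 := Num.min e' (d / 2).
have e20 : 0 < e2 by rewrite lt_min e'0; lra.
have e21 : e2 <= e' by rewrite ge_min lexx.
have e22 : e2 <= d / 2 by rewrite ge_min lexx orbT.
have [p2 hp2] := hF _ _ y20 e20.
have y2t : y / 2 <= complex.Im tau by lra.
pose s := map_poly f p2 - map_poly f p.
have hs u : complex.Im u = y / 2 -> nm s.[e u] <= 2 * e'.
  move=> ue; have := hp u; have := hp2 u; rewrite ue lexx divr1 => /(_ isT) a /(_ isT) b.
  rewrite /s hornerD hornerN; have := modulusB (F u - (map_poly f p).[e u]) (F u - (map_poly f p2).[e u]).
  rewrite (_ : F u - _ - _ = (map_poly f p2).[e u] - (map_poly f p).[e u]); last by ring.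
  lra.
pose th := nm x / rho.
have thr : th <= rho by rewrite /th ler_pdivrMr // -expr2.
have th0 : 0 <= th by rewrite divr_ge0 // ltW.
have th1 : (0 <= th) && (th < 1) by rewrite th0 (le_lt_trans thr).
have := horner_sub_coef0_le (x := x) hs th1; rewrite -/rho {1}/th divfK ?gt_eqF // => /(_ (lexx _)) sx.
have {}sx : nm (s.[x] - s`_0) <= eps * nm x / 2.
  apply: le_trans sx _.
  have -> : eps * nm x / 2 = 2 * e' * (th / (1 - rho)).
    by rewrite /e' /th; field; rewrite subr_eq0 (gt_eqF r1) (gt_eqF r0).
  rewrite ler_wpM2l //; first by lra.
  by rewrite ler_wpM2l // lef_pV2 ?posrE; lra.
have c0 : nm (map_poly f p2)`_0 <= e2.
  have := Hol_approx_coef0 (ltn0Sn 0) F0 hp2; rewrite subr0; exact.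
have hx := hp2 _ y2t; rewrite divr1 -/x in hx.
have -> : F tau - x * (map_poly f (drop_poly 1 p)).[x] =
    (F tau - (map_poly f p2).[x]) + (s.[x] - s`_0) + (map_poly f p2)`_0.
  by rewrite /s hornerD hornerN coefB E; ring.
apply: le_trans (modulusD _ _) _; have := modulusD (F tau - (map_poly f p2).[x]) (s.[x] - s`_0).
by have := mulr_gt0 eps0 xn; lra.
Qed.

(** The constant coefficients of the approximants are integers arbitrarily close to c, and two
    distinct integers are at distance at least 1. *)
Lemma Hol_int_limit w F (c : R[i]) : (0 < w)%N -> HolZ w F -> tends_infty F c -> exists n : int, c = n%:~R.
Proof.
move=> w0 hF Fc; have near eps : 0 < eps -> exists n : int, nm (n%:~R - c) <= eps.
  move=> eps0; have [p hp] := hF 1 eps ltr01 eps0; exists p`_0.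
  by rewrite -(coef_map (intr : {rmorphism int -> R[i]})); apply: Hol_approx_coef0 w0 Fc hp.
have [n hn] := near (1 / 4) ltac:(lra); exists n; apply/eqP; rewrite -subr_eq0 -modulus_eq0.
apply/eqP/le_anti; rewrite modulus_ge0 andbT; apply/ler_addgt0Pl => d d0; rewrite addr0.
pose d' := Num.min d (1 / 4); have d'0 : 0 < d' by rewrite lt_min d0; lra.
have [m hm] := near d' d'0.
have d1 : d' <= d by rewrite ge_min lexx.
have d2 : d' <= 1 / 4 by rewrite ge_min lexx orbT.
suff <- : m = n by rewrite modulusC; lra.
apply/eqP; rewrite -subr_eq0; apply: contraT => mn.
have := modulusB (m%:~R - c) (n%:~R - c).
rewrite (_ : m%:~R - c - (n%:~R - c) = (m - n)%:~R); last by rewrite rmorphB /=; ring.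
rewrite intr_C modulus_real -intr_norm => h.
have : (1 : R) <= `|m - n|%:~R by rewrite -[1]/(1%:~R) ler_int -gtz0_ge1 normr_gt0.
by lra.
Qed.

Definition invariant0 (M : nat) F := forall g, det2 g = 1 -> (M %| m21 g)%Z ->
  forall tau, H tau -> F (act g tau) = F tau.

Definition cusps_regular (M W : nat) F := forall g, det2 g = 1 -> ~~ (M %| m21 g)%Z ->
  HolC W (fun tau => F (act g tau)).

(* For every z the product of z - G over the cosets has level one, hence is constant;
   so G takes finitely many values. *)
Lemma invariant_zero (M W : nat) G : (0 < M)%N -> (0 < W)%N -> invariant0 M G -> cusps_regular M W G ->
  HolC 1 G -> tends_infty G 0 -> forall tau, H tau -> G tau = 0.
Proof.
move=> M0 W0 Ginv Gcusp hG G0.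
have hGg g : det2 g = 1 -> HolC W (fun tau => G (act g tau)).
  move=> Dg; have [Mg|] := boolP (M %| m21 g)%Z; last exact: Gcusp.
  have := Hol_widen (ltn0Sn 0) W0 hG; rewrite mul1n.
  by apply: Hol_ext => tau t0; rewrite Ginv.
have ct g := coset_tripleP M0 (g := g).
have same g g' tau : det2 g = 1 -> det2 g' = 1 -> H tau -> coset_triple M0 g = coset_triple M0 g' ->
    G (act g' tau) = G (act g tau).
  move=> Dg Dg' t0 E; have := coset_triple_eq M0 Dg Dg'; rewrite E eqxx => /esym Mg.
  have E2 : g' = mul2 (mul2 g' (adj2 g)) g by rewrite -mul2A mul2_adjl // mul2_1r.
  have D2 : det2 (mul2 g' (adj2 g)) = 1 by rewrite det2M det2_adj Dg Dg'.
  by rewrite {1}E2 actM ?det1_gt0 // Ginv //; apply/H_act/det1_gt0.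
pose good x g := det2 g = 1 /\ coset_triple M0 g = x.
(* The triples that arise as Hermite forms index the cosets, and [rep] chooses a representative of
   each. *)
pose L := [seq x <- triples M | `[<exists g, good x g>]].
have /choice[rep hrep] : forall x, exists g, x \in L -> good x g.
  move=> x; case: (boolP (x \in L)) => [|_]; last by exists (Mat2 1 0 0 1).
  by rewrite mem_filter => /andP[/asboolP[g hg] _]; exists g.
have LP g : det2 g = 1 -> coset_triple M0 g \in L.
  move=> Dg; rewrite mem_filter; case: (ct g Dg) => -> _; rewrite andbT.
  by apply/asboolP; exists g.
have Lu : uniq L by apply/filter_uniq/triples_uniq.
pose P z tau := \prod_(x <- L) (z - G (act (rep x) tau)).
have Pinv z g0 tau : det2 g0 = 1 -> H tau -> P z (act g0 tau) = P z tau.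
  move=> D0 t0; pose s x := coset_triple M0 (mul2 (rep x) g0).
  have sL x : x \in L -> det2 (mul2 (rep x) g0) = 1 by case/hrep => Dx _; rewrite det2M Dx D0.
  have su : uniq (map s L).
    rewrite map_inj_in_uniq // => x y xL yL /eqP; rewrite coset_triple_eq ?sL //.
    have [Dx xE] := hrep _ xL; have [Dy yE] := hrep _ yL.
    have -> : mul2 (mul2 (rep y) g0) (adj2 (mul2 (rep x) g0)) = mul2 (rep y) (adj2 (rep x)).
      have -> : adj2 (mul2 (rep x) g0) = mul2 (adj2 g0) (adj2 (rep x)).
        by case: (rep x) (g0) => ? ? ? ? [? ? ? ?]; rewrite /adj2 /mul2 /=; congr Mat2; ring.
      by rewrite !mul2A -(mul2A (rep y)) mul2_adj // mul2_1r.
    by rewrite -coset_triple_eq // xE yE => /eqP.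
  have sub : {subset map s L <= L} by move=> _ /mapP[x xL ->]; apply/LP/sL.
  have pm : perm_eq (map s L) L.
    by rewrite uniq_perm //; case: (uniq_min_size su sub); rewrite ?size_map.
  rewrite /P -[RHS](perm_big _ pm) big_map; apply: eq_big_seq => x xL; congr (_ - _).
  have [Dx _] := hrep _ xL; have [Ds sE] := hrep _ (sub _ (map_f s xL)).
  by rewrite -actM ?det1_gt0 //; apply: same => //; apply: sL.
have PHol z : HolC W (P z).
  have : {in L, forall x, HolC W (fun tau => z - G (act (rep x) tau))}.
    move=> x /hrep[Dx _].
    exact: HolD (Hol_cst (idfun : {rmorphism R[i] -> R[i]}) W z) (HolN (hGg _ Dx)).
  rewrite /P; elim: (L) => [|x l IH] h; first by apply: Hol_ext (Hol1 _ _) => tau _; rewrite big_nil.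
  apply: Hol_ext (HolM (h x (mem_head _ _)) (IH _)) => [tau _|y yl]; first by rewrite big_cons.
  by apply: h; rewrite in_cons yl orbT.
have PT z : invariantT (P z) by move=> tau t0; have := Pinv z (Mat2 1 1 0 1) tau erefl t0; rewrite act_T.
have PS z : invariantS (P z) by move=> tau t0; have := Pinv z (Mat2 0 1 (-1) 0) tau erefl t0; rewrite act_S.
have i0 : H 'i by rewrite /upper_half_plane /= ltr01.
have fin tau : H tau -> G tau \in [seq G (act (rep x) 'i) | x <- L].
  move=> t0; have D1 : det2 (Mat2 1 0 0 1) = 1 by [].
  (* For z = G tau the factor of the trivial coset vanishes at tau, so the constant [P z] is 0, and
     some factor vanishes at i as well. *)
  have [c hc] := level_one W0 (PHol (G tau)) (PT _) (PS _).
  have : P (G tau) 'i = 0.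
    rewrite (hc _ i0) -(hc _ t0); apply/eqP; rewrite prodf_seq_eq0; apply/hasP.
    have xL := LP _ D1; exists (coset_triple M0 (Mat2 1 0 0 1)) => //=.
    have [Dx xE] := hrep _ xL.
    by rewrite -(same (rep (coset_triple M0 (Mat2 1 0 0 1))) _ tau Dx D1 t0 xE) act1 subrr.
  move/eqP; rewrite prodf_seq_eq0 => /hasP[x xL /=]; rewrite subr_eq0 => /eqP->.
  exact: map_f.
have cst tau : H tau -> G tau = G 'i.
  by move=> t0; apply: (continuousH_finite_range (Hol_continuous hG) fin).
move=> tau t0; rewrite cst //; apply: (tends_infty_unique _ G0).
move=> eps eps0; exists 1 => u hu; rewrite cst ?subrr ?modulus0 ?ltW //.
by apply: lt_le_trans hu.
Qed.

Section PolynomialInHauptmodul.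
Variables (M W : nat) (t : R[i] -> R[i]).
Hypotheses (M0 : (0 < M)%N) (W0 : (0 < W)%N) (tinv : invariant0 M t).
Hypotheses (tcusp : cusps_regular M W t) (tZ : HolZ 1 (fun tau => e tau * t tau)).
Hypothesis t1 : tends_infty (fun tau => e tau * t tau) 1.

Lemma tends_inftyD F G a b : tends_infty F a -> tends_infty G b ->
  tends_infty (fun tau => F tau + G tau) (a + b).
Proof.
move=> hF hG eps eps0; have e20 : 0 < eps / 2 by lra.
have [Y hY] := hF _ e20; have [Z hZ] := hG _ e20.
exists (Num.max Y Z) => tau; rewrite ge_max => /andP[/hY u /hZ v].
rewrite opprD addrACA; apply: le_trans (modulusD _ _) _; lra.
Qed.

Lemma tends_infty_ext F G c : (forall tau, H tau -> F tau = G tau) -> tends_infty F c -> tends_infty G c.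
Proof.
move=> FG hF eps eps0; have [Y hY] := hF _ eps0; exists (Num.max Y 1) => tau.
by rewrite ge_max => /andP[/hY + h1]; rewrite FG //; apply: lt_le_trans h1.
Qed.

Lemma cusps_regularD F G : cusps_regular M W F -> cusps_regular M W G ->
  cusps_regular M W (fun tau => F tau + G tau).
Proof. by move=> hF hG g Dg Mg; apply: HolD; [apply: hF|apply: hG]. Qed.

(** The limit c is an integer n; after subtraction of n t^K from F the limit is 0, so [Hol_div_e]
    lowers K by one. The coefficient of index K is kept for the degree in Y. *)
Lemma poly_in_hauptmodul K F (c : R[i]) : invariant0 M F -> cusps_regular M W F ->
  HolZ 1 (fun tau => e tau ^+ K * F tau) -> tends_infty (fun tau => e tau ^+ K * F tau) c ->
  exists P : {poly int}, [/\ (size P <= K.+1)%N, (P`_K)%:~R = c &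
    forall tau, H tau -> F tau = (map_poly intr P).[t tau]].
Proof.
elim: K F c => [|K IHK] F c Finv Fcusp FZ Fc; have [n nE] := Hol_int_limit (ltn0Sn 0) FZ Fc.
  have hF : HolZ 1 F by apply: Hol_ext FZ => tau _; rewrite expr0 mul1r.
  exists n%:P; split; rewrite ?size_polyC_leq1 ?coefC //.
  move=> tau t0; rewrite map_polyC hornerC; apply/eqP; rewrite -subr_eq0; apply/eqP.
  apply: (invariant_zero (G := fun tau => F tau - n%:~R) M0 W0) => //.
  - by move=> g Dg Mg u u0; rewrite Finv.
  - by apply: cusps_regularD => // g _ _; apply: (Hol_cst (idfun : {rmorphism R[i] -> R[i]})).
  - exact: HolD (Hol_HolC hF) (Hol_cst (idfun : {rmorphism R[i] -> R[i]}) _ _).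
  rewrite -(subrr c); apply: tends_inftyD; last by rewrite nE; apply: tends_infty_cst.
  by apply: tends_infty_ext Fc => u _; rewrite expr0 mul1r.
pose F' tau := F tau + (- n)%:~R * t tau ^+ K.+1.
have F'inv : invariant0 M F' by move=> g Dg Mg u u0; rewrite /F' Finv ?tinv.
have F'cusp : cusps_regular M W F'.
  apply: cusps_regularD => // g Dg Mg.
  exact: HolM (Hol_cst (idfun : {rmorphism R[i] -> R[i]}) _ _) (HolX _ (tcusp Dg Mg)).
have F'E tau : e tau ^+ K.+1 * F tau + (- n)%:~R * (e tau * t tau) ^+ K.+1 = e tau ^+ K.+1 * F' tau.
  by rewrite /F' exprMn mulrDr mulrCA.
have F'Z : HolZ 1 (fun tau => e tau ^+ K.+1 * F' tau).
  apply: Hol_ext (fun tau _ => F'E tau) _.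
  exact: HolD FZ (HolM (Hol_cst (intr : {rmorphism int -> R[i]}) _ _) (HolX _ tZ)).
have F'0 : tends_infty (fun tau => e tau ^+ K.+1 * F' tau) 0.
  apply: tends_infty_ext (fun tau _ => F'E tau) _.
  have -> : 0 = c + (- n)%:~R * 1 ^+ K.+1 by rewrite expr1n mulr1 nE rmorphN subrr.
  apply: tends_inftyD => //; apply: tends_inftyM; first exact: tends_infty_cst.
  elim: K.+1 => [|m IH]; first exact: tends_infty_cst.
  by rewrite exprS; apply: tends_infty_ext (tends_inftyM t1 IH) => tau _; rewrite exprS.
have F'q : HolZ 1 (fun tau => e tau ^+ K * F' tau).
  apply: Hol_ext (Hol_div_e F'Z F'0) => tau _.
  by rewrite exprS mulrC -mulrA mulKf ?e_neq0.
have [c' hc'] := Hol_tends (ltn0Sn 0) F'q.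
have [P [sP _ PE]] := IHK F' c' F'inv F'cusp F'q hc'.
exists (P + n *: 'X^(K.+1)); split.
- apply: leq_trans (size_polyD _ _) _; rewrite geq_max (leq_trans sP) //=.
  by apply: leq_trans (size_scale_leq _ _) _; rewrite size_polyXn.
- by rewrite coefD coefZ coefXn eqxx mulr1 nth_default // add0r nE.
move=> tau t0; rewrite rmorphD /= hornerD -PE // /F' map_polyZ /= map_polyXn hornerZ hornerXn.
by rewrite rmorphN mulNr subrK.
Qed.

End PolynomialInHauptmodul.

End ModularFunctions.

(** * Integrality *)

(* The norm from Z[x] to Z[x^d], computed on the companion matrix of x^d - y. *)
Lemma prod_conjugates (L : idomainType) (p : {poly int}) (d : nat) : (0 < d)%N ->
  exists D : {poly {poly int}}, forall (y : L) (x : 'I_d -> L), injective x -> (forall b, x b ^+ d = y) ->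
    \prod_b (x b *: 'X - ((map_poly intr p).[x b])%:P) =
    map_poly (horner_eval y) (map_poly (map_poly intr) D).
Proof.
case: d => // d _; pose C : 'M[{poly int}]_d.+1 :=
  \matrix_(i, j) if (i.+1 < d.+1)%N then (j == i.+1 :> nat)%:R else (j == 0%N :> nat)%:R * 'X.
pose A : 'M[{poly {poly int}}]_d.+1 := 'X *: map_mx polyC C - map_mx polyC (horner_mx C (map_poly polyC p)).
exists (\det A) => y x xinj xy.
pose phi : {rmorphism {poly int} -> L} := horner_eval y \o map_poly intr.
have phiX : phi 'X = y by rewrite /= map_polyX horner_evalE hornerX.
have phiC c : phi c%:P = c%:~R by rewrite /= map_polyC horner_evalE hornerC.
have -> : map_poly (horner_eval y) (map_poly (map_poly intr) (\det A)) = map_poly phi (\det A).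
  by rewrite -map_poly_comp.
rewrite -det_map_mx; clearbody phi.
pose C' := map_mx phi C; pose p' : {poly L} := map_poly intr p.
have -> : map_mx (map_poly phi) A = 'X *: map_mx polyC C' - map_mx polyC (horner_mx C' p').
  have -> : horner_mx C' p' = map_mx phi (horner_mx C (map_poly polyC p)).
    rewrite map_horner_mx; congr (horner_mx _ _); rewrite -map_poly_comp.
    by apply: eq_map_poly => c; rewrite [RHS]phiC.
  apply/matrixP => i j; rewrite !mxE rmorphB rmorphM /= map_polyX.
  by rewrite !map_polyC.
(* The columns of this Vandermonde matrix are eigenvectors of the companion matrix for the
   eigenvalues x_b, and distinct x_b make its determinant nonzero. *)
pose V : 'M[L]_d.+1 := \matrix_(i, j) x j ^+ i.
have CV : C' *m V = V *m diag_mx (\row_j x j).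
  apply/matrixP => i j; rewrite mul_mx_diag !mxE -exprSr.
  have [lt|ge] := ltnP i.+1 d.+1.
    rewrite (bigD1 (Ordinal lt)) //= !mxE lt eqxx rmorph1 mul1r big1 ?addr0 // => k.
    by rewrite -val_eqE /= => /negPf nk; rewrite !mxE lt nk rmorph0 mul0r.
  have -> : i.+1 = d.+1 by apply/eqP; rewrite eqn_leq ge ltn_ord.
  rewrite xy (bigD1 ord0) //= !mxE ltnNge ge /= mul1r phiX expr0 mulr1 big1 ?addr0 // => k.
  by rewrite -val_eqE /= => /negPf nk; rewrite !mxE ltnNge ge nk /= mul0r rmorph0 mul0r.
have pV (q : {poly L}) : horner_mx C' q *m V = V *m diag_mx (\row_j q.[x j]).
  elim/poly_ind: q => [|q c IH].
    rewrite rmorph0 mul0mx; apply/esym/matrixP => i j; rewrite mul_mx_diag !mxE horner0 mulr0 //.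
  rewrite rmorphD rmorphM /= horner_mx_X horner_mx_C mulmxDl -mulmxA CV mulmxA IH -mulmxA mulmx_diag.
  rewrite mul_scalar_mx; apply/matrixP => i j; rewrite !mul_mx_diag !mxE !hornerE /=.
  by rewrite mulrDr mulrA (mulrC c).
pose PV := map_mx polyC V.
have PVdet : \det PV != 0.
  rewrite det_map_mx polyC_eq0; have -> : V = Vandermonde d.+1 (\row_j x j).
    by apply/matrixP => i j; rewrite !mxE.
  rewrite det_Vandermonde prodf_seq_neq0; apply/allP => i _ /=.
  rewrite prodf_seq_neq0; apply/allP => j _; apply/implyP => ij /=; rewrite !mxE subr_eq0 (inj_eq xinj).
  by apply: contraTneq ij => ->; rewrite ltnn.
apply/esym/(mulIf PVdet); rewrite -det_mulmx.
have -> : ('X *: map_mx polyC C' - map_mx polyC (horner_mx C' p')) *m PV =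
    PV *m diag_mx (\row_j (x j *: 'X - (p'.[x j])%:P)).
  rewrite mulmxBl -scalemxAl -!map_mxM CV pV; apply/matrixP => i j; rewrite !mul_mx_diag !mxE.
  by rewrite /= !polyCM -mul_polyC; ring.
rewrite det_mulmx det_diag mulrC; congr (_ * _).
by apply: eq_bigr => j _; rewrite mxE.
Qed.

(** * Integral expansions of the coefficients of the Hecke products *)

Section HeckePolynomial.
Variable R : realType.
Local Notation nm := (@modulus R).
Local Notation e := (@qexp R).
Local Notation H := (@upper_half_plane R).
Local Notation HolC := (Hol (idfun : {rmorphism R[i] -> R[i]})).
Local Notation HolZ := (Hol (intr : {rmorphism int -> R[i]})).

(** On bounded sets the coefficients of such a product are Lipschitz in the v_b, so an approximation
    of q t carries over to the product. *)
Lemma prod_linear_stable (n : nat) (B : R) : 0 <= B -> exists2 K, 0 <= K &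
  forall (u v v' : nat -> R[i]) (d : R), 0 <= d ->
  (forall b, (b < n)%N -> [/\ nm (u b) <= B, nm (v b) <= B, nm (v' b) <= B & nm (v b - v' b) <= d]) ->
  forall k, nm ((\prod_(0 <= b < n) (u b *: 'X - (v b)%:P))`_k - (\prod_(0 <= b < n) (u b *: 'X - (v' b)%:P))`_k) <= K * d
    /\ nm (\prod_(0 <= b < n) (u b *: 'X - (v' b)%:P))`_k <= K.
Proof.
move=> B0; elim: n => [|n [K K0 IH]].
  exists 1 => // u v v' d d0 _ k; rewrite !big_geq // subrr modulus0 mul1r; split=> //.
  by rewrite coef1; case: (k == 0%N); rewrite ?modulus1 ?modulus0.
exists (2 * B * K + K) => [|u v v' d d0 h k]; first by rewrite addr_ge0 // !mulr_ge0.
have {}IH := IH u v v' d d0 (fun b bn => h b (ltnW bn)).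
have [hu hv hv' hd] := h n (ltnSn n).
rewrite !big_nat_recr //=; set P := \prod_(0 <= b < n) (u b *: 'X - (v b)%:P) in IH *.
set P' := \prod_(0 <= b < n) (u b *: 'X - (v' b)%:P) in IH *.
have E (S : {poly R[i]}) a b : (S * (a *: 'X - b%:P))`_k = a * (if k is k'.+1 then S`_k' else 0) - b * S`_k.
  rewrite mulrBr -scalerAr coefB coefZ coefMX coefMC [S`_k * b]mulrC.
  by case: k.
rewrite !E; set s := (if k is _.+1 then _ else _); set s' := (if k is _.+1 then _ else _).
have [ss' s'K] : nm (s - s') <= K * d /\ nm s' <= K.
  rewrite /s /s'; case: (k) => [|k']; last exact: IH.
  by rewrite subrr modulus0 mulr_ge0.
have [PP' P'K] := IH k.
have n1 := modulus_ge0 (u n); have n2 := modulus_ge0 (v n); have n3 := modulus_ge0 (v' n).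
have n4 := modulus_ge0 (s - s'); have n5 := modulus_ge0 (P`_k - P'`_k); have n6 := modulus_ge0 s'.
have n7 := modulus_ge0 P'`_k; have n8 := modulus_ge0 (v n - v' n).
split.
  have -> : u n * s - v n * P`_k - (u n * s' - v' n * P'`_k) =
      u n * (s - s') - v n * (P`_k - P'`_k) - (v n - v' n) * P'`_k by ring.
  apply: le_trans (modulusB _ _) _; rewrite modulusM.
  have := modulusB (u n * (s - s')) (v n * (P`_k - P'`_k)); rewrite !modulusM.
  have := ler_pM n1 n4 hu ss'; have := ler_pM n2 n5 hv PP'; have := ler_pM n8 n7 hd P'K.
  by rewrite !mulrDl; lra.
apply: le_trans (modulusB _ _) _; rewrite !modulusM.
by have := ler_pM n1 n6 hu s'K; have := ler_pM n3 n7 hv' P'K; lra.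
Qed.

Lemma prod_e_frac (d : nat) : (0 < d)%N -> \prod_(0 <= b < d) e (b%:R / d%:R) = (-1) ^+ d.-1.
Proof.
move=> d0; have dC : d%:R != 0 :> R[i] by rewrite pnatr_eq0 -lt0n.
have -> : \prod_(0 <= b < d) e (b%:R / d%:R) = e (d%:R * (d%:R - 1) / 2 / d%:R).
  have E n : \prod_(0 <= b < n) e (b%:R / d%:R) = e (n%:R * (n%:R - 1) / 2 / d%:R).
    elim: n => [|n IH]; first by rewrite big_geq // !mul0r e0.
    rewrite big_nat_recr //= IH -e_add -natr1; congr (e _); field; exact: dC.
  exact: E.
rewrite (_ : _ / d%:R = d.-1%:R * (1 / 2)); first by rewrite e_natM e_half.
by rewrite -{1 2 3}(prednK d0) -natr1; move: dC; rewrite -{1}(prednK d0) -natr1 => dC; field.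
Qed.

Variable t : R[i] -> R[i].
Hypothesis tZ : HolZ 1 (fun tau => e tau * t tau).
Hypothesis t1 : tends_infty (fun tau => e tau * t tau) 1.

Lemma Im_affine (a b d : nat) tau : complex.Im ((a%:R * tau + b%:R) / d%:R : R[i]) = a%:R / d%:R * complex.Im tau.
Proof.
rewrite -!(rmorph_nat (real_complex R)) -fmorphV.
by case: tau => x y /=; rewrite !(mul0r, mulr0, addr0, add0r, subr0) mulrAC.
Qed.

Definition hecke_factor (a d : nat) tau : {poly R[i]} :=
  \prod_(0 <= b < d) ('X - (t ((a%:R * tau + b%:R) / d%:R))%:P).

(** Multiplying the b-th factor by its own q turns X - t into q X - q t, which stays bounded at
    infinity. The product of these q is (-1)^(d-1) q^a, since the fractions b / d add up to (d - 1)
    / 2. *)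
Lemma hecke_factorE (a d : nat) tau : (0 < d)%N -> e tau ^+ a *: hecke_factor a d tau = (-1) ^+ d.-1 *:
  \prod_(0 <= b < d) (e ((a%:R * tau + b%:R) / d%:R) *: 'X -
     (e ((a%:R * tau + b%:R) / d%:R) * t ((a%:R * tau + b%:R) / d%:R))%:P).
Proof.
move=> d0; have dC : d%:R != 0 :> R[i] by rewrite pnatr_eq0 -lt0n.
have E (u v : nat -> R[i]) n : \prod_(0 <= b < n) (u b *: 'X - (u b * v b)%:P) =
    (\prod_(0 <= b < n) u b) *: \prod_(0 <= b < n) ('X - (v b)%:P).
  elim: n => [|n IH]; first by rewrite !big_geq // scale1r.
  by rewrite !big_nat_recr //= IH -!mul_polyC !polyCM; ring.
rewrite (E (fun b => e ((a%:R * tau + b%:R) / d%:R)) (fun b => t ((a%:R * tau + b%:R) / d%:R))) -/(hecke_factor a d tau).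
have -> : \prod_(0 <= b < d) e ((a%:R * tau + b%:R) / d%:R) = (-1) ^+ d.-1 * e tau ^+ a.
  under eq_bigr => b _ do rewrite mulrDl e_add.
  rewrite big_split /= prod_e_frac // prodr_const_nat subn0 -!e_natM mulrC; congr (_ * e _).
  by field.
by rewrite scalerA mulrA -exprMn mulrNN mulr1 expr1n mul1r.
Qed.

(** The points e((a tau + b) / d) for b < d are the d distinct d-th roots of q^a. With q t replaced
    by an integral polynomial the product is a norm, so its coefficients are integral polynomials in
    q^a; [prod_linear_stable] controls the error. *)
Lemma Hol_hecke_factor (a d k : nat) : (0 < a)%N -> (0 < d)%N ->
  HolZ 1 (fun tau => (e tau ^+ a *: hecke_factor a d tau)`_k).
Proof.
move=> a0 d0; have dC : d%:R != 0 :> R[i] by rewrite pnatr_eq0 -lt0n.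
have s0 : 0 < a%:R / d%:R :> R by rewrite divr_gt0 ?ltr0n.
pose z (b : nat) tau := (a%:R * tau + b%:R) / d%:R : R[i].
suff h : HolZ 1 (fun tau => (\prod_(0 <= b < d) (e (z b tau) *: 'X - (e (z b tau) * t (z b tau))%:P))`_k).
  apply: Hol_ext (HolM (Hol_cst (intr : {rmorphism int -> R[i]}) 1 ((-1) ^+ d.-1)) h) => tau _.
  by rewrite hecke_factorE // coefZ rmorphXn rmorphN1.
move=> y eps y0 eps0.
have [B B0 hB] := Hol_bounded (mulr_gt0 s0 y0) tZ.
have B10 : 0 <= B + 1 by lra.
have [K K0 hK] := prod_linear_stable d B10.
pose del := Num.min 1 (eps / (K + 1)).
have K1 : 0 < K + 1 by lra.
have del0 : 0 < del by rewrite lt_min ltr01 divr_gt0.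
have del1 : del <= 1 by rewrite ge_min lexx.
have delK : K * del <= eps.
  have : del * (K + 1) <= eps by rewrite -ler_pdivlMr // ge_min lexx orbT.
  by rewrite mulrDr mulr1 mulrC; lra.
have [p hp] := tZ (mulr_gt0 s0 y0) del0; have [D hD] := prod_conjugates R[i] p d0.
exists (D`_k \Po 'X^a) => tau yt.
rewrite map_comp_poly map_polyXn horner_comp hornerXn divr1.
have t0 : H tau := lt_le_trans y0 yt.
have zy b : a%:R / d%:R * y <= complex.Im (z b tau) by rewrite Im_affine ler_pM2l.
have := hD (e tau ^+ a) (fun b : 'I_d => e (z b tau)).
have xinj : injective (fun b : 'I_d => e (z b tau)).
  have aux (b c : 'I_d) : (c <= b)%N -> e (z b tau) = e (z c tau) -> b = c.
    move=> cb E; have : e ((b - c)%:R / d%:R) = 1.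
      rewrite (_ : _ / _ = z b tau - z c tau); last by rewrite /z natrB // -mulrBl; congr (_ / _); ring.
      by rewrite e_sub E divff ?e_neq0.
    move=> /(e_frac_eq1 d0) dv; apply/val_inj/eqP; rewrite /= eqn_leq cb andbT -subn_eq0.
    by apply: contraTT dv; rewrite -lt0n => h; rewrite gtnNdvd // (leq_ltn_trans (leq_subr _ _)).
  move=> b c; case/orP: (leq_total c b) => h E; first exact: aux.
  by apply/esym/aux.
have xd b : e (z b tau) ^+ d = e tau ^+ a.
  rewrite -!e_natM mulrC divfK // e_add e_nat mulr1 //.
move=> /(_ xinj (fun b => xd b)); rewrite -(big_mkord xpredT (fun b => e (z b tau) *: 'X - (map_poly intr p).[e (z b tau)]%:P)) => E.
have -> : (map_poly intr D`_k).[e tau ^+ a] =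
    (\prod_(0 <= b < d) (e (z b tau) *: 'X - (map_poly intr p).[e (z b tau)]%:P))`_k.
  by rewrite E !coef_map.
apply: le_trans delK; apply: (hK _ _ _ _ (ltW del0) _ k).1 => b _.
have h1 := hp _ (zy b); have h2 := hB _ (zy b); rewrite divr1 in h1; split=> //.
- have := modulus_e_lt1 (lt_le_trans (mulr_gt0 s0 y0) (zy b)); lra.
- lra.
- by have := modulus_dist (map_poly intr p).[e (z b tau)] (e (z b tau) * t (z b tau)); rewrite modulusC; lra.
Qed.

(** Each q t tends to 1, so the limit is a sign; it is what keeps the top coefficient in Y from
    vanishing. *)
Lemma hecke_factor_tends (a d : nat) : (0 < a)%N -> (0 < d)%N -> exists2 c, c != 0 &
  tends_infty (fun tau => (e tau ^+ a *: hecke_factor a d tau)`_0) c.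
Proof.
move=> a0 d0; exists ((-1) ^+ d.-1 * (-1) ^+ d); first by rewrite mulf_neq0 // expf_neq0 // oppr_eq0 oner_eq0.
have h b : tends_infty (fun tau => - (e ((a%:R * tau + b%:R) / d%:R) * t ((a%:R * tau + b%:R) / d%:R))) (-1).
  move=> eps eps0; have [Y hY] := t1 eps0; exists (`|Y| * (d%:R / a%:R)) => tau yt.
  rewrite -opprD modulusN; apply: hY; rewrite Im_affine; apply: le_trans (ler_norm _) _.
  by rewrite -ler_pdivrMl ?divr_gt0 ?ltr0n // invf_div mulrC.
have hp n : tends_infty (fun tau => (\prod_(0 <= b < n) (e ((a%:R * tau + b%:R) / d%:R) *: 'X -
     (e ((a%:R * tau + b%:R) / d%:R) * t ((a%:R * tau + b%:R) / d%:R))%:P))`_0) ((-1) ^+ n).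
  elim: n => [|n IH].
    by apply: tends_infty_ext (tends_infty_cst _) => tau _; rewrite big_geq // coef1.
  rewrite exprSr; apply: tends_infty_ext (tends_inftyM IH (h n)) => tau _.
  by rewrite big_nat_recr //= coef0M coefB coefZ coefX mulr0 sub0r coefC.
apply: tends_infty_ext (tends_inftyM (tends_infty_cst ((-1) ^+ d.-1)) (hp d)) => tau _.
by rewrite hecke_factorE // coefZ.
Qed.

Definition hecke_poly (P : triple -> bool) N tau : {poly R[i]} :=
  \prod_(x <- triples N | P x) ('X - (t (act (up x) tau))%:P).

Lemma hecke_polyE N tau :
  hecke_poly xpredT N tau = \prod_(p <- factorisations N) hecke_factor p.1 p.2 tau.
Proof.
rewrite /hecke_poly /triples big_allpairs_dep /=; apply: eq_bigr => p _.
by apply: eq_bigr => b _; rewrite act_upper.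
Qed.

Lemma hecke_poly_scaled (A : seq (nat * nat)) tau :
  e tau ^+ (\sum_(p <- A) p.1)%N *: \prod_(p <- A) hecke_factor p.1 p.2 tau =
  \prod_(p <- A) (e tau ^+ p.1 *: hecke_factor p.1 p.2 tau).
Proof.
elim: A => [|p A IH]; first by rewrite !big_nil scale1r.
by rewrite !big_cons -IH exprD -scalerAl -scalerAr scalerA.
Qed.

End HeckePolynomial.

(** * The modular equations *)

Lemma triples_gt0 N : (0 < N)%N -> (0 < size (triples N))%N.
Proof.
move=> N0; have : (1, 0, N)%N \in triples N by rewrite mem_triples // mul1n eqxx N0.
by case: (triples N).
Qed.

Definition scale_triple k x : triple := (k * x.1.1, k * x.1.2, k * x.2)%N.

Lemma triples_scale k N : (0 < k)%N -> (0 < N)%N -> (k ^ 2 %| N)%N ->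
  perm_eq [seq x <- triples N | content x == k]
    (map (scale_triple k) [seq x <- triples (N %/ k ^ 2) | content x == 1%N]).
Proof.
move=> k0 N0 kN; have N'0 : (0 < N %/ k ^ 2)%N by rewrite divn_gt0 ?expn_gt0 ?k0 // dvdn_leq.
apply: uniq_perm; first exact/filter_uniq/triples_uniq.
  rewrite map_inj_uniq; first exact/filter_uniq/triples_uniq.
  by move=> [[a b] d] [[a' b'] d'] [/eqP + /eqP + /eqP]; rewrite !eqn_pmul2l // => /eqP-> /eqP-> /eqP->.
have E a d : ((k * a) * (k * d) == N)%N = (a * d == N %/ k ^ 2)%N.
  by rewrite -{1}(divnK kN) mulnACA mulnn mulnC eqn_pmul2r // expn_gt0 k0.
move=> [[a b] d]; apply/idP/mapP.
  rewrite mem_filter => /andP[/eqP ck]; rewrite mem_triples // => /andP[ad bd].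
  have ka : (k %| a)%N by rewrite -ck /content /= (dvdn_trans (dvdn_gcdl _ _)) ?dvdn_gcdl.
  have kb : (k %| b)%N by rewrite -ck /content /= (dvdn_trans (dvdn_gcdl _ _)) ?dvdn_gcdr.
  have kd : (k %| d)%N by rewrite -ck /content /= dvdn_gcdr.
  exists (a %/ k, b %/ k, d %/ k)%N; last by rewrite /scale_triple /= ![(k * _)%N]mulnC !divnK.
  rewrite mem_filter mem_triples // -E ![(k * _)%N]mulnC !divnK // ad ltn_divLR // divnK // bd !andbT.
  by rewrite -(eqn_pmul2l k0) muln1 /content /= !muln_gcdr ![(k * _)%N]mulnC !divnK // -[X in _ == X]ck.
move=> [[[a' b'] d']]; rewrite mem_filter mem_triples // => /andP[/eqP ck /andP[ad bd]] [-> -> ->].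
by rewrite mem_filter mem_triples // E ad ltn_pmul2l // bd /content /= -!muln_gcdr -/(content (a', b', d')) ck muln1 eqxx.
Qed.

Lemma content_square_dvd N x : (0 < N)%N -> x \in triples N -> (content x ^ 2 %| N)%N.
Proof.
case: x => [[a b] d] N0; rewrite mem_triples // => /andP[/eqP<- _].
by rewrite -mulnn dvdn_mul // /content /= ?dvdn_gcdr // (dvdn_trans (dvdn_gcdl _ _)) ?dvdn_gcdl.
Qed.

Lemma content_gt0 N x : (0 < N)%N -> x \in triples N -> (0 < content x)%N.
Proof. by move=> N0 /(triple_gt0 N0)[a0 d0]; rewrite gcdn_gt0 d0 orbT. Qed.

(** The conjunction passes to products and to quotients by a balanced factor, which is how the
    equality of degrees reaches Psi_N. *)
Definition balanced (p : {poly {poly int}}) := (p \is monic) && (degX p == degY p).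

Lemma specYM (R : realType) (p q : {poly {poly int}}) (y : R[i]) : specY (p * q) y = specY p y * specY q y.
Proof. by rewrite /specY !rmorphM. Qed.

Lemma coef_specY (R : realType) (p : {poly {poly int}}) (y : R[i]) k : (specY p y)`_k = (map_poly intr p`_k).[y].
Proof. by rewrite /specY coef_map coef_map. Qed.

Lemma degY_mul (p q : {poly {poly int}}) : p != 0 -> q != 0 -> degY (p * q) = (degY p + degY q)%N.
Proof.
move=> p0 q0; have sw0 (r : {poly {poly int}}) : r != 0 -> swapXY r != 0.
  by rewrite -!size_poly_eq0 -sizeYE => h; rewrite sizeY_eq0 -size_poly_eq0.
rewrite /degY !sizeYE rmorphM size_mul ?sw0 //.
move: (sw0 _ p0) (sw0 _ q0); rewrite -!size_poly_eq0.
by move: (size (swapXY p)) (size (swapXY q)) => a b; lia.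
Qed.

Lemma degX_mul (p q : {poly {poly int}}) : p != 0 -> q != 0 -> degX (p * q) = (degX p + degX q)%N.
Proof.
move=> p0 q0; rewrite /degX size_mul //; move: p0 q0; rewrite -!size_poly_eq0.
by move: (size p) (size q) => a b; lia.
Qed.

Lemma balancedM p q : balanced p -> balanced q -> balanced (p * q).
Proof.
move=> /andP[mp /eqP dp] /andP[mq /eqP dq]; rewrite /balanced monicMl // mq.
by rewrite degX_mul ?degY_mul ?monic_neq0 // dp dq eqxx.
Qed.

Lemma balanced_divr p q : balanced q -> balanced (p * q) -> balanced p.
Proof.
move=> /andP[mq /eqP dq] /andP[mpq]; have mp : p \is monic by rewrite -(monicMr p mq).
by rewrite degX_mul ?degY_mul ?monic_neq0 // dq eqn_add2r /balanced mp.
Qed.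

Lemma balanced1 : balanced 1.
Proof.
rewrite /balanced monic1 /degX /degY size_poly1 /=; apply/eqP.
by rewrite sizeYE rmorph1 size_poly1.
Qed.

Section ModularEquation.
Variable R : realType.
Local Notation nm := (@modulus R).
Local Notation e := (@qexp R).
Local Notation H := (@upper_half_plane R).
Local Notation HolC := (Hol (idfun : {rmorphism R[i] -> R[i]})).
Local Notation HolZ := (Hol (intr : {rmorphism int -> R[i]})).

Lemma Hol_coef_prod (A : comNzRingType) (f : {rmorphism A -> R[i]}) w (I : eqType) (s : seq I) (P : pred I)
    (F : I -> R[i] -> {poly R[i]}) :
  {in s, forall i k, P i -> Hol f w (fun tau => (F i tau)`_k)} ->
  forall k, Hol f w (fun tau => (\prod_(i <- s | P i) F i tau)`_k).
Proof.
elim: s => [|i s IH] h k.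
  apply: Hol_ext (Hol_cst f w (k == 0%N)%:R) => tau _.
  by rewrite big_nil coef1; case: (k == 0%N); rewrite ?rmorph1 ?rmorph0.
have hs : {in s, forall i k, P i -> Hol f w (fun tau => (F i tau)`_k)}.
  by move=> j js; apply: h; rewrite in_cons js orbT.
have [Pi|nPi] := boolP (P i); last first.
  by apply: Hol_ext (IH hs k) => tau _; rewrite big_cons (negPf nPi).
have hj (j : 'I_k.+1) : xpredT j -> Hol f w (fun tau => (F i tau)`_j * (\prod_(i <- s | P i) F i tau)`_(k - j)).
  by move=> _; exact: HolM (h i (mem_head _ _) j Pi) (IH hs (k - j)%N).
by apply: Hol_ext (Hol_sum _ hj) => tau _; rewrite big_cons Pi coefM.
Qed.

Variables (M W : nat) (t : R[i] -> R[i]).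
Hypotheses (M0 : (0 < M)%N) (W0 : (0 < W)%N) (tinv : invariant0 M t).
Hypotheses (tcusp : cusps_regular M W t) (tZ : HolZ 1 (fun tau => e tau * t tau)).
Hypothesis t1 : tends_infty (fun tau => e tau * t tau) 1.
Local Notation hecke := (hecke_poly t).

(** Otherwise t has finitely many values, is constant by connectedness, and q t tends to 0 instead
    of 1. *)
Lemma hauptmodul_poly_inj (r : {poly int}) :
  (forall tau, H tau -> (map_poly intr r).[t tau] = 0) -> r = 0.
Proof.
move=> r0; apply/eqP; apply: contraT => rn0.
have rn : map_poly intr r != 0 :> {poly R[i]} by rewrite map_poly_eq0_id0 // intr_eq0 lead_coef_eq0.
have [s hs] := closed_field_poly_normal (map_poly intr r : {poly R[i]}).
have ct : continuousH t.
  have ce : continuousH e by apply: continuousH_ext (continuousH_e 1) => tau _; rewrite mulr1.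
  have h := continuousHM (Hol_continuous tZ) (continuousHV (fun tau _ => e_neq0 tau) ce).
  by apply: continuousH_ext h => tau _; rewrite mulrC mulKf ?e_neq0.
have fin tau : H tau -> t tau \in s.
  move=> t0; have : root (map_poly intr r) (t tau) by rewrite rootE r0.
  by rewrite hs rootZ ?lead_coef_eq0 // root_prod_XsubC.
have i0 : H 'i by rewrite /upper_half_plane /= ltr01.
have h0 : tends_infty (fun tau => e tau * t tau) 0.
  rewrite -(mul0r (t 'i)); apply: tends_infty_ext (tends_inftyM (@tends_infty_e R) (tends_infty_cst (t 'i))) => tau t0.
  by rewrite (continuousH_finite_range ct fin t0 i0).
by have /eqP := tends_infty_unique t1 h0; rewrite oner_eq0.
Qed.

Lemma hecke_size N P tau : size (hecke P N tau) = (count P (triples N)).+1.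
Proof. by rewrite /hecke_poly -big_filter size_prod_XsubC size_filter. Qed.

Lemma hecke_monic N P tau : hecke P N tau \is monic.
Proof. exact: monic_prod_XsubC. Qed.

Section Level.
Variables (N : nat) (N0 : (0 < N)%N) (coMN : coprime M N).

Lemma H_up x tau : x \in triples N -> H tau -> H (act (up x) tau).
Proof.
by move=> /(triple_gt0 N0)[a0 d0] t0; apply: H_act => //; rewrite det_up ltz_nat muln_gt0 a0.
Qed.

Lemma act_hecke g : det2 g = 1 -> exists s : triple -> triple, perm_eq (map s (triples N)) (triples N) /\
  forall x, x \in triples N -> exists h, [/\ det2 h = 1, (M %| m21 h)%Z = (M %| m21 g)%Z &
    forall tau, H tau -> act (up x) (act g tau) = act h (act (up (s x)) tau)].
Proof.
move=> Dg; have [s [ps hs]] := hecke_perm N0 coMN Dg; exists s; split=> // x xN.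
have [h [Dh E Mh]] := hs x xN; exists h; split=> // tau t0.
have U0 y : y \in triples N -> 0 < det2 (up y).
  by move=> /(triple_gt0 N0)[a0 d0]; rewrite det_up ltz_nat muln_gt0 a0.
have Ux := U0 x xN; have Us : 0 < det2 (up (s x)) by apply: U0; rewrite -(perm_mem ps) map_f.
have g0 := det1_gt0 Dg; have h0 := det1_gt0 Dh.
by rewrite -[LHS]actM // E actM.
Qed.

Lemma hecke_invariant g tau : det2 g = 1 -> (M %| m21 g)%Z -> H tau ->
  hecke xpredT N (act g tau) = hecke xpredT N tau.
Proof.
move=> Dg Mg t0; have [s [ps hs]] := act_hecke Dg.
rewrite /hecke_poly -[RHS](perm_big _ ps) big_map; apply: eq_big_seq => x xN.
have [h [Dh Mh E]] := hs x xN; rewrite E // tinv ?Mh //.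
by apply: H_up => //; rewrite -(perm_mem ps) map_f.
Qed.

(** A g outside Gamma_0(M) passes to an h outside Gamma_0(M), where t is regular. The width W d of
    the factor for (a, b, d) is widened to the common W N. *)
Lemma hecke_cusps k : cusps_regular M (W * N) (fun tau => (hecke xpredT N tau)`_k).
Proof.
move=> g Dg Mg; have [s [ps hs]] := act_hecke Dg.
rewrite /hecke_poly; apply: Hol_coef_prod => x xN j _.
have [h [Dh Mh E]] := hs x xN; rewrite (negPf Mg) in Mh.
have sN : s x \in triples N by rewrite -(perm_mem ps) map_f.
suff hol : HolC (W * N) (fun tau => t (act h (act (up (s x)) tau))).
  have hj := HolN (HolM (Hol_cst (idfun : {rmorphism R[i] -> R[i]}) _ (j == 0%N)%:R) hol).
  apply: Hol_ext (HolD (Hol_cst (idfun : {rmorphism R[i] -> R[i]}) _ (j == 1%N)%:R) hj) => tau t0.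
  rewrite coefB coefX coefC E //; case: (j == 0%N); rewrite ?mul1r ?mul0r //.
case: (s x) sN => [[a b] d] sN; have [a0 d0] := triple_gt0 N0 sN.
move: sN; rewrite mem_triples // => /andP[/eqP ad bd]; rewrite /= in a0 d0.
have hb : complex.Im (b%:R : R[i]) = 0 by rewrite -(rmorph_nat (real_complex R)).
have := Hol_affine W0 a0 d0 hb (tcusp Dh (negbT Mh)) => hol.
have Wd0 : (0 < W * d)%N by rewrite muln_gt0 W0.
have -> : (W * N = W * d * a)%N by rewrite -ad -mulnA (mulnC d).
by apply: Hol_ext (Hol_widen Wd0 a0 hol) => tau _; rewrite -act_upper.
Qed.

(** The power of q that clears the poles is the sum of the a, which equals the sum of the d and so
    the number of triples: the degree in t is at most the degree in X. At k = 0 all factors have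
    nonzero limits and the bound is attained. *)
Lemma hecke_coef k : exists P : {poly int}, [/\ (size P <= (size (triples N)).+1)%N,
  k = 0%N -> P`_(size (triples N)) != 0 &
  forall tau, H tau -> (hecke xpredT N tau)`_k = (map_poly intr P).[t tau]].
Proof.
have nE : (\sum_(p <- factorisations N) p.1)%N = size (triples N) by rewrite size_triples sum_factorisations.
have fac0 p : p \in factorisations N -> (0 < p.1)%N /\ (0 < p.2)%N.
  case: p => a d; rewrite mem_factorisations // => /eqP ad.
  by apply/andP; rewrite -muln_gt0 ad.
have E tau : \prod_(p <- factorisations N) (e tau ^+ p.1 *: hecke_factor t p.1 p.2 tau) =
    e tau ^+ size (triples N) *: hecke xpredT N tau.
  by rewrite hecke_polyE -nE hecke_poly_scaled.
have FZ j : HolZ 1 (fun tau => e tau ^+ size (triples N) * (hecke xpredT N tau)`_j).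
  have h : {in factorisations N, forall p i, xpredT p -> HolZ 1 (fun tau => (e tau ^+ p.1 *: hecke_factor t p.1 p.2 tau)`_i)}.
    by move=> p /fac0[a0 d0] i _; exact: Hol_hecke_factor.
  by apply: Hol_ext (Hol_coef_prod h j) => tau _; rewrite E coefZ.
have main c : tends_infty (fun tau => e tau ^+ size (triples N) * (hecke xpredT N tau)`_k) c ->
  exists P : {poly int}, [/\ (size P <= (size (triples N)).+1)%N, (P`_(size (triples N)))%:~R = c &
  forall tau, H tau -> (hecke xpredT N tau)`_k = (map_poly intr P).[t tau]].
  apply: (@poly_in_hauptmodul R M (W * N) t) => //.
  - by rewrite muln_gt0 W0.
  - by move=> g Dg Mg; apply: Hol_widen => //; apply: tcusp.
  - by move=> g Dg Mg tau t0; rewrite hecke_invariant.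
  exact: hecke_cusps.
have [k0|k0] := eqVneq k 0%N; last first.
  have [c /main[P [sP _ PE]]] := Hol_tends (ltn0Sn 0) (FZ k).
  by exists P; split=> // /eqP; rewrite (negPf k0).
suff [c c0 /main[P [sP Pc PE]]] : exists2 c, c != 0 &
    tends_infty (fun tau => e tau ^+ size (triples N) * (hecke xpredT N tau)`_k) c.
  by exists P; split=> // _; move: c0; rewrite -Pc intr_eq0.
suff [c c0 hc] : exists2 c, c != 0 &
    tends_infty (fun tau => (\prod_(p <- factorisations N) (e tau ^+ p.1 *: hecke_factor t p.1 p.2 tau))`_0) c.
  by exists c => //; apply: tends_infty_ext hc => tau _; rewrite E coefZ k0.
elim: (factorisations N) fac0 => [|p l IH] h.
  exists 1; first exact: oner_neq0.
  by apply: tends_infty_ext (tends_infty_cst 1) => tau _; rewrite big_nil coef1.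
have [a0 d0] := h p (mem_head _ _).
have [c c0 hc] := hecke_factor_tends t1 a0 d0.
have [|c' c'0 hc'] := IH; first by move=> q ql; apply: h; rewrite in_cons ql orbT.
exists (c * c'); first by rewrite mulf_neq0.
by apply: tends_infty_ext (tends_inftyM hc hc') => tau _; rewrite big_cons coef0M.
Qed.

Lemma exists_Phi : exists Phi, balanced Phi /\
  forall tau, H tau -> specY Phi (t tau) = hecke xpredT N tau.
Proof.
have /choice[P hP] := hecke_coef; pose n := size (triples N).
have n0 : (0 < n)%N := triples_gt0 N0.
(* The coefficient of X^n is set to 1 outright, as [hecke_coef] gives for it only a polynomial with
   value 1 at every t tau. *)
pose Phi : {poly {poly int}} := \poly_(k < n.+1) (if k == n then 1 else P k).
have sPhi : size Phi = n.+1 by rewrite size_poly_eq // eqxx oner_neq0.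
exists Phi; split.
  apply/andP; split.
    by apply/monicP; rewrite lead_coefE sPhi coef_poly ltnSn eqxx.
  rewrite /degX /degY sPhi /=.
  have P0 : Phi`_0 = P 0%N by rewrite coef_poly ltn0Sn /= ltn_eqF.
  suff -> : sizeY Phi = n.+1 by [].
  apply/anti_leq/andP; split.
    apply/bigmax_leqP => i _; rewrite coef_poly; case: ifP => // _; last by rewrite size_poly0.
    case: ifP => _; first by rewrite size_poly1.
    by case: (hP i).
  apply: leq_trans (max_size_coefXY Phi 0); rewrite P0.
  have [_ /(_ erefl) h _] := hP 0%N.
  by rewrite ltnNge; apply: contra h => /(nth_default 0)->.
move=> tau t0; apply/polyP => k; rewrite coef_specY coef_poly.
have sz : size (hecke xpredT N tau) = n.+1 by rewrite hecke_size count_predT.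
have [kn|kn] := ltnP k n.+1; last by rewrite rmorph0 horner0 nth_default // sz.
have [->|_] := eqVneq k n.
  by rewrite rmorph1 hornerC; have /monicP := hecke_monic N xpredT tau; rewrite lead_coefE sz.
by have [_ _ ->] := hP k.
Qed.

End Level.

Lemma act_scale k x tau : (0 < k)%N -> act (up (scale_triple k x)) tau = act (up x) tau :> R[i].
Proof.
move=> k0; have kC : k%:R != 0 :> R[i] by rewrite pnatr_eq0 -lt0n.
rewrite !act_upper /= !natrM -mulrA -mulrDr -mulf_div divff // mul1r //.
Qed.

(** Triples are grouped by content k; dividing one by k turns N into N / k^2 and leaves its
    transformation unchanged. *)
Lemma hecke_primitive N tau : (0 < N)%N -> hecke xpredT N tau =
  \prod_(1 <= k < N.+1 | (k ^ 2 %| N)%N) hecke (fun x => content x == 1%N) (N %/ k ^ 2) tau.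
Proof.
move=> N0; pose f x := 'X - (t (act (up x) tau))%:P.
have iotaN x : x \in triples N -> content x \in index_iota 1 N.+1.
  move=> xN; rewrite mem_index_iota (content_gt0 N0 xN) //= ltnS.
  apply: leq_trans (dvdn_leq N0 (content_square_dvd N0 xN)).
  by rewrite -[X in (X <= _)%N]muln1 -mulnn leq_mul2l (content_gt0 N0 xN) orbT.
rewrite /hecke_poly -[LHS]/(\prod_(x <- triples N) f x).
transitivity (\prod_(x <- triples N) \prod_(1 <= k < N.+1 | k == content x) f x).
  apply: eq_big_seq => x xN; by rewrite -big_filter filter_pred1_uniq ?iota_uniq ?big_seq1 //; exact: iotaN.
rewrite (exchange_big_dep xpredT) //= [RHS]big_mkcond /=.
apply: eq_big_seq => k; rewrite mem_index_iota => /andP[k0 _].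
have [kN|kN] := boolP (k ^ 2 %| N)%N; last first.
  rewrite big_seq_cond big1 // => x /andP[xN /eqP kx].
  by move: kN; rewrite kx content_square_dvd.
rewrite -big_filter -[RHS]big_filter (eq_filter (a2 := fun x => content x == k)) => [|x]; last exact: eq_sym.
rewrite (perm_big _ (triples_scale k0 N0 kN)) big_map; apply: eq_bigr => x _.
by rewrite /f act_scale.
Qed.

(* Phi_N is the product of the Psi_(N / k^2), so Psi_N is a quotient of monic polynomials. *)
Lemma exists_Psi N : (0 < N)%N -> coprime M N -> exists Psi, balanced Psi /\
  forall tau, H tau -> specY Psi (t tau) = hecke (fun x => content x == 1%N) N tau.
Proof.
have [m] := ubnP N; elim: m N => // m IHm N; rewrite ltnS => Nm N0 coMN.
have /choice[Psi hPsi] : forall k, exists Psi, (2 <= k)%N -> (k ^ 2 %| N)%N -> balanced Psi /\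
    forall tau, H tau -> specY Psi (t tau) = hecke (fun x => content x == 1%N) (N %/ k ^ 2) tau.
  move=> k; have [/andP[k2 kN]|h] := boolP ((2 <= k) && (k ^ 2 %| N))%N; last first.
    by exists 1 => k2 kN; rewrite k2 kN in h.
  have [||| Psi hPsi] := IHm (N %/ k ^ 2)%N; last by exists Psi.
  - by apply: leq_trans Nm; rewrite ltn_Pdiv // -{1}(exp1n 2) ltn_exp2r.
  - by rewrite divn_gt0 ?expn_gt0 ?(ltnW k2) // dvdn_leq.
  by apply: coprime_dvdr coMN; rewrite -{2}(divnK kN) dvdn_mulr.
pose Q := \prod_(2 <= k < N.+1 | (k ^ 2 %| N)%N) Psi k.
have bQ : balanced Q.
  rewrite /Q big_seq_cond; apply: (big_ind (fun p => is_true (balanced p))) => [|p q bp bq|k].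
  - exact: balanced1.
  - exact: balancedM.
  move=> /andP[]; rewrite mem_index_iota => /andP[k2 _] kN; by case: (hPsi k k2 kN).
have mQ : Q \is monic by case/andP: bQ.
have QE tau : H tau -> specY Q (t tau) =
    \prod_(2 <= k < N.+1 | (k ^ 2 %| N)%N) hecke (fun x => content x == 1%N) (N %/ k ^ 2) tau.
  move=> t0; rewrite /Q; pose sp : {rmorphism {poly {poly int}} -> {poly R[i]}} :=
    map_poly (horner_eval (t tau)) \o map_poly (map_poly intr).
  rewrite -[LHS]/(sp _) rmorph_prod [LHS]big_seq_cond [RHS]big_seq_cond; apply: eq_bigr.
  by move=> k /andP[]; rewrite mem_index_iota => /andP[k2 _] kN; case: (hPsi k k2 kN) => _ /(_ _ t0).
have [Phi [bPhi PhiE]] := exists_Phi N0 coMN.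
pose D := Pdiv.CommonRing.rdivp Phi Q; pose S := Pdiv.CommonRing.rmodp Phi Q.
have divE : Phi = D * Q + S := Pdiv.RingMonic.rdivp_eq mQ Phi.
have sS : (size S < size Q)%N by apply: Pdiv.CommonRing.ltn_rmodpN0; rewrite monic_neq0.
pose prim tau := hecke (fun x => content x == 1%N) N tau.
have sizeQ tau : H tau -> specY Q (t tau) \is monic /\ size (specY Q (t tau)) = size Q.
  move=> t0; have cQ : (specY Q (t tau))`_(size Q).-1 = 1.
    by rewrite coef_specY -lead_coefE (monicP mQ) rmorph1 hornerC.
  have s1 : (size (specY Q (t tau)) <= size Q)%N.
    apply/leq_sizeP => j jQ; rewrite coef_specY nth_default // rmorph0 horner0 //.
  have Q0 : (0 < size Q)%N by rewrite size_poly_gt0 monic_neq0.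
  have s2 : size (specY Q (t tau)) = size Q.
    apply/anti_leq; rewrite s1 -(prednK Q0) ltnNge; apply/negP => /(nth_default 0).
    by rewrite cQ => /eqP; rewrite oner_eq0.
  by split=> //; apply/monicP; rewrite lead_coefE s2.
have key tau : H tau -> specY D (t tau) = prim tau /\ specY S (t tau) = 0.
  move=> t0; have [mq sq] := sizeQ _ t0.
  have : specY Phi (t tau) = prim tau * specY Q (t tau).
    by rewrite PhiE // hecke_primitive // big_ltn_cond // exp1n dvd1n divn1 QE.
  have -> : specY Phi (t tau) = specY D (t tau) * specY Q (t tau) + specY S (t tau).
    by rewrite -specYM divE /specY !rmorphD.
  move=> E; have {}E : (prim tau - specY D (t tau)) * specY Q (t tau) = specY S (t tau).
    by rewrite mulrBl -E addrAC subrr add0r.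
  have sS' : (size (specY S (t tau)) < size (specY Q (t tau)))%N.
    rewrite sq; apply: leq_ltn_trans sS; apply/leq_sizeP => j jS.
    by rewrite coef_specY nth_default // rmorph0 horner0.
  (* A nonzero multiple of the monic specialisation of Q would be at least as long as Q, and S is
     shorter. *)
  have D0 : prim tau - specY D (t tau) = 0.
    apply/eqP; apply: contraTT sS' => h; rewrite -E -leqNgt (size_mul h (monic_neq0 mq)).
    by move: h; rewrite -size_poly_gt0; move: (size (prim tau - _)) (size (specY Q _)) => j k; lia.
  split; first by apply/esym/eqP; rewrite -subr_eq0 D0.
  by rewrite -E D0 mul0r.
(* The coefficients of S in X vanish at every value of t. *)
have S0 : S = 0.
  apply/polyP => k; rewrite coef0; apply: hauptmodul_poly_inj => tau t0.
  by rewrite -coef_specY (key tau t0).2 coef0.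
exists D; split; last by move=> tau /key[].
by apply: (balanced_divr bQ); move: bPhi; rewrite {1}divE S0 addr0.
Qed.

Lemma degX_specY N P (Psi : {poly {poly int}}) : balanced Psi ->
  (forall tau, H tau -> specY Psi (t tau) = hecke P N tau) -> degX Psi = count P (triples N).
Proof.
move=> /andP[mP _] h; have i0 : H 'i by rewrite /upper_half_plane /= ltr01.
have P0 : (0 < size Psi)%N by rewrite size_poly_gt0 monic_neq0.
have cP : (specY Psi (t 'i))`_(degX Psi) = 1.
  by rewrite coef_specY -lead_coefE (monicP mP) rmorph1 hornerC.
have s1 : (size (specY Psi (t 'i)) <= size Psi)%N.
  by apply/leq_sizeP => j jQ; rewrite coef_specY nth_default // rmorph0 horner0.
have s2 : (degX Psi < size (specY Psi (t 'i)))%N.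
  by rewrite ltnNge; apply/negP => /(nth_default 0); rewrite cP => /eqP; rewrite oner_eq0.
move: s1 s2; rewrite h // hecke_size /degX; case: (size Psi) P0 => // j _ /=.
by rewrite !ltnS => h1 h2; apply/anti_leq; rewrite h1 h2.
Qed.

End ModularEquation.

(** * The index of the congruence subgroup *)

(** k is the part of d made of the primes that do not divide b. A prime of d dividing b divides
    neither k nor a; one not dividing b divides k. In both cases it does not divide a k + b. *)
Lemma coprime_shift a b d : (0 < d)%N -> gcdn (gcdn a b) d = 1%N -> exists k, coprime d (a * k + b).
Proof.
move=> d0 gabd; pose pi : nat_pred := [pred p | ~~ (p %| b)%N]; exists (d`_pi)%N.
apply: contraT => nc; set q := gcdn d (a * d`_pi + b) in nc.
have q1 : (1 < q)%N by rewrite ltn_neqAle eq_sym nc gcdn_gt0 d0.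
have pp := pdiv_prime q1; have pq := pdiv_dvd q; set p := pdiv q in pp pq.
have pd : (p %| d)%N := dvdn_trans pq (dvdn_gcdl _ _).
have pakb : (p %| a * d`_pi + b)%N := dvdn_trans pq (dvdn_gcdr _ _).
have [pb|pb] := boolP (p %| b)%N; last first.
  have pk : (p %| d`_pi)%N.
    have : p \in primes d`_pi by rewrite primes_part mem_filter /= unfold_in /= pb mem_primes pp d0 pd.
    by rewrite mem_primes => /and3P[].
  by move: pakb; rewrite dvdn_addr ?dvdn_mull // (negPf pb).
move: pakb; rewrite dvdn_addl // Euclid_dvdM // => /orP[pa|pk].
  have : (p %| gcdn (gcdn a b) d)%N by rewrite !dvdn_gcd pa pb pd.
  by rewrite gabd dvdn1 => /eqP p1; rewrite p1 in pp.
have : p \in primes d`_pi by rewrite mem_primes pp pk part_gt0.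
by rewrite primes_part mem_filter unfold_in /= pb.
Qed.

Section Index.
Variables (N : nat) (N0 : (0 < N)%N).

Definition primitive_triples := [seq x <- triples N | content x == 1%N].

(** The content divides the bottom row of diag(N, 1) g, which is that of g, and hence det g = 1. *)
Lemma coset_triple_primitive g : det2 g = 1 -> coset_triple N0 g \in primitive_triples.
Proof.
move=> Dg; have [xN [h Dh E]] := coset_tripleP N0 Dg; rewrite mem_filter xN andbT.
move: (coset_triple N0 g) E xN => x E _; have dv : (content x %| det2 g)%Z.
  have da : (content x %| x.1.1%:Z)%Z by rewrite dvdzE /content /= (dvdn_trans (dvdn_gcdl _ _)) ?dvdn_gcdl.
  have db : (content x %| x.1.2%:Z)%Z by rewrite dvdzE /content /= (dvdn_trans (dvdn_gcdl _ _)) ?dvdn_gcdr.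
  have dd : (content x %| x.2%:Z)%Z by rewrite dvdzE /content /= dvdn_gcdr.
  move: E; case: g {Dg} => g1 g2 g3 g4; rewrite /det2 /mul2 /= !mul0r !mul1r !add0r => -[_ _ -> ->].
  rewrite mulr0 addr0; apply: rpredB; apply: dvdz_mull; first apply: rpredD; exact: dvdz_mull.
by move: dv; rewrite Dg dvdzE /= dvdn1.
Qed.

(** The first row of h up(a, b, d) must be divisible by N. The row (-d, a k + b) of h achieves this,
    giving (-N, N k), and it can be completed to determinant 1 because d and a k + b are coprime. *)
Lemma coset_triple_surj x : x \in primitive_triples -> exists g, det2 g = 1 /\ coset_triple N0 g = x.
Proof.
case: x => [[a b] d]; rewrite mem_filter => /andP[/eqP cx xN].
have [a0 d0] := triple_gt0 N0 xN; rewrite /= in a0 d0.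
have [k ck] := coprime_shift d0 cx.
have /coprimezP[[u v] /= uv] : coprimez d (a * k + b)%N by rewrite /coprimez /gcdz /=.
pose g := Mat2 (- 1) k (- v * a) (- v * b - u * d).
pose h := Mat2 (- d%:Z) (a * k + b)%N (- v) (- u).
have Dh : det2 h = 1 by rewrite -uv /det2 /= ; ring.
have Dg : det2 g = 1 by rewrite -uv /det2 /= PoszD PoszM; ring.
have E : mul2 (Mat2 N 0 0 1) g = mul2 h (up (a, b, d)).
  have NE : N%:Z = a%:Z * d%:Z by move: xN; rewrite mem_triples // => /andP[/eqP<- _]; rewrite PoszM.
  by rewrite /mul2 /= NE PoszD PoszM; congr Mat2; ring.
exists g; split=> //; have [yN [h' Dh' E']] := coset_tripleP N0 Dg.
apply: (hermite_uniq (k := mul2 (adj2 h) h') N0 yN xN); first by rewrite det2M det2_adj Dh Dh'.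
by rewrite -mul2A -E' E mul2A mul2_adjl // mul2_1l.
Qed.

Definition to2 (g : 'M[int]_2) := Mat2 (g 0 0) (g 0 1) (g 1 0) (g 1 1).
Definition of2 (g : mat2) : 'M[int]_2 :=
  \matrix_(i, j) if i == 0 then (if j == 0 then m11 g else m12 g) else (if j == 0 then m21 g else m22 g).

Lemma of2K : cancel of2 to2.
Proof. by case=> a b c d; rewrite /to2 /of2 !mxE. Qed.

Lemma to2_inj : injective to2.
Proof.
move=> g h [E1 E2 E3 E4]; apply/matrixP => i j.
have two (k : 'I_2) : k = 0 \/ k = 1.
  by case: k => [[|[|k]] lt] //; [left|right]; apply: val_inj.
by case: (two i) => ->; case: (two j) => ->.
Qed.

Lemma to2M g h : to2 (g *m h) = mul2 (to2 g) (to2 h).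
Proof.
have l1 : lift ord0 ord0 = 1 :> 'I_2 by apply: val_inj.
by rewrite /to2 /mul2 !mxE !big_ord_recl !big_ord0 !addr0 !l1.
Qed.

Lemma det_to2 (g : 'M[int]_2) : \det g = det2 (to2 g).
Proof.
have l1 : lift ord0 ord0 = 1 :> 'I_2 by apply: val_inj.
rewrite (expand_det_row g 0) !big_ord_recl big_ord0 addr0 /cofactor !det_mx11 !mxE /= !l1.
have -> : lift 1 0 = 0 :> 'I_2 by apply: val_inj.
by rewrite /det2 /= expr0 mul1r expr1 mulN1r mulrN.
Qed.

Lemma SL2Z_to2 g : SL2Z g <-> det2 (to2 g) = 1.
Proof. by rewrite /SL2Z /= det_to2. Qed.

Lemma card_uniq_seq (T : eqType) (s : seq T) : uniq s -> ([set x | x \in s] #= `I_(size s))%card.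
Proof.
case: s => [_|x0 s us]; first by rewrite (_ : [set x | x \in [::]] = set0) ?II0 // -subset0 => x.
have -> : [set x | x \in x0 :: s] = nth x0 (x0 :: s) @` `I_(size (x0 :: s)).
  apply/seteqP; split=> [x /= xs|_ /= [i /= lt <-]]; last exact: mem_nth.
  exists (index x (x0 :: s)); last by rewrite nth_index.
  by rewrite -index_mem in xs.
apply: inj_card_eq => i j; rewrite !inE /= => li lj /eqP.
by rewrite nth_uniq // => /eqP.
Qed.

Lemma index_Gamma0 : has_index SL2Z (Gamma0 N) (size primitive_triples).
Proof.
have /choice[rep hrep] : forall x, exists g, x \in primitive_triples -> det2 g = 1 /\ coset_triple N0 g = x.
  move=> x; have [xN|_] := boolP (x \in primitive_triples); last by exists (Mat2 1 0 0 1).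
  by have [g hg] := coset_triple_surj xN; exists g.
pose coset (g : 'M[int]_2) := [set h *m g | h in Gamma0 N].
have coset_eq g g' : SL2Z g -> SL2Z g' -> coset_triple N0 (to2 g) = coset_triple N0 (to2 g') -> coset g `<=` coset g'.
  move=> /SL2Z_to2 Dg /SL2Z_to2 Dg' /esym/eqP; rewrite coset_triple_eq // => Ng _ [h [/SL2Z_to2 Dh Nh] <-].
  have Dk : det2 (mul2 (to2 g) (adj2 (to2 g'))) = 1 by rewrite det2M det2_adj Dg Dg'.
  exists (h *m of2 (mul2 (to2 g) (adj2 (to2 g')))); last first.
    by apply: to2_inj; rewrite !to2M of2K -!mul2A mul2_adjl // mul2_1r.
  split; first by apply/SL2Z_to2; rewrite to2M of2K det2M Dh Dk.
  have -> (k : 'M[int]_2) : k 1 0 = m21 (to2 k) by [].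
  rewrite to2M of2K; move: Ng; move: (mul2 _ (adj2 _)) => [k1 k2 k3 k4] /= Ng.
  by apply: rpredD; [apply: dvdz_mulr|apply: dvdz_mull].
have cosets : right_cosets SL2Z (Gamma0 N) = (fun x => coset (of2 (rep x))) @` [set x | x \in primitive_triples].
  apply/seteqP; split=> [_ [g Sg <-]|_ [x xN <-]]; last first.
    by exists (of2 (rep x)) => //; apply/SL2Z_to2; rewrite of2K; case: (hrep x xN).
  have Dg := (SL2Z_to2 g).1 Sg; have xN := coset_triple_primitive Dg.
  have [Dr rE] := hrep _ xN; have Sr : SL2Z (of2 (rep (coset_triple N0 (to2 g)))) by apply/SL2Z_to2; rewrite of2K.
  by exists (coset_triple N0 (to2 g)) => //; apply/seteqP; split; apply: coset_eq => //; rewrite of2K.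
rewrite /has_index cosets; apply: card_eq_trans (card_uniq_seq _); last exact/filter_uniq/triples_uniq.
apply: inj_card_eq => x y; rewrite !inE => xN yN E.
have [Dx xE] := hrep x xN; have [Dy yE] := hrep y yN.
have : coset (of2 (rep y)) (of2 (rep y)).
  exists 1%:M; last by rewrite mul1mx.
  by split; [rewrite /SL2Z /= det1|rewrite mxE].
rewrite -E => -[h [_ Nh]] /(congr1 to2); rewrite to2M !of2K => rE.
rewrite -xE -yE; apply/eqP; rewrite coset_triple_eq // -rE -mul2A mul2_adj // mul2_1r.
exact: Nh.
Qed.

End Index.

Lemma modular_productE (R : realType) (P : nat -> nat -> nat -> bool) N (t : R[i] -> R[i]) tau :
  modular_product P N t tau = hecke_poly t (fun x => P x.1.1 x.1.2 x.2) N tau.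
Proof.
rewrite /hecke_poly big_mkcond big_allpairs_dep big_filter big_mkcond big_allpairs /=.
apply: eq_bigr => a _; rewrite big_mkcond; apply: eq_bigr => d _ /=; case: ifP => // _.
by rewrite big_mkcond; apply: eq_bigr => b _; rewrite act_upper.
Qed.

Theorem theorem2p9 (R : realType) (M N : nat)
    (hM : M \in [:: 2; 3; 4; 5; 6; 7; 8; 9; 10; 12; 13; 16; 18; 25]%N)
    (hN : (0 < N)%N) (hMN : coprime M N) :
  exists Phi Psi : {poly {poly int}},
    (forall tau : R[i], upper_half_plane tau ->
       specY Phi (hauptmodul M tau) =
         modular_product (fun _ _ _ => true) N (hauptmodul M) tau /\
       specY Psi (hauptmodul M tau) =
         modular_product (fun a b d => gcdn (gcdn a b) d == 1)%N N
           (hauptmodul M) tau) /\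
    degX Phi = degY Phi /\
    degX Psi = degY Psi /\
    has_index SL2Z (Gamma0 N) (degX Psi).
Proof.
have /andP[ok cert] := levels_ok hM; have M0 := ltnW (level_gt1 ok).
have tinv : invariant0 M (etaq (R := R) (exponents M)).
  by move=> g Dg Mg tau t0; apply: etaq_invariant cert Dg Mg tau t0.
have tcusp : cusps_regular M (24 * M) (etaq (R := R) (exponents M)).
  by move=> g Dg Mg; apply: Hol_etaq_cusp.
have W0 : (0 < 24 * M)%N by rewrite muln_gt0.
have tZ := Hol_etaq (R := R) ok; have t1 := tends_infty_etaq (R := R) ok.
have [Phi [bPhi PhiE]] := exists_Phi M0 W0 tinv tcusp tZ t1 hN hMN.
have [Psi [bPsi PsiE]] := exists_Psi M0 W0 tinv tcusp tZ t1 hN hMN.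
have -> : @hauptmodul R M = etaq (exponents M) by apply/funext; apply: hauptmodulE.
exists Phi, Psi; split; [|split; [|split]].
- by move=> tau t0; rewrite !modular_productE PhiE // PsiE.
- by case/andP: bPhi => _ /eqP.
- by case/andP: bPsi => _ /eqP.
by rewrite (degX_specY bPsi PsiE) -size_filter; apply: index_Gamma0.
Qed.
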